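(* Let $K$ be an algebraically closed field, let $\Lambda$ be a finite-dimensional basic $K$-algebra, let $X_1,\ldots,X_r$ be a set of simple-minded objects in $\mathcal{D}^b(\mathrm{mod}\,\Lambda)$, let $T_1,\ldots,T_r$ be the objects obtained from $X_1,\ldots,X_r$ by Rickard's construction, and let $\nu^{-1}T=\bigoplus_{i=1}^r\nu^{-1}T_i$, where $\nu^{-1}$ is the inverse Nakayama functor. Then the following assertions are equivalent: (i) $\nu^{-1}T$ is a tilting complex; (ii) $\nu^{-1}T$ is in the heart of some $t$-structure on $\mathcal{D}(\mathrm{Mod}\,\Lambda)$.
   Context: $\mathrm{Mod}\,\Lambda$ (resp. $\mathrm{mod}\,\Lambda$) is the category of right (resp. finite-dimensional right) $\Lambda$-modules; $\mathcal{D}(\mathrm{Mod}\,\Lambda)$ is the unbounded derived category, and $\mathcal{D}^b(\mathrm{mod}\,\Lambda)$, $\mathcal{D}^-(\mathrm{mod}\,\Lambda)$ (bounded, bounded above) are viewed as triangulated subcategories of it. $\Sigma$ is the suspension (shift), $\mathrm{Hom}$ is taken in $\mathcal{D}(\mathrm{Mod}\,\Lambda)$. $\mathrm{thick}(\mathcal{S})$ is the smallest triangulated subcategory containing $\mathcal{S}$ and stable under direct summands. $\mathrm{per}(\Lambda)=\mathrm{thick}(\Lambda_\Lambda)$. Simple-minded objects: let $r$ be the rank of the Grothendieck group of $\mathrm{mod}\,\Lambda$. Objects $X_1,\ldots,X_r$ of $\mathcal{D}^b(\mathrm{mod}\,\Lambda)$ are simple-minded if (1) $\mathrm{Hom}(X_i,\Sigma^mX_j)=0$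 for all $m<0$ and all $i,j$; (2) $\mathrm{Hom}(X_i,X_j)=K$ if $i=j$ and $0$ otherwise; (3) $\mathcal{D}^b(\mathrm{mod}\,\Lambda)=\mathrm{thick}(X_1,\ldots,X_r)$. Rickard's construction: set $X_i^{(0)}=X_i$. Given $X_i^{(n-1)}$, for $1\le j\le r$ and $m<0$ let $B(j,m,i)$ be a basis of $\mathrm{Hom}(\Sigma^mX_j,X_i^{(n-1)})$, put $Z_i^{(n-1)}=\bigoplus_{m<0}\bigoplus_j\bigoplus_{B(j,m,i)}\Sigma^mX_j$, and let $\alpha_i^{(n-1)}:Z_i^{(n-1)}\to X_i^{(n-1)}$ be the map whose component corresponding to $f\in B(j,m,i)$ is $f$. Let $X_i^{(n)}$ be a cone of $\alpha_i^{(n-1)}$, with triangle $Z_i^{(n-1)}\to X_i^{(n-1)}\xrightarrow{\beta_i^{(n-1)}}X_i^{(n)}\to\Sigma Z_i^{(n-1)}$. Then $T_i$ is the Milnor colimit of $X_i^{(0)}\xrightarrow{\beta_i^{(0)}}X_i^{(1)}\xrightarrow{\beta_i^{(1)}}\cdots$, i.e. there is a triangle $\bigoplus_{n\ge0}X_i^{(n)}\xrightarrow{\mathrm{id}-\beta}\bigoplus_{n\ge0}X_i^{(n)}\to T_i\to\Sigma\bigoplus_{n\ge0}X_i^{(n)}$. By a result of Rickard each $T_i$ is isomorphic to a bounded complex of finitely generated injective $\Lambda$-modules, and $T_i$ is taken to be such a complex. Nakayama functor: with $\mathrm{D}=\mathrm{Hom}_K(?,K)$, the Nakayama functor $\nu:\mathrm{per}(\Lambda)\to\mathrm{thick}(\mathrm{D}({}_\Lambda\Lambda))$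 is a triangle equivalence with quasi-inverse $\nu^{-1}$ (induced by applying $\nu=\mathrm{D}\mathrm{Hom}_\Lambda(?,\Lambda)$ to complexes of finitely generated projectives, and $\nu^{-1}=\mathrm{Hom}_\Lambda(\mathrm{D}({}_\Lambda\Lambda),?)$ to complexes of finitely generated injectives). A tilting complex is an object $P\in\mathrm{per}(\Lambda)$ with $\mathrm{Hom}(P,\Sigma^mP)=0$ for all $m\ne0$ and $\mathrm{thick}(P)=\mathrm{per}(\Lambda)$. A $t$-structure on a triangulated category $\mathcal{C}$ is a pair $(\mathcal{C}^{\le0},\mathcal{C}^{\ge0})$ of strictly full subcategories with $\Sigma\mathcal{C}^{\le0}\subseteq\mathcal{C}^{\le0}$, $\Sigma^{-1}\mathcal{C}^{\ge0}\subseteq\mathcal{C}^{\ge0}$; $\mathrm{Hom}(M,\Sigma^{-1}N)=0$ for $M\in\mathcal{C}^{\le0}$, $N\in\mathcal{C}^{\ge0}$; and for each $M\in\mathcal{C}$ a triangle $M'\to M\to M''\to\Sigma M'$ with $M'\in\mathcal{C}^{\le0}$, $M''\in\Sigma^{-1}\mathcal{C}^{\ge0}$. Its heart is $\mathcal{C}^{\le0}\cap\mathcal{C}^{\ge0}$. *)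

(* Defs.v *)
From HB Require Import structures.
From mathcomp Require Import all_boot all_order all_algebra falgebra.
From mathcomp Require Import boolp.

Set Implicit Arguments.
Unset Strict Implicit.
Unset Printing Implicit Defensive.

Import GRing.Theory.
Local Open Scope ring_scope.

Definition mklin (R : nzRingType) (U V : lmodType R) (f : U -> V)
    (fl : linear f) : {linear U -> V} :=
  HB.pack f (GRing.isLinear.Build R U V *:%R f fl).

Section Complexes.
Variable R : nzRingType.

(* The differential is given for all pairs of degrees and vanishes off
   [j = i + 1]; this avoids transports along equalities between degrees when
   complexes are shifted. *)
Record cplx := Cplx {
  obj :> int -> lmodType R;
  dif : forall i j, {linear obj i -> obj j};
  dif_shape : forall i j, j != i + 1 -> forall x, dif i j x = 0;
  dif_dif : forall i j k x, dif j k (dif i j x) = 0 }.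

Record chmap (X Y : cplx) := Chmap {
  cm :> forall i, {linear X i -> Y i};
  cm_dif : forall i j x, cm j (dif X i j x) = dif Y i j (cm i x) }.

Lemma cm_id_dif (X : cplx) i j x :
  (idfun : {linear X j -> X j}) (dif X i j x) =
  dif X i j ((idfun : {linear X i -> X i}) x).
Proof. by []. Qed.
Definition cm_id (X : cplx) : chmap X X := Chmap (@cm_id_dif X).

Lemma cm_comp_dif (X Y Z : cplx) (g : chmap Y Z) (f : chmap X Y) i j x :
  (g j \o f j) (dif X i j x) = dif Z i j ((g i \o f i) x).
Proof. by rewrite /= !cm_dif. Qed.
Definition cm_comp (X Y Z : cplx) (g : chmap Y Z) (f : chmap X Y) :
    chmap X Z :=
  @Chmap X Z (fun i => (g i \o f i : {linear X i -> Z i}))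
         (cm_comp_dif g f).

Lemma cm_zero_dif (X Y : cplx) i j x :
  (\0 : {linear X j -> Y j}) (dif X i j x) =
  dif Y i j ((\0 : {linear X i -> Y i}) x).
Proof. by rewrite /= raddf0. Qed.
Definition cm_zero (X Y : cplx) : chmap X Y := Chmap (@cm_zero_dif X Y).

Lemma cm_add_dif (X Y : cplx) (f g : chmap X Y) i j x :
  (f j \+ g j) (dif X i j x) = dif Y i j ((f i \+ g i) x).
Proof. by rewrite /= !cm_dif raddfD. Qed.
Definition cm_add (X Y : cplx) (f g : chmap X Y) : chmap X Y :=
  @Chmap X Y (fun i => (f i \+ g i : {linear X i -> Y i})) (cm_add_dif f g).

Definition homotopic (X Y : cplx) (f g : chmap X Y) : Prop :=
  exists h : forall i j, {linear X i -> Y j}, forall i (x : X i),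
    f i x - g i x =
      dif Y (i - 1) i (h i (i - 1) x) + h (i + 1) i (dif X i (i + 1) x).

Definition cocycle (X : cplx) i (x : X i) : Prop := forall j, dif X i j x = 0.
Definition coboundary (X : cplx) j (x : X j) : Prop :=
  exists i (y : X i), x = dif X i j y.

Definition quasi_iso (X Y : cplx) (f : chmap X Y) : Prop :=
  (forall i (x : X i), cocycle x -> coboundary (f i x) -> coboundary x) /\
  (forall i (y : Y i), cocycle y ->
     exists2 x : X i, cocycle x & coboundary (y - f i x)).

Lemma quasi_iso_id X : quasi_iso (cm_id X).
Proof.
split=> // i y cy; exists y => //=; rewrite subrr.
by exists i, 0; rewrite raddf0.
Qed.

Lemma cocycle_cm X Y (f : chmap X Y) i (x : X i) :
  cocycle x -> cocycle (f i x).
Proof. by move=> cx j; rewrite -cm_dif cx raddf0. Qed.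

Lemma coboundaryP (X : cplx) i (x : X i) :
  coboundary x -> exists y, x = dif X (i - 1) i y.
Proof.
case=> k [y ->]; have [e|ne] := eqVneq i (k + 1); last first.
  by exists 0; rewrite raddf0 dif_shape.
have ek : k = i - 1 by rewrite e addrK.
by rewrite {i}e in x ek *; case: _ / ek; exists y.
Qed.

Lemma coboundaryD (X : cplx) i (x y : X i) :
  coboundary x -> coboundary y -> coboundary (x + y).
Proof.
move=> /coboundaryP[u ->] /coboundaryP[v ->].
by exists (i - 1), (u + v); rewrite raddfD.
Qed.

Lemma coboundary_cm X Y (f : chmap X Y) i (x : X i) :
  coboundary x -> coboundary (f i x).
Proof. by case=> k [y ->]; exists k, (f k y); rewrite cm_dif. Qed.

Lemma quasi_iso_comp X Y Z (g : chmap Y Z) (f : chmap X Y) :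
  quasi_iso g -> quasi_iso f -> quasi_iso (cm_comp g f).
Proof.
move=> [gi gs] [fi fs]; split=> [i x cx bx|i z cz].
  by apply: fi => //; apply: gi => //; apply: cocycle_cm.
have [y cy bz] := gs i z cz; have [x cx bx] := fs i y cy.
exists x => //=; have -> : z - g i (f i x) = (z - g i y) + g i (y - f i x).
  by rewrite raddfB /= addrA subrK.
by apply: coboundaryD => //; apply: coboundary_cm.
Qed.

(* [shift n X] is $\Sigma^n X$, with differential $(-1)^n d$. *)
Section Shift.
Variable n : int.

Definition shift_dif (X : cplx) i j :
    {linear X (i + n) -> X (j + n)} :=
  if odd `|n|%N then (\- dif X (i + n) (j + n) : {linear _ -> _})
  else dif X (i + n) (j + n).

Lemma shift_shape X i j : j != i + 1 -> forall x, shift_dif X i j x = 0.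
Proof.
move=> ne x; have ne' : j + n != i + n + 1 by rewrite addrAC (inj_eq (addIr n)).
by rewrite /shift_dif; case: ifP => _ /=; rewrite dif_shape // oppr0.
Qed.

Lemma shift_dif_dif X i j k x : shift_dif X j k (shift_dif X i j x) = 0.
Proof.
by rewrite /shift_dif; case: ifP => _ /=; rewrite ?raddfN /= dif_dif ?oppr0.
Qed.

Definition shift (X : cplx) : cplx :=
  @Cplx (fun i => X (i + n)) (shift_dif X) (@shift_shape X) (@shift_dif_dif X).

Lemma cm_shift_dif X Y (f : chmap X Y) i j x :
  f (j + n) (dif (shift X) i j x) = dif (shift Y) i j (f (i + n) x).
Proof.
by rewrite /= /shift_dif; case: ifP => _ /=; rewrite ?raddfN /= cm_dif.
Qed.
Definition cm_shift X Y (f : chmap X Y) : chmap (shift X) (shift Y) :=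
  @Chmap (shift X) (shift Y) (fun i => f (i + n)) (cm_shift_dif f).

Lemma shift_cocycle X i (x : shift X i) :
  @cocycle (shift X) i x <-> @cocycle X (i + n) x.
Proof.
split=> cx j; last first.
  by rewrite /= /shift_dif; case: ifP => _ /=; rewrite cx ?oppr0.
have := cx (j - n); rewrite /= /shift_dif; have := subrK n j.
move: (j - n + n) => k ->; case: ifP => _ //= /eqP.
by rewrite oppr_eq0 => /eqP.
Qed.

Lemma shift_coboundary X i (x : shift X i) :
  @coboundary (shift X) i x <-> @coboundary X (i + n) x.
Proof.
split=> [[k [y ->]]|[k [y ->]]].
  rewrite /= /shift_dif; case: ifP => _ /=; last by exists (k + n), y.
  by exists (k + n), (- y); rewrite raddfN.
suff [z ->] : exists z : X (k - n + n), dif X k (i + n) y =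
    dif X (k - n + n) (i + n) z.
  exists (k - n); rewrite /= /shift_dif; case: ifP => _; last by exists z.
  by exists (- z); rewrite /= raddfN /= opprK.
by have := subrK n k; move: (k - n + n) => l ->; exists y.
Qed.

Lemma quasi_iso_shift X Y (f : chmap X Y) :
  quasi_iso f -> quasi_iso (cm_shift f).
Proof.
move=> [fi fs]; split=> [i x /shift_cocycle cx /shift_coboundary bx|].
  by apply/shift_coboundary; apply: fi.
move=> i y /shift_cocycle cy; have [x cx bx] := fs _ _ cy.
by exists x; [apply/shift_cocycle|apply/shift_coboundary].
Qed.
End Shift.

Definition transport (X : int -> lmodType R) i j : {linear X i -> X j} :=
  if i =P j is ReflectT e
  then ecast k {linear X i -> X k} e (idfun : {linear X i -> X i}) else \0.

Lemma transport_id X i x : transport X i i x = x.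
Proof. by rewrite /transport; case: eqP => // e; rewrite eq_axiomK. Qed.

Lemma transport_neq X i j x : i != j -> transport X i j x = 0.
Proof. by rewrite /transport; case: eqP. Qed.

Lemma transport_dif (X : cplx) i j k x :
  transport X j k (dif X i j x) = dif X (j - 1) k (transport X i (j - 1) x).
Proof.
have [ei|nei] := eqVneq i (j - 1); last first.
  rewrite (transport_neq _ nei) dif_shape ?raddf0 //.
  by apply: contra_neq nei => ->; rewrite addrK.
rewrite {i}ei in x *; rewrite transport_id.
have [ek|nek] := eqVneq j k; first by rewrite -{k}ek transport_id.
by rewrite transport_neq // dif_shape // subrK eq_sym.
Qed.

Section Cone.
Variables (X Y : cplx) (f : chmap X Y).

Definition cone_obj (i : int) : lmodType R := (X (i + 1)%R * Y i)%type.

Definition cone_fun i j (p : cone_obj i) : cone_obj j :=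
  (- dif X (i + 1) (j + 1) p.1,
   transport Y (i + 1) j (f (i + 1) p.1) + dif Y i j p.2).

Lemma cone_linear i j : linear (@cone_fun i j).
Proof.
move=> a p q; congr pair => /=; first by rewrite linearP scalerN opprD.
by rewrite !linearP /= scalerDr addrACA.
Qed.

Definition cone_dif i j : {linear cone_obj i -> cone_obj j} :=
  mklin (@cone_linear i j).

Lemma cone_shape i j : j != i + 1 -> forall x, cone_dif i j x = 0.
Proof.
move=> ne p; congr pair => /=.
  by rewrite dif_shape ?oppr0 // (inj_eq (addIr 1)).
by rewrite transport_neq 1?eq_sym // dif_shape // addr0.
Qed.

Lemma cone_dif_dif i j k x : cone_dif j k (cone_dif i j x) = 0.
Proof.
congr pair => /=; first by rewrite raddfN /= dif_dif !oppr0.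
rewrite raddfN /= cm_dif raddfN /= raddfD /= dif_dif addr0.
have [ej|nej] := eqVneq j (i + 1); last first.
  rewrite transport_neq 1?eq_sym // raddf0 addr0.
  by rewrite dif_shape ?raddf0 ?oppr0 // (inj_eq (addIr 1)).
rewrite {j}ej; rewrite transport_id.
have [ek|nek] := eqVneq k (i + 1 + 1).
  by rewrite {k}ek transport_id addNr.
by rewrite transport_neq 1?eq_sym // dif_shape // oppr0 addr0.
Qed.

Definition cone : cplx := Cplx cone_shape cone_dif_dif.

Lemma cone_in_linear i : linear (fun y : Y i => (0, y) : cone i).
Proof. by move=> a y z; congr pair => /=; rewrite scaler0 addr0. Qed.
Lemma cone_in_dif i j y :
  mklin (@cone_in_linear j) (dif Y i j y) =
  dif cone i j (mklin (@cone_in_linear i) y).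
Proof. by congr pair => /=; rewrite !raddf0 ?oppr0 ?add0r. Qed.
Definition cone_in : chmap Y cone := Chmap cone_in_dif.

Lemma cone_out_linear i : linear (fun p : cone i => p.1 : shift 1 X i).
Proof. by []. Qed.
Lemma cone_out_dif i j p :
  mklin (@cone_out_linear j) (dif cone i j p) =
  dif (shift 1 X) i j (mklin (@cone_out_linear i) p).
Proof. by []. Qed.
Definition cone_out : chmap cone (shift 1 X) := Chmap cone_out_dif.
End Cone.

(* The homotopy pullback of [f : W -> Y] and [t : V -> Y]; it provides the
   common denominators of the calculus of fractions. *)
Section HomotopyPullback.
Variables (W V Y : cplx) (f : chmap W Y) (t : chmap V Y).

Definition hpull_obj (i : int) : lmodType R := (W i * V i * Y (i - 1)%R)%type.

Definition hpull_fun i j (p : hpull_obj i) : hpull_obj j :=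
  (dif W i j p.1.1, dif V i j p.1.2,
   transport Y i (j - 1) (f i p.1.1 - t i p.1.2)
     - dif Y (i - 1) (j - 1) p.2).

Lemma hpull_linear i j : linear (@hpull_fun i j).
Proof.
move=> a p q; congr pair => /=; first by congr pair => /=; rewrite linearP.
have E (U : lmodType R) (A B C D : U) :
    a *: A + B - (a *: C + D) = a *: (A - C) + (B - D).
  by rewrite scalerBr opprD addrACA.
rewrite (linearP (f i)) (linearP (t i)) /= (E (Y i)).
by rewrite (linearP (transport Y _ _)) linearP /= (E (Y (j - 1))).
Qed.

Definition hpull_dif i j : {linear hpull_obj i -> hpull_obj j} :=
  mklin (@hpull_linear i j).

Lemma hpull_shape i j : j != i + 1 -> forall x, hpull_dif i j x = 0.
Proof.
move=> ne p; have ne' : i != j - 1 by rewrite eq_sym subr_eq.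
congr pair => /=; first by congr pair => /=; rewrite dif_shape.
rewrite transport_neq // dif_shape ?subr0 //.
by rewrite subrK eq_sym.
Qed.

Lemma hpull_dif_dif i j k x : hpull_dif j k (hpull_dif i j x) = 0.
Proof.
congr pair => /=; first by congr pair => /=; rewrite dif_dif.
rewrite !cm_dif -(raddfB (dif Y i j)) transport_dif.
by rewrite (raddfB (dif Y (j - 1) (k - 1))) /= dif_dif subr0 subrr.
Qed.

Definition hpull : cplx := Cplx hpull_shape hpull_dif_dif.

Lemma hpull_fst_linear i : linear (fun p : hpull i => p.1.1).
Proof. by []. Qed.
Lemma hpull_fst_dif i j p :
  mklin (@hpull_fst_linear j) (dif hpull i j p) =
  dif W i j (mklin (@hpull_fst_linear i) p).
Proof. by []. Qed.
Definition hpull_fst : chmap hpull W := Chmap hpull_fst_dif.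

Lemma hpull_snd_linear i : linear (fun p : hpull i => p.1.2).
Proof. by []. Qed.
Lemma hpull_snd_dif i j p :
  mklin (@hpull_snd_linear j) (dif hpull i j p) =
  dif V i j (mklin (@hpull_snd_linear i) p).
Proof. by []. Qed.
Definition hpull_snd : chmap hpull V := Chmap hpull_snd_dif.

Lemma quasi_iso_hpull_fst : quasi_iso t -> quasi_iso hpull_fst.
Proof.
move=> [ti ts]; split=> [i [[w v] y] cp /coboundaryP[/= w' ew]|i w cw].
  have [cv ey] : cocycle v /\ f i w - t i v = dif Y (i - 1) i y.
    split=> [j|]; first by have [] := cp j.
    have [_ _] := cp (i + 1); have := addrK 1 i; move: (i + 1 - 1) => k ->.
    by rewrite transport_id => /eqP; rewrite subr_eq0 => /eqP.
  have [v' ev] : exists v', v = dif V (i - 1) i v'.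
    apply: coboundaryP; apply: ti => //.
    exists (i - 1), (f _ w' - y); rewrite raddfB /= -cm_dif -ew -ey.
    by rewrite subKr.
  have cz : cocycle (f _ w' - t _ v' - y).
    move=> j; have [->|ne] := eqVneq j (i - 1 + 1); last by rewrite dif_shape.
    by rewrite subrK !raddfB /= -!cm_dif -ew -ev ey subrr.
  have [v2 cv2 /coboundaryP[y2 ey2]] := ts _ _ cz.
  exists (i - 1), (w', v' + v2, y2); congr pair => /=.
    by congr pair => //; rewrite raddfD /= cv2 addr0.
  rewrite transport_id -ey2 raddfD /= opprD addrA.
  by rewrite [_ - y - _]addrAC subKr.
have cfw : cocycle (f i w) by apply: cocycle_cm.
have [v cv /coboundaryP[y ey]] := ts _ _ cfw.
exists (w, v, y) => [j|]; last first.
  by exists i, 0; rewrite /= subrr raddf0.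
have [->|ne] := eqVneq j (i + 1); last exact: hpull_shape.
congr pair => /=; first by congr pair => /=; rewrite ?cw ?cv.
by have := addrK 1 i; move: (i + 1 - 1) => k ->; rewrite transport_id ey subrr.
Qed.
End HomotopyPullback.

(* Morphisms of the derived category are roofs [X <- apex -> Y] whose left leg
   is a quasi-isomorphism, compared by [deq]; no quotient is taken. *)
Record dhom (X Y : cplx) := Roof {
  apex : cplx;
  den : chmap apex X;
  num : chmap apex Y;
  den_quasi_iso : quasi_iso den }.

Definition deq (X Y : cplx) (a b : dhom X Y) : Prop :=
  exists (W : cplx) (u : chmap W (apex a)) (v : chmap W (apex b)),
    [/\ quasi_iso (cm_comp (den a) u),
        homotopic (cm_comp (den a) u) (cm_comp (den b) v) &
        homotopic (cm_comp (num a) u) (cm_comp (num b) v)].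

Definition dlift (X Y : cplx) (f : chmap X Y) : dhom X Y :=
  Roof f (quasi_iso_id X).

Definition did (X : cplx) : dhom X X := dlift (cm_id X).

Definition dzero (X Y : cplx) : dhom X Y := dlift (cm_zero X Y).

Definition dcomp (X Y Z : cplx) (b : dhom Y Z) (a : dhom X Y) : dhom X Z :=
  Roof (cm_comp (num b) (hpull_snd (num a) (den b)))
    (quasi_iso_comp (den_quasi_iso a)
       (quasi_iso_hpull_fst (num a) (den_quasi_iso b))).

Definition dadd (X Y : cplx) (a b : dhom X Y) : dhom X Y :=
  Roof (cm_add (cm_comp (num a) (hpull_fst (den a) (den b)))
               (cm_comp (num b) (hpull_snd (den a) (den b))))
    (quasi_iso_comp (den_quasi_iso a)
       (quasi_iso_hpull_fst (den a) (den_quasi_iso b))).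

Definition dshift (n : int) (X Y : cplx) (a : dhom X Y) :
    dhom (shift n X) (shift n Y) :=
  Roof (cm_shift n (num a)) (quasi_iso_shift n (den_quasi_iso a)).

Definition is_diso (X Y : cplx) (a : dhom X Y) : Prop :=
  exists b : dhom Y X, deq (dcomp b a) (did X) /\ deq (dcomp a b) (did Y).

Definition diso (X Y : cplx) : Prop := exists a : dhom X Y, is_diso a.

Definition is_coprod (I : Type) (A : I -> cplx) (S : cplx)
    (inj : forall i, dhom (A i) S) : Prop :=
  forall (Y : cplx) (f : forall i, dhom (A i) Y),
    (exists g : dhom S Y, forall i, deq (dcomp g (inj i)) (f i)) /\
    (forall g g' : dhom S Y,
       (forall i, deq (dcomp g (inj i)) (dcomp g' (inj i))) -> deq g g').

Definition triangle (X Y Z : cplx) (f : dhom X Y) (g : dhom Y Z)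
    (h : dhom Z (shift 1 X)) : Prop :=
  exists (A B : cplx) (u : chmap A B)
         (a : dhom X A) (b : dhom Y B) (c : dhom Z (cone u)),
    [/\ is_diso a, is_diso b & is_diso c] /\
    [/\ deq (dcomp b f) (dcomp (dlift u) a),
        deq (dcomp c g) (dcomp (dlift (cone_in u)) b) &
        deq (dcomp (dshift 1 a) h) (dcomp (dlift (cone_out u)) c)].

Definition strictly_full (P : cplx -> Prop) : Prop :=
  forall X Y, diso X Y -> P X -> P Y.

Definition triangulated_subcat (P : cplx -> Prop) : Prop :=
  [/\ strictly_full P, exists X, P X,
      forall X, P X -> P (shift 1 X) /\ P (shift (- 1) X) &
      forall X Y Z (f : dhom X Y) (g : dhom Y Z) (h : dhom Z (shift 1 X)),
        triangle f g h -> P X -> P Y -> P Z].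

Definition summand_closed (P : cplx -> Prop) : Prop :=
  forall (X X' Y : cplx)
         (inj : forall b : bool, dhom (if b then X else X') Y),
    is_coprod inj -> P Y -> P X.

Definition thick (S : cplx -> Prop) (Y : cplx) : Prop :=
  forall P : cplx -> Prop, triangulated_subcat P -> summand_closed P ->
    (forall X, S X -> P X) -> P Y.

Definition is_tstructure (C_le C_ge : cplx -> Prop) : Prop :=
  [/\ strictly_full C_le /\ strictly_full C_ge,
      forall X, C_le X -> C_le (shift 1 X),
      forall X, C_ge X -> C_ge (shift (- 1) X),
      forall M N (f : dhom M (shift (- 1) N)), C_le M -> C_ge N ->
        deq f (dzero M (shift (- 1) N)) &
      forall M, exists (M' N : cplx) (f : dhom M' M)
          (g : dhom M (shift (- 1) N)) (h : dhom (shift (- 1) N) (shift 1 M')),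
        [/\ C_le M', C_ge N & triangle f g h]].

Definition heart (C_le C_ge : cplx -> Prop) (X : cplx) : Prop :=
  C_le X /\ C_ge X.

Section Stalk.
Variable M : lmodType R.
Definition stalk_obj (i : int) : lmodType R :=
  if i == 0 then M else 'rV[R]_0.
Definition stalk_dif i j : {linear stalk_obj i -> stalk_obj j} := \0.
Lemma stalk_shape i j : j != i + 1 -> forall x, stalk_dif i j x = 0.
Proof. by []. Qed.
Lemma stalk_dif_dif i j k x : stalk_dif j k (stalk_dif i j x) = 0.
Proof. by []. Qed.
Definition stalk : cplx := Cplx stalk_shape stalk_dif_dif.
End Stalk.

Definition bounded (X : cplx) : Prop :=
  exists N : nat, forall i, (N < `|i|)%N -> forall x : X i, x = 0.

Definition short_exact (M N P : lmodType R) (f : {linear M -> N})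
    (g : {linear N -> P}) : Prop :=
  [/\ injective f, forall y, g y = 0 <-> exists x, f x = y &
      forall z, exists y, g y = z].

Definition injective_module (I : lmodType R) : Prop :=
  forall (A B : lmodType R) (u : {linear A -> B}) (v : {linear A -> I}),
    injective u -> exists w : {linear B -> I}, forall x, w (u x) = v x.

Definition finitely_generated (M : lmodType R) : Prop :=
  exists (n : nat) (b : 'I_n -> M), forall x, exists a : 'I_n -> R,
    x = \sum_i a i *: b i.
End Complexes.

(* A right [L]-module is a left module over the converse ring [L^c]. *)
Notation rmodType L := (lmodType L^c).

Section Algebra.
Variables (K : fieldType) (L : falgType K).

(* [e L] and [e' L] are isomorphic as right modules, where
   [e L = {x | e * x = x}] for an idempotent [e]. *)
Definition isog_ideal (e e' : L) : Prop :=
  exists f g : L -> L,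
    [/\ forall x, e * x = x -> e' * f x = f x /\ g (f x) = x,
        forall y, e' * y = y -> e * g y = g y /\ f (g y) = y &
        forall x y a, e * x = x -> e * y = y ->
          f (x * a + y) = f x * a + f y].

Definition idempotent (e : L) : Prop := e * e = e.

Definition primitive_idempotent (e : L) : Prop :=
  [/\ idempotent e, e <> 0 &
      forall e1 e2 : L, idempotent e1 -> idempotent e2 ->
        e1 * e2 = 0 -> e2 * e1 = 0 -> e = e1 + e2 -> e1 = 0 \/ e2 = 0].

Definition basic : Prop :=
  exists (n : nat) (e : 'I_n -> L),
    [/\ forall i, primitive_idempotent (e i),
        forall i j, i != j -> e i * e j = 0,
        \sum_i e i = 1 &
        forall i j, i != j -> ~ isog_ideal (e i) (e j)].

Definition kscal (c : K) : L^c := (c%:A : L).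

Lemma kscalC c (a : L^c) : kscal c * a = a * kscal c.
Proof.
by change ((a : L) * c%:A = c%:A * (a : L)); rewrite mulr_algl mulr_algr.
Qed.

Definition findim (M : rmodType L) : Prop :=
  exists (n : nat) (b : 'I_n -> M), forall x, exists c : 'I_n -> K,
    x = \sum_i kscal (c i) *: b i.

(* The Grothendieck group of mod L is the universal target of functions that
   are additive on short exact sequences of finite-dimensional modules. *)
Definition K0_additive (A : zmodType) (phi : rmodType L -> A) : Prop :=
  forall (M N P : rmodType L) (f : {linear M -> N}) (g : {linear N -> P}),
    findim M -> findim N -> findim P -> short_exact f g ->
    phi N = phi M + phi P.

Definition is_K0 (G : zmodType) (cls : rmodType L -> G) : Prop :=
  K0_additive cls /\
  forall (A : zmodType) (phi : rmodType L -> A), K0_additive phi ->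
    exists h : {additive G -> A},
      (forall M, findim M -> h (cls M) = phi M) /\
      forall h' : {additive G -> A},
        (forall M, findim M -> h' (cls M) = phi M) -> h' =1 h.

Definition zfree (G : zmodType) (n : nat) (g : 'I_n -> G) : Prop :=
  forall c : 'I_n -> int, \sum_i g i *~ c i = 0 -> forall i, c i = 0.

Definition has_rank (G : zmodType) (r : nat) : Prop :=
  (exists g : 'I_r -> G, zfree g) /\
  forall n (g : 'I_n -> G), zfree g -> (n <= r)%N.

Definition K0_rank (r : nat) : Prop :=
  exists (G : zmodType) (cls : rmodType L -> G), is_K0 cls /\ has_rank G r.

Local Notation C := (cplx L^c).

Section Scale.
Variables (c : K) (X Y : C) (f : chmap X Y).

Lemma cm_scale_linear i : linear (fun x => kscal c *: f i x).
Proof.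
by move=> a x y; rewrite linearP scalerDr !scalerA kscalC.
Qed.
Lemma cm_scale_dif i j x :
  mklin (@cm_scale_linear j) (dif X i j x) =
  dif Y i j (mklin (@cm_scale_linear i) x).
Proof.
change (kscal c *: f j (dif X i j x) = dif Y i j (kscal c *: f i x)).
by rewrite linearZ /= cm_dif.
Qed.
Definition cm_scale : chmap X Y := Chmap cm_scale_dif.
End Scale.

Definition dscale (c : K) (X Y : C) (a : dhom X Y) : dhom X Y :=
  Roof (cm_scale c (num a)) (den_quasi_iso a).

Fixpoint dlincomb (X Y : C) (I : Type) (e : I -> dhom X Y)
    (s : seq (K * I)) : dhom X Y :=
  if s is (c, i) :: s' then dadd (dscale c (e i)) (dlincomb e s')
  else dzero X Y.

Definition is_basis (X Y : C) (I : choiceType) (e : I -> dhom X Y) : Prop :=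
  (forall f, exists s, deq f (dlincomb e s)) /\
  (forall s : seq (K * I), uniq [seq p.2 | p <- s] ->
     deq (dlincomb e s) (dzero X Y) -> all (fun p => p.1 == 0) s).

Definition Db_mod (X : C) : Prop :=
  exists Y : C, [/\ diso X Y, bounded Y & forall i, findim (Y i)].

Definition simple_minded (r : nat) (X : 'I_r -> C) : Prop :=
  [/\ K0_rank r,
      forall i, Db_mod (X i),
      forall i j (m : int), (m < 0)%R ->
        forall f : dhom (X i) (shift m (X j)), deq f (dzero _ _),
      (forall i (f : dhom (X i) (X i)),
         exists! c : K, deq f (dscale c (did (X i)))) /\
      (forall i j, i != j -> forall f : dhom (X i) (X j), deq f (dzero _ _)) &
      forall Y, Db_mod Y <-> thick (fun Z => exists i, Z = X i) Y].

Section RickardStep.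
Variables (r : nat) (X : 'I_r -> C) (B : 'I_r -> int -> choiceType).

Record step_index := StepIndex {
  si_obj : 'I_r;
  si_deg : int;
  si_neg : (si_deg < 0)%R;
  si_elt : B si_obj si_deg }.
End RickardStep.

(* [Y] is X_i^(n-1), [Y'] is X_i^(n) and [beta] the map between them. *)
Definition rickard_step (r : nat) (X : 'I_r -> C) (Y Y' : C)
    (beta : dhom Y Y') : Prop :=
  exists (B : 'I_r -> int -> choiceType)
         (e : forall j m, B j m -> dhom (shift m (X j)) Y)
         (Z : C)
         (inj : forall k : step_index B, dhom (shift (si_deg k) (X (si_obj k))) Z)
         (alpha : dhom Z Y) (gamma : dhom Y' (shift 1 Z)),
    [/\ forall j m, (m < 0)%R -> is_basis (e j m),
        is_coprod inj,
        forall k, deq (dcomp alpha (inj k)) (e _ _ (si_elt k)) &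
        triangle alpha beta gamma].

Definition milnor_colimit (Y : nat -> C) (beta : forall n, dhom (Y n) (Y n.+1))
    (T : C) : Prop :=
  exists (S : C) (inj : forall n, dhom (Y n) S)
         (phi : dhom S S) (u : dhom S T) (v : dhom T (shift 1 S)),
    [/\ is_coprod inj,
        forall n, deq (dcomp phi (inj n))
          (dadd (inj n) (dscale (- 1) (dcomp (inj n.+1) (beta n)))) &
        triangle phi u v].

Definition rickard (r : nat) (X T : 'I_r -> C) : Prop :=
  (exists (Xn : nat -> 'I_r -> C)
          (beta : forall n i, dhom (Xn n i) (Xn n.+1 i)),
    [/\ forall i, Xn 0%N i = X i,
        forall n i, rickard_step X (beta n i) &
        forall i, milnor_colimit (beta ^~ i) (T i)]) /\
  (forall i, bounded (T i) /\
     forall k, injective_module (T i k) /\ finitely_generated (T i k)).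

(* D(L) = Hom_K(L, K): a right module by (phi a)(x) = phi (a x), and a left
   module by (a phi)(x) = phi (x a), see [dual_lact]. *)
Definition dual : Type := 'Hom(L, K^o).
HB.instance Definition _ := GRing.Zmodule.on dual.

Definition dual_scale (a : L^c) (phi : dual) : dual := (phi \o amull (a : L))%VF.

Lemma dual_scaleE a (phi : dual) (x : L) :
  dual_scale a phi x = phi ((a : L) * x).
Proof. by rewrite comp_lfunE lfunE. Qed.

Lemma dual_scaleA a b v : dual_scale a (dual_scale b v) = dual_scale (a * b) v.
Proof. by apply/lfunP => x; rewrite !dual_scaleE mulrA. Qed.
Lemma dual_scale1 : left_id 1 dual_scale.
Proof. by move=> v; apply/lfunP => x; rewrite dual_scaleE mul1r. Qed.
Lemma dual_scaleDr : right_distributive dual_scale +%R.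
Proof.
by move=> a u v; apply/lfunP => x; rewrite add_lfunE !dual_scaleE add_lfunE.
Qed.
Lemma dual_scaleDl v : {morph dual_scale^~ v : a b / a + b}.
Proof.
move=> a b; apply/lfunP => x.
by rewrite add_lfunE !dual_scaleE mulrDl linearD.
Qed.
HB.instance Definition _ := GRing.Zmodule_isLmodule.Build L^c dual
  dual_scaleA dual_scale1 dual_scaleDr dual_scaleDl.

Definition dual_lact (a : L) (phi : dual) : dual := (phi \o amulr a)%VF.

Lemma dual_lactE a (phi : dual) (x : L) : dual_lact a phi x = phi (x * a).
Proof. by rewrite comp_lfunE lfunE. Qed.

Lemma dual_lact_linear a : linear (dual_lact a).
Proof.
move=> b u v; apply/lfunP => x.
rewrite add_lfunE !dual_lactE add_lfunE !dual_scaleE dual_lactE.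
by rewrite mulrA.
Qed.

(* Hom_L(D(L), M), a right module by (f a)(phi) = f (a phi). *)
Section HomDual.
Variable M : rmodType L.

Record homdual := HomDual {
  hd_fun :> dual -> M;
  hd_linear : linear hd_fun }.

Lemma hd_ext (f g : homdual) : f =1 g -> f = g.
Proof.
case: f g => f fl [g gl] /= /funext e; rewrite {f}e in fl *.
by congr HomDual; apply: Prop_irrelevance.
Qed.

HB.instance Definition _ := gen_eqMixin homdual.
HB.instance Definition _ := gen_choiceMixin homdual.

Lemma hd_zero_linear : linear (fun _ : dual => 0 : M).
Proof. by move=> a u v; rewrite scaler0 addr0. Qed.
Lemma hd_add_linear (f g : homdual) : linear (fun x => f x + g x).
Proof. by move=> a u v; rewrite !hd_linear scalerDr addrACA. Qed.
Lemma hd_opp_linear (f : homdual) : linear (fun x => - f x).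
Proof. by move=> a u v; rewrite hd_linear opprD scalerN. Qed.
Lemma hd_scale_linear (a : L^c) (f : homdual) :
  linear (fun x => f (dual_lact a x)).
Proof. by move=> b u v; rewrite dual_lact_linear hd_linear. Qed.

Definition hd_zero := HomDual hd_zero_linear.
Definition hd_add f g := HomDual (hd_add_linear f g).
Definition hd_opp f := HomDual (hd_opp_linear f).
Definition hd_scale a f := HomDual (hd_scale_linear a f).

Lemma hd_addA : associative hd_add.
Proof. by move=> f g h; apply: hd_ext => x /=; rewrite addrA. Qed.
Lemma hd_addC : commutative hd_add.
Proof. by move=> f g; apply: hd_ext => x /=; rewrite addrC. Qed.
Lemma hd_add0 : left_id hd_zero hd_add.
Proof. by move=> f; apply: hd_ext => x /=; rewrite add0r. Qed.
Lemma hd_addN : left_inverse hd_zero hd_opp hd_add.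
Proof. by move=> f; apply: hd_ext => x /=; rewrite addNr. Qed.
HB.instance Definition _ :=
  GRing.isZmodule.Build homdual hd_addA hd_addC hd_add0 hd_addN.

Lemma hd_scaleA a b f : hd_scale a (hd_scale b f) = hd_scale (a * b) f.
Proof.
apply: hd_ext => x /=; congr (hd_fun f _); apply/lfunP => y.
by rewrite !dual_lactE mulrA.
Qed.
Lemma hd_scale1 : left_id 1 hd_scale.
Proof.
move=> f; apply: hd_ext => x /=; congr (hd_fun f _); apply/lfunP => y.
by rewrite dual_lactE mulr1.
Qed.
Lemma hd_scaleDr : right_distributive hd_scale +%R.
Proof. by move=> a f g; apply: hd_ext. Qed.
Lemma hd_scaleDl f : {morph hd_scale^~ f : a b / a + b}.
Proof.
move=> a b; apply: hd_ext => x /=.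
have -> : dual_lact (a + b) x = 1 *: dual_lact a x + dual_lact b x.
  rewrite scale1r; apply/lfunP => y.
  by rewrite add_lfunE !dual_lactE mulrDr linearD.
by rewrite hd_linear scale1r.
Qed.
HB.instance Definition _ := GRing.Zmodule_isLmodule.Build L^c homdual
  hd_scaleA hd_scale1 hd_scaleDr hd_scaleDl.
End HomDual.

Section HomDualMap.
Variables (M N : rmodType L) (f : {linear M -> N}).

Lemma hd_comp_linear (p : homdual M) : linear (fun x => f (p x)).
Proof. by move=> a u v; rewrite hd_linear linearP. Qed.
Definition hd_comp (p : homdual M) : homdual N := HomDual (hd_comp_linear p).

Lemma hd_map_linear : linear hd_comp.
Proof. by move=> a p q; apply: hd_ext => x /=; rewrite raddfD. Qed.
Definition hd_map : {linear homdual M -> homdual N} := mklin hd_map_linear.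
End HomDualMap.

Section NuInv.
Variable T : C.
Definition nu_inv_obj (i : int) : rmodType L := homdual (T i).
Definition nu_inv_dif i j : {linear nu_inv_obj i -> nu_inv_obj j} :=
  hd_map (dif T i j).
Lemma nu_inv_shape i j : j != i + 1 -> forall p, nu_inv_dif i j p = 0.
Proof. by move=> ne p; apply: hd_ext => x /=; rewrite dif_shape. Qed.
Lemma nu_inv_dif_dif i j k p : nu_inv_dif j k (nu_inv_dif i j p) = 0.
Proof. by apply: hd_ext => x /=; rewrite dif_dif. Qed.
Definition nu_inv : C := Cplx nu_inv_shape nu_inv_dif_dif.
End NuInv.

Definition per : C -> Prop := thick (fun Z => Z = stalk (L^c)^o).

Definition tilting_complex (P : C) : Prop :=
  [/\ per P,
      forall m : int, m != 0 -> forall f : dhom P (shift m P), deq f (dzero _ _) &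
      forall Y, thick (fun Z => Z = P) Y <-> per Y].
End Algebra.

(* Main.v *)
(* Put G_i = nu^{-1} T_i, a bounded complex of projectives.  Maps from negative
   shifts of the X_j die along the telescope defining T_i, and X_j, being in
   D^b(mod), is small with respect to coproducts of objects whose cohomology is
   uniformly bounded below; so Hom(S^m X_j, T_i) = 0 for m < 0.  As T_i is built
   from X_i and such S^m X_j, it follows that Hom(T_i, S^p T_j) = 0 for p > 0,
   and nu^{-1} carries this over to the G_i.

   Moreover the G_i generate per: attaching to D(L) finitely many shifts of the
   T_i, one map at a time, yields a bounded complex of injectives J without maps
   from the S^b T_i with b up to any given bound.  Since D(L) lies in
   D^b(mod) = thick(X), only finitely many such b matter, so D(L) -> J is null
   homotopic.  Its image under nu^{-1} is then null as well, while the cone of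
   this image lies in thick(G); hence so does nu^{-1} D(L) = L.

   So only Hom(P, S^m P) = 0 for m < 0 is in question.  It holds if P lies in the
   heart of a t-structure; conversely, it puts P in the heart of the t-structure
   whose coaisle is {N | Hom(P, S^m N) = 0 for m < 0}. *)
From HB Require Import structures.
Require Import Defs.
From mathcomp Require Import all_boot all_order all_algebra falgebra.
From mathcomp Require Import boolp classical_sets zify.

Set Implicit Arguments.
Unset Strict Implicit.
Unset Printing Implicit Defensive.

Import Order.TTheory GRing.Theory Num.Theory.
Local Open Scope ring_scope.

(** * Homotopies *)

Section Homotopy.
Variable R : nzRingType.
Implicit Types X Y Z W V U : cplx R.

(** Objects of D^b(mod) need not be compact in D(Mod), so the smallness of the X_j has to exploit a
    common lower bound on cohomology. The bound is expressed by the vanishing of maps to shifts of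
    D(L): this passes formally to coproducts and to third terms of triangles, so it survives the
    whole telescope. On the generation side nu^{-1} acts on complexes and chain maps, not on the
    derived category. The approximations of D(L) are therefore linked by actual chain maps, and what
    is tracked is that the cone of their image under nu^{-1} lies in the given thick subcategory.
    The approximation J depends on how many maps from the T_i have been killed, and that number
    depends on how D(L) is built from the X_j; the bound is thus found for all J at once, before any
    J is constructed. The t-structure comes from a second tower, which kills maps from shifts of the
    G_i instead of the X_j, and both towers rest on the same statements about telescopes. *)

Definition hty X Y (f g : chmap X Y) (h : forall i j, {linear X i -> Y j}) :=
  forall i j k, j + 1 = i -> i + 1 = k -> forall x,
    f i x - g i x = dif Y j i (h i j x) + h k i (dif X i k x).

(** In [hty] the neighbouring degrees are variables tied by equations: the homotopy identity can
    then be used for any presentation of i - 1 and i + 1 without transports. *)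
Lemma homotopicP X Y (f g : chmap X Y) :
  homotopic f g <-> exists h, hty f g h.
Proof.
split=> [[h H]|[h H]]; exists h.
  move=> i j k ej <- x; have {ej} -> : j = i - 1 by rewrite -ej addrK.
  exact: H.
by move=> i x; apply: H; rewrite ?subrK.
Qed.

Lemma homotopic_eq X Y (f g : chmap X Y) :
  (forall i x, f i x = g i x) -> homotopic f g.
Proof.
move=> e; apply/homotopicP; exists (fun _ _ => \0) => i j k _ _ x /=.
by rewrite e subrr raddf0 addr0.
Qed.

Lemma homotopic_refl X Y (f : chmap X Y) : homotopic f f.
Proof. exact: homotopic_eq. Qed.

Lemma homotopic_sym X Y (f g : chmap X Y) : homotopic f g -> homotopic g f.
Proof.
move=> /homotopicP[h H]; apply/homotopicP.
exists (fun i j => \- h i j) => i j k ej ek x /=.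
by rewrite raddfN -opprD -(H _ _ _ ej ek) opprB.
Qed.

Lemma homotopic_trans X Y (g f h : chmap X Y) :
  homotopic f g -> homotopic g h -> homotopic f h.
Proof.
move=> /homotopicP[a A] /homotopicP[b B]; apply/homotopicP.
exists (fun i j => a i j \+ b i j) => i j k ej ek x /=.
by rewrite raddfD addrACA -(A _ _ _ ej ek) -(B _ _ _ ej ek) addrA subrK.
Qed.

Lemma homotopic_compl X Y Z (k : chmap Y Z) (f g : chmap X Y) :
  homotopic f g -> homotopic (cm_comp k f) (cm_comp k g).
Proof.
move=> /homotopicP[a A]; apply/homotopicP.
exists (fun i j => k j \o a i j) => i j l ej ek x /=.
by rewrite -raddfB (A _ _ _ ej ek) raddfD /= cm_dif.
Qed.

Lemma homotopic_compr X Y Z (k : chmap X Y) (f g : chmap Y Z) :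
  homotopic f g -> homotopic (cm_comp f k) (cm_comp g k).
Proof.
move=> /homotopicP[a A]; apply/homotopicP.
exists (fun i j => a i j \o k i) => i j l ej ek x /=.
by rewrite (A _ _ _ ej ek) cm_dif.
Qed.

Lemma homotopic_add X Y (f f' g g' : chmap X Y) :
  homotopic f f' -> homotopic g g' ->
  homotopic (cm_add f g) (cm_add f' g').
Proof.
move=> /homotopicP[a A] /homotopicP[b B]; apply/homotopicP.
exists (fun i j => a i j \+ b i j) => i j k ej ek x /=.
by rewrite opprD addrACA (A _ _ _ ej ek) (B _ _ _ ej ek) raddfD addrACA.
Qed.

(** For odd n the differential changes sign, and the homotopy has to change sign with it. *)
Lemma homotopic_shift n X Y (f g : chmap X Y) :
  homotopic f g -> homotopic (cm_shift n f) (cm_shift n g).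
Proof.
move=> /homotopicP[a A]; apply/homotopicP.
exists (fun i j => if odd `|n|%N then (\- a (i + n) (j + n) : {linear _ -> _})
        else a (i + n) (j + n)) => i j k ej ek x /=.
have ej' : j + n + 1 = i + n by rewrite -ej addrAC.
have ek' : i + n + 1 = k + n by rewrite -ek addrAC.
rewrite (A _ _ _ ej' ek') /shift_dif; case: ifP => _ //=.
by rewrite !raddfN /= !opprK.
Qed.

(** Off j = i + 1 both differentials vanish, so only consecutive degrees carry content. *)
Lemma chmap_succ X Y (f : forall i, {linear X i -> Y i}) :
  (forall i j, i + 1 = j -> forall x, f j (dif X i j x) = dif Y i j (f i x)) ->
  forall i j x, f j (dif X i j x) = dif Y i j (f i x).
Proof.
move=> H i j x; have [ej|ne] := eqVneq j (i + 1); first exact: H.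
by rewrite !dif_shape // raddf0.
Qed.

Lemma cm_opp_dif X Y (f : chmap X Y) i j x :
  (\- f j) (dif X i j x) = dif Y i j ((\- f i) x).
Proof. by rewrite /= cm_dif raddfN. Qed.
Definition cm_opp X Y (f : chmap X Y) : chmap X Y :=
  @Chmap R X Y (fun i => (\- f i : {linear X i -> Y i})) (cm_opp_dif f).

Lemma cocycleB X i (x y : X i) : cocycle x -> cocycle y -> cocycle (x - y).
Proof. by move=> cx cy j; rewrite raddfB /= cx cy subrr. Qed.

Lemma coboundary0 X i : coboundary (0 : X i).
Proof. by exists i, 0; rewrite raddf0. Qed.

Lemma cocycle_succ X i j (x : X i) : i + 1 = j -> dif X i j x = 0 -> cocycle x.
Proof.
move=> ej e k; have [ek|ne] := eqVneq k (i + 1); last by rewrite dif_shape.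
by rewrite ek ej.
Qed.

Lemma coboundary_succ X i j (x : X i) :
  j + 1 = i -> coboundary x -> exists y, x = dif X j i y.
Proof.
move=> e /coboundaryP; have -> : i - 1 = j by rewrite -e addrK.
by [].
Qed.

Lemma homotopic_coboundary X Y (f g : chmap X Y) i (x : X i) :
  homotopic f g -> cocycle x -> coboundary (f i x - g i x).
Proof.
case=> h H cx; rewrite H cx raddf0 addr0.
by exists (i - 1), (h i (i - 1) x).
Qed.

Lemma quasi_iso_homotopic X Y (f g : chmap X Y) :
  homotopic f g -> quasi_iso f -> quasi_iso g.
Proof.
move=> h [fi fs]; split=> [i x cx bx|i y cy].
  apply: fi => //; rewrite -(subrK (g i x) (f i x)).
  by apply: coboundaryD => //; apply: homotopic_coboundary.
have [x cx bx] := fs i y cy; exists x => //.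
rewrite -[y](subrK (f i x)) -addrA.
by apply: coboundaryD => //; apply: homotopic_coboundary.
Qed.

Lemma quasi_iso_right X Y Z (g : chmap Y Z) (f : chmap X Y) :
  quasi_iso (cm_comp g f) -> quasi_iso g -> quasi_iso f.
Proof.
move=> [ci cs] [gi gs]; split=> [i x cx bx|i y cy].
  by apply: ci => //=; apply: coboundary_cm.
have [x cx /= bx] := cs i (g i y) (cocycle_cm g cy).
exists x => //; apply: gi; last by rewrite raddfB.
by apply: cocycleB => //; apply: cocycle_cm.
Qed.

Lemma quasi_iso_bij X Y (f : chmap X Y) (g : chmap Y X) :
  (forall i, cancel (f i) (g i)) -> (forall i, cancel (g i) (f i)) ->
  quasi_iso f.
Proof.
move=> fK gK; split=> [i x _ bx|i y cy].
  by rewrite -(fK i x); apply: coboundary_cm.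
exists (g i y); first exact: cocycle_cm.
by rewrite gK subrr; apply: coboundary0.
Qed.

Section HpullTheory.
Variables (W V Y : cplx R) (f : chmap W Y) (t : chmap V Y).

(** The third component of the homotopy pullback is itself the homotopy. *)
Lemma hpull_square :
  homotopic (cm_comp f (hpull_fst f t)) (cm_comp t (hpull_snd f t)).
Proof.
apply/homotopicP.
pose h i j (p : hpull f t i) := transport Y (i - 1) j p.2.
have hl i j : linear (@h i j) by move=> a p q; rewrite /h /= linearP.
exists (fun i j => mklin (@hl i j)) => i j k ej <- p /=.
have {}ej : j = i - 1 by rewrite -ej addrK.
subst j; rewrite /h transport_id /= /hpull_fun /=.
have := addrK 1 i; move: (i + 1 - 1) => l ->.
by rewrite !transport_id [RHS]addrC subrK.
Qed.

(** The two maps and a chosen homotopy between the composites are the three components of the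
    lift. *)
Lemma hpull_lift U (a : chmap U W) (b : chmap U V) :
  homotopic (cm_comp f a) (cm_comp t b) ->
  exists c : chmap U (hpull f t),
    forall i x, hpull_fst f t i (c i x) = a i x /\
                hpull_snd f t i (c i x) = b i x.
Proof.
case=> h H.
pose c i (x : U i) : hpull f t i := (a i x, b i x, h i (i - 1) x).
have cl i : linear (@c i).
  by move=> l x y; congr pair => /=; first congr pair => /=; rewrite linearP.
suff cd : forall i j x, mklin (@cl j) (dif U i j x) =
    dif (hpull f t) i j (mklin (@cl i) x) by exists (Chmap cd).
apply: chmap_succ => i _ <- x; congr pair => /=.
  by congr pair => /=; rewrite cm_dif.
have /= -> := H i x; have := addrK 1 i; move: (i + 1 - 1) => l ->.
by rewrite transport_id addrAC subrr add0r.
Qed.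

End HpullTheory.

End Homotopy.

(** * Morphisms of the derived category *)

Section DerivedHom.
Variable R : nzRingType.
Implicit Types X Y Z W : cplx R.

Lemma deq_refl X Y (a : dhom X Y) : deq a a.
Proof.
exists (apex a), (cm_id _), (cm_id _); split; try exact: homotopic_refl.
exact: quasi_iso_comp (den_quasi_iso a) (quasi_iso_id _).
Qed.

Lemma deq_sym X Y (a b : dhom X Y) : deq a b -> deq b a.
Proof.
case=> W [u [v [q h1 h2]]]; exists W, v, u; split; try exact: homotopic_sym.
exact: quasi_iso_homotopic h1 q.
Qed.

(** The two refinements of [b] are matched by the homotopy pullback of [v] and [u'];
    two-out-of-three makes [u'] a quasi-isomorphism, hence also the projection to [W]. *)
Lemma deq_trans X Y (b a c : dhom X Y) : deq a b -> deq b c -> deq a c.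
Proof.
case=> W [u [v [q h1 h2]]] [W' [u' [w [q' h1' h2']]]].
have qu' : quasi_iso u' by exact: quasi_iso_right q' (den_quasi_iso b).
pose p := hpull_fst v u'; pose p' := hpull_snd v u'.
have step Z (k : chmap (apex b) Z) (l : chmap (apex a) Z)
    (l' : chmap (apex c) Z) : homotopic (cm_comp l u) (cm_comp k v) ->
    homotopic (cm_comp k u') (cm_comp l' w) ->
    homotopic (cm_comp l (cm_comp u p)) (cm_comp l' (cm_comp w p')).
  move=> e e'; apply: (homotopic_trans (g := cm_comp k (cm_comp v p))).
    exact: (homotopic_compr p e).
  apply: (homotopic_trans (g := cm_comp k (cm_comp u' p'))).
    exact/homotopic_compl/hpull_square.
  exact: (homotopic_compr p' e').
exists (hpull v u'), (cm_comp u p), (cm_comp w p'); split.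
- exact: (quasi_iso_comp q (quasi_iso_hpull_fst v qu')).
- exact: (step _ (den b)).
- exact: (step _ (num b)).
Qed.

(** A morphism is the equivalence class of a roof, taken as a predicate on roofs; extensionality
    turns [deq] into equality, so that one can rewrite. *)
Record Hom X Y := MkHom {
  hom_cls : dhom X Y -> Prop;
  hom_clsP : exists a, hom_cls = deq a }.

Definition cl X Y (a : dhom X Y) : Hom X Y :=
  MkHom (ex_intro (fun b => deq a = deq b) a erefl).

Lemma clE X Y (a b : dhom X Y) : cl a = cl b <-> deq a b.
Proof.
split=> [[->]|e]; first exact: deq_refl.
suff E : deq a = deq b.
  rewrite /cl; move: (ex_intro _ _ _); rewrite E => H.
  by congr MkHom; apply: Prop_irrelevance.
apply/funext => c; apply/propext; split => h; last exact: deq_trans h.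
exact: deq_trans (deq_sym e) h.
Qed.

Lemma homP X Y (p : Hom X Y) : exists a, p = cl a.
Proof.
case: p => P [a e]; exists a; rewrite /cl; subst P.
by congr MkHom; apply: Prop_irrelevance.
Qed.

Definition rep X Y (p : Hom X Y) : dhom X Y := projT1 (cid (homP p)).
Lemma repK X Y (p : Hom X Y) : cl (rep p) = p.
Proof. by rewrite /rep; case: cid. Qed.
Lemma rep_deq X Y (a : dhom X Y) : deq a (rep (cl a)).
Proof. by apply/clE; rewrite repK. Qed.

Lemma cl_refine X Y W (f : chmap W Y) (s : chmap W X) (qs : quasi_iso s)
    W' (u : chmap W' W) (q : quasi_iso (cm_comp s u)) :
  cl (Roof f qs) = cl (Roof (cm_comp f u) q).
Proof.
apply/clE; exists W', u, (cm_id _); split=> //; exact: homotopic_refl.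
Qed.

Lemma cl_homotopic X Y W (f f' : chmap W Y) (s s' : chmap W X)
    (qs : quasi_iso s) (qs' : quasi_iso s') :
  homotopic s s' -> homotopic f f' -> cl (Roof f qs) = cl (Roof f' qs').
Proof.
move=> hs hf; apply/clE; by exists W, (cm_id _), (cm_id _); split.
Qed.

(** Any Ore square, not just the homotopy pullback, computes the composite, because it factors
    through the pullback. *)
Lemma dcompE X Y Z (b : dhom Y Z) (a : dhom X Y) H
    (t : chmap H (apex a)) (f : chmap H (apex b))
    (q : quasi_iso (cm_comp (den a) t)) :
  homotopic (cm_comp (num a) t) (cm_comp (den b) f) ->
  cl (dcomp b a) = cl (Roof (cm_comp (num b) f) q).
Proof.
move=> h; have [c cE] := hpull_lift h.
apply/clE; exists H, c, (cm_id _); split.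
- apply: quasi_iso_homotopic q; apply: homotopic_eq => i x /=.
  by have [/= -> _] := cE i x.
- by apply: homotopic_eq => i x /=; have [/= -> _] := cE i x.
- by apply: homotopic_eq => i x /=; have [_ /= ->] := cE i x.
Qed.

Lemma ore X Y Z (b : dhom Y Z) (a : dhom X Y) :
  exists H (t : chmap H (apex a)) (f : chmap H (apex b)),
    quasi_iso t /\ homotopic (cm_comp (num a) t) (cm_comp (den b) f).
Proof.
exists (hpull (num a) (den b)), (hpull_fst _ _), (hpull_snd _ _); split.
  exact/quasi_iso_hpull_fst/den_quasi_iso.
exact: hpull_square.
Qed.

(** A single Ore square over the two refined roofs computes both composites. *)
Lemma dcomp_deq X Y Z (b b' : dhom Y Z) (a a' : dhom X Y) :
  deq b b' -> deq a a' -> cl (dcomp b a) = cl (dcomp b' a').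
Proof.
move=> [V [v [v' [q h1 h2]]]] [W [u [u' [q' h1' h2']]]].
have [H [t [f [qt sq]]]] :=
  ore (Roof (cm_comp (num b) v) q) (Roof (cm_comp (num a) u) q').
have qE := quasi_iso_comp q' qt.
rewrite (@dcompE _ _ _ b a H (cm_comp u t) (cm_comp v f) qE) //.
have hE : homotopic (cm_comp (den a) (cm_comp u t))
                    (cm_comp (den a') (cm_comp u' t)).
  exact: (homotopic_compr t h1').
have qE' := quasi_iso_homotopic hE qE.
rewrite (@dcompE _ _ _ b' a' H (cm_comp u' t) (cm_comp v' f) qE').
  by apply: cl_homotopic => //; exact: (homotopic_compr f h2).
apply: (homotopic_trans (homotopic_sym (homotopic_compr t h2'))).
exact: (homotopic_trans sq (homotopic_compr f h1)).
Qed.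

Definition hcomp X Y Z (q : Hom Y Z) (p : Hom X Y) : Hom X Z :=
  cl (dcomp (rep q) (rep p)).
Local Notation "q ** p" := (hcomp q p) (at level 40, left associativity).

Lemma cl_comp X Y Z (b : dhom Y Z) (a : dhom X Y) :
  cl b ** cl a = cl (dcomp b a).
Proof. by apply: dcomp_deq; apply/deq_sym/rep_deq. Qed.

(** Two stacked Ore squares give one roof over [H2] that represents both bracketings. *)
Lemma hcompA X Y Z W (r : Hom Z W) (q : Hom Y Z) (p : Hom X Y) :
  r ** (q ** p) = r ** q ** p.
Proof.
have [[[a ->] [b ->]] [c ->]] := (homP p, homP q, homP r).
have [H1 [t1 [f1 [q1 s1]]]] := ore b a.
pose q1' := quasi_iso_comp (den_quasi_iso a) q1.
rewrite cl_comp (dcompE q1' s1).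
have [H2 [t2 [f2 [q2 s2]]]] := ore c (Roof (cm_comp (num b) f1) q1').
pose q2' := quasi_iso_comp q1' q2.
rewrite cl_comp (dcompE (b := c) (a := Roof _ q1') q2' s2).
have [g gE] := hpull_lift (f := num b) (t := den c) (a := cm_comp f1 t2) s2.
rewrite !cl_comp.
have s3 : homotopic (cm_comp (num a) (cm_comp t1 t2))
                    (cm_comp (den (dcomp c b)) g).
  apply: (homotopic_trans (homotopic_compr t2 s1)).
  by apply: homotopic_eq => i x /=; have [/= -> _] := gE i x.
have q3 : quasi_iso (cm_comp (den a) (cm_comp t1 t2)) by exact: q2'.
rewrite (dcompE (b := dcomp c b) (a := a) q3 s3).
apply: cl_homotopic; first exact: homotopic_refl.
by apply: homotopic_eq => i x /=; have [_ /= ->] := gE i x.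
Qed.

Definition Q X Y (f : chmap X Y) : Hom X Y := cl (dlift f).
Definition h1 X : Hom X X := Q (cm_id X).

Lemma Q_homotopic X Y (f g : chmap X Y) : homotopic f g -> Q f = Q g.
Proof. by move=> h; apply: cl_homotopic => //; apply: homotopic_refl. Qed.

Lemma Q_eq X Y (f g : chmap X Y) : (forall i x, f i x = g i x) -> Q f = Q g.
Proof. by move=> h; apply/Q_homotopic/homotopic_eq. Qed.

Lemma compQ X Y Z (b : dhom Y Z) (f : chmap X Y) H
    (t : chmap H X) (g : chmap H (apex b)) (q : quasi_iso t) :
  homotopic (cm_comp f t) (cm_comp (den b) g) ->
  cl b ** Q f = cl (Roof (cm_comp (num b) g) q).
Proof.
move=> h; have q' : quasi_iso (cm_comp (cm_id X) t).
  exact: quasi_iso_comp (quasi_iso_id _) q.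
rewrite cl_comp (dcompE (a := dlift f) q' h).
by apply: cl_homotopic; apply: homotopic_eq.
Qed.

Lemma Qcl X Y Z W (f : chmap Y Z) (s : chmap W X) (qs : quasi_iso s)
    (g : chmap W Y) : Q f ** cl (Roof g qs) = cl (Roof (cm_comp f g) qs).
Proof.
have q' : quasi_iso (cm_comp s (cm_id W)).
  exact: quasi_iso_comp qs (quasi_iso_id _).
rewrite cl_comp (dcompE (b := dlift f) (a := Roof g qs) (f := g) q').
  by apply: cl_homotopic; apply: homotopic_eq.
exact: homotopic_eq.
Qed.

Lemma Q_comp X Y Z (f : chmap Y Z) (g : chmap X Y) :
  Q (cm_comp f g) = Q f ** Q g.
Proof. by rewrite /Q -/(Q f) Qcl. Qed.

Lemma hcomp1r X Y (p : Hom X Y) : p ** h1 X = p.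
Proof.
have [a ->] := homP p; rewrite /h1 (compQ (g := cm_id _) (den_quasi_iso a)).
  case: a => W s f qs /=; apply: cl_homotopic; exact: homotopic_eq.
exact: homotopic_eq.
Qed.

Lemma hcomp1l X Y (p : Hom X Y) : h1 Y ** p = p.
Proof.
have [[W s f qs] ->] := homP p; rewrite /h1 Qcl.
by apply: cl_homotopic; apply: homotopic_eq.
Qed.

Definition Qi X Y (s : chmap X Y) (qs : quasi_iso s) : Hom Y X :=
  cl (Roof (cm_id X) qs).

Lemma cl_roof X Y W (s : chmap W X) (qs : quasi_iso s) (f : chmap W Y) :
  cl (Roof f qs) = Q f ** Qi qs.
Proof. by rewrite Qcl; apply: cl_homotopic; apply: homotopic_eq. Qed.

Lemma QiK X Y (s : chmap X Y) (qs : quasi_iso s) : Q s ** Qi qs = h1 Y.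
Proof.
rewrite Qcl; apply/clE.
exists X, (cm_id _), s; split; try exact: homotopic_eq.
exact: quasi_iso_comp qs (quasi_iso_id _).
Qed.

Lemma QKi X Y (s : chmap X Y) (qs : quasi_iso s) : Qi qs ** Q s = h1 X.
Proof.
rewrite (compQ (b := Roof (cm_id X) qs) (g := cm_id X) (quasi_iso_id X)); last exact: homotopic_eq.
by apply: cl_homotopic; apply: homotopic_eq.
Qed.

Lemma roofP X Y (p : Hom X Y) :
  exists W (s : chmap W X) (qs : quasi_iso s) (f : chmap W Y),
    p = Q f ** Qi qs.
Proof.
have [[W s f qs] ->] := homP p; exists W, s, qs, f; exact: cl_roof.
Qed.

(** Both denominators are identities, so the two legs [u] and [v] of the comparing roof are
    homotopic and one can replace the other. *)
Lemma Q_inj X Y (f g : chmap X Y) : Q f = Q g ->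
  exists W (s : chmap W X),
    quasi_iso s /\ homotopic (cm_comp f s) (cm_comp g s).
Proof.
move=> /clE[W [u [v [q /= h k]]]]; exists W, u; split.
  by apply: quasi_iso_homotopic q; apply: homotopic_eq.
apply: (homotopic_trans k).
by apply: homotopic_compl; apply: homotopic_sym.
Qed.

Lemma epiQ X Y Z (s : chmap X Y) (p q : Hom Y Z) :
  quasi_iso s -> p ** Q s = q ** Q s -> p = q.
Proof.
move=> qs e; rewrite -[p]hcomp1r -[q]hcomp1r -(QiK qs).
by rewrite !hcompA e.
Qed.

Lemma monoQ X Y Z (s : chmap Y Z) (p q : Hom X Y) :
  quasi_iso s -> Q s ** p = Q s ** q -> p = q.
Proof.
move=> qs e; rewrite -[p]hcomp1l -[q]hcomp1l -(QKi qs).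
by rewrite -!hcompA e.
Qed.

End DerivedHom.
Notation "q ** p" := (hcomp q p) (at level 40, left associativity).

(** * Additive structure and suspension of the derived category *)

Section Additive.
Variable R : nzRingType.
Implicit Types X Y Z W : cplx R.

Lemma daddE X Y (a b : dhom X Y) W (x : chmap W (apex a))
    (y : chmap W (apex b)) (q : quasi_iso (cm_comp (den a) x)) :
  homotopic (cm_comp (den a) x) (cm_comp (den b) y) ->
  cl (dadd a b) =
  cl (Roof (cm_add (cm_comp (num a) x) (cm_comp (num b) y)) q).
Proof.
move=> h; have [c cE] := hpull_lift h.
apply/clE; exists W, c, (cm_id _); split.
- apply: quasi_iso_homotopic q; apply: homotopic_eq => i z /=.
  by have [/= -> _] := cE i z.
- by apply: homotopic_eq => i z /=; have [/= -> _] := cE i z.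
- by apply: homotopic_eq => i z /=; have [/= -> ->] := cE i z.
Qed.

Lemma common_den X Y (a b : dhom X Y) :
  exists W (x : chmap W (apex a)) (y : chmap W (apex b)),
    quasi_iso (cm_comp (den a) x) /\
    homotopic (cm_comp (den a) x) (cm_comp (den b) y).
Proof.
exists (hpull (den a) (den b)), (hpull_fst _ _), (hpull_snd _ _); split.
  exact: (den_quasi_iso (dadd a b)).
exact: hpull_square.
Qed.

Lemma dadd_deq X Y (a a' b b' : dhom X Y) :
  deq a a' -> deq b b' -> cl (dadd a b) = cl (dadd a' b').
Proof.
move=> [V [v [v' [q h k]]]] [W [w [w' [q' h' k']]]].
have [U [x [y [qx hxy]]]] := common_den (Roof (cm_comp (num a) v) q)
   (Roof (cm_comp (num b) w) q').
have q1 : quasi_iso (cm_comp (den a) (cm_comp v x)) by exact: qx.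
rewrite (@daddE _ _ a b U (cm_comp v x) (cm_comp w y) q1) //.
have e : homotopic (cm_comp (den a) (cm_comp v x))
  (cm_comp (den a') (cm_comp v' x)) by exact: (homotopic_compr x h).
rewrite (@daddE _ _ a' b' U (cm_comp v' x) (cm_comp w' y)
  (quasi_iso_homotopic e q1)).
  apply: cl_homotopic => //; apply: homotopic_add.
    exact: (homotopic_compr x k).
  exact: (homotopic_compr y k').
apply: (homotopic_trans (homotopic_sym e)).
exact: (homotopic_trans hxy (homotopic_compr y h')).
Qed.

Definition hadd X Y (p q : Hom X Y) : Hom X Y := cl (dadd (rep p) (rep q)).
Local Notation "p +! q" := (hadd p q) (at level 50, left associativity).

Lemma cl_add X Y (a b : dhom X Y) : cl a +! cl b = cl (dadd a b).
Proof. by apply: dadd_deq; apply/deq_sym/rep_deq. Qed.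

Lemma add_roof X Y W (s : chmap W X) (qs : quasi_iso s) (f g : chmap W Y) :
  Q f ** Qi qs +! Q g ** Qi qs = Q (cm_add f g) ** Qi qs.
Proof.
rewrite -!cl_roof cl_add.
rewrite (@daddE _ _ (Roof f qs) (Roof g qs) W (cm_id W) (cm_id W) qs).
  by apply: cl_homotopic; apply: homotopic_eq.
exact: homotopic_refl.
Qed.

Lemma add_Q X Y (f g : chmap X Y) : Q f +! Q g = Q (cm_add f g).
Proof.
have e (h : chmap X Y) : Q h = Q h ** Qi (quasi_iso_id X).
  by rewrite -cl_roof; apply: cl_homotopic; apply: homotopic_eq.
by rewrite (e f) (e g) add_roof -e.
Qed.

Lemma roof2P X Y (p q : Hom X Y) :
  exists W (s : chmap W X) (qs : quasi_iso s) (f g : chmap W Y),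
    p = Q f ** Qi qs /\ q = Q g ** Qi qs.
Proof.
have [[a ->] [b ->]] := (homP p, homP q).
have [W [x [y [qx h]]]] := common_den a b.
exists W, _, qx, (cm_comp (num a) x), (cm_comp (num b) y).
rewrite -!cl_roof; split.
  by case: a x y qx h => V s f qs x y qx h /=; apply: cl_refine.
transitivity (cl (Roof (cm_comp (num b) y) (quasi_iso_homotopic h qx))).
  by case: b y h => V s f qs y h /=; apply: cl_refine.
by apply: cl_homotopic; [apply: homotopic_sym | apply: homotopic_refl].
Qed.

Definition hzero X Y : Hom X Y := Q (cm_zero X Y).
(** Negation as composition with -id is well defined on classes at once. *)
Definition hopp X Y (p : Hom X Y) : Hom X Y := Q (cm_opp (cm_id Y)) ** p.

Lemma haddC X Y (p q : Hom X Y) : p +! q = q +! p.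
Proof.
have [W [s [qs [f [g [-> ->]]]]]] := roof2P p q.
rewrite !add_roof; congr (_ ** _); apply: Q_eq => i x /=; exact: addrC.
Qed.

Lemma hadd_compl X Y Z (p q : Hom Y Z) (r : Hom X Y) :
  (p +! q) ** r = p ** r +! q ** r.
Proof.
have [W [s [qs [f [g [-> ->]]]]]] := roof2P p q.
rewrite add_roof -!hcompA; have [V [t [qt [k ->]]]] := roofP (Qi qs ** r).
rewrite !hcompA -!Q_comp add_roof; congr (_ ** _); exact: Q_eq.
Qed.

(** Sums are formed over denominators on the source, so on this side the inverse of [t] has to be
    moved past f and g: both composites are brought to a common denominator [u]. *)
Lemma hadd_compr X Y Z (r : Hom Y Z) (p q : Hom X Y) :
  r ** (p +! q) = r ** p +! r ** q.
Proof.
have [W [s [qs [f [g [-> ->]]]]]] := roof2P p q.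
rewrite add_roof !hcompA -hadd_compl; congr (_ ** _).
have [V [t [qt [k ->]]]] := roofP r.
have [U [u [qu [f' [g' [ef eg]]]]]] := roof2P (Qi qt ** Q f) (Qi qt ** Q g).
rewrite -!hcompA ef eg !hcompA -!Q_comp add_roof.
have -> : Q (cm_add (cm_comp k f') (cm_comp k g')) =
    Q k ** Q (cm_add f' g').
  by rewrite -Q_comp; apply: Q_eq => i x /=; rewrite raddfD.
rewrite -!hcompA; congr (_ ** _).
apply: (monoQ qt); apply: (epiQ qu).
rewrite !hcompA QiK hcomp1l -!hcompA QKi hcomp1r.
have ef' : Q t ** Q f' = Q f ** Q u.
  by rewrite -[Q f']hcomp1r -(QKi qu) !hcompA -(hcompA _ (Q f')) -ef !hcompA
     QiK hcomp1l.
have eg' : Q t ** Q g' = Q g ** Q u.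
  by rewrite -[Q g']hcomp1r -(QKi qu) !hcompA -(hcompA _ (Q g')) -eg !hcompA
     QiK hcomp1l.
rewrite -add_Q hadd_compl -ef' -eg' -!Q_comp add_Q.
by apply: Q_eq => i x /=; rewrite raddfD.
Qed.

Lemma roof3P X Y (p q r : Hom X Y) :
  exists W (s : chmap W X) (qs : quasi_iso s) (f g h : chmap W Y),
    [/\ p = Q f ** Qi qs, q = Q g ** Qi qs & r = Q h ** Qi qs].
Proof.
have [W [s [qs [f [g [-> ->]]]]]] := roof2P p q.
have [V [t [qt [h er]]]] := roofP (r ** Q s).
have qst := quasi_iso_comp qs qt.
exists V, _, qst, (cm_comp f t), (cm_comp g t), h.
have e Z (k : Hom X Z) (l : Hom V Z) :
    k ** Q s ** Q t = l -> k = l ** Qi qst.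
  by move=> <-; rewrite -!hcompA [Q s ** _]hcompA -Q_comp QiK hcomp1r.
split; apply: e; rewrite ?er -!hcompA ?[Qi qs ** _]hcompA ?QKi ?hcomp1l ?Q_comp //.
by rewrite hcomp1r.
Qed.

Lemma haddA X Y (p q r : Hom X Y) : p +! (q +! r) = p +! q +! r.
Proof.
have [W [s [qs [f [g [h [-> -> ->]]]]]]] := roof3P p q r.
rewrite !add_roof; congr (_ ** _); apply: Q_eq => i x /=; exact: addrA.
Qed.

Lemma hcomp0l X Y Z (p : Hom X Y) : hzero Y Z ** p = hzero X Z.
Proof.
have [W [s [qs [f ->]]]] := roofP p.
apply: (epiQ qs); rewrite -!hcompA QKi hcomp1r /hzero -!Q_comp.
exact: Q_eq.
Qed.

Lemma hcomp0r X Y Z (p : Hom Y Z) : p ** hzero X Y = hzero X Z.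
Proof.
have [W [s [qs [f ->]]]] := roofP p.
suff -> : hzero X Y = Q s ** hzero X W.
  rewrite -!hcompA [Qi qs ** _]hcompA QKi hcomp1l /hzero -!Q_comp.
  by apply: Q_eq => i x /=; rewrite raddf0.
by rewrite /hzero -!Q_comp; apply: Q_eq => i x /=; rewrite raddf0.
Qed.

Lemma hadd0l X Y (p : Hom X Y) : hzero X Y +! p = p.
Proof.
have [W [s [qs [f ->]]]] := roofP p.
rewrite -(hcomp0l Y (Qi qs)) add_roof; congr (_ ** _).
by apply: Q_eq => i x /=; rewrite add0r.
Qed.

Lemma hadd0r X Y (p : Hom X Y) : p +! hzero X Y = p.
Proof. by rewrite haddC hadd0l. Qed.

Lemma haddNr X Y (p : Hom X Y) : p +! hopp p = hzero X Y.
Proof.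
rewrite -{1}[p]hcomp1l /hopp -hadd_compl add_Q.
rewrite (Q_eq (g := cm_zero Y Y)) ?hcomp0l // => i x /=; exact: subrr.
Qed.

Lemma haddNl X Y (p : Hom X Y) : hopp p +! p = hzero X Y.
Proof. by rewrite haddC haddNr. Qed.

Lemma hopp_uniq X Y (p q : Hom X Y) : p +! q = hzero X Y -> q = hopp p.
Proof.
by move=> e; rewrite -[q]hadd0l -(haddNl p) -haddA e hadd0r.
Qed.

Lemma hoppl X Y Z (p : Hom Y Z) (q : Hom X Y) : hopp p ** q = hopp (p ** q).
Proof. by apply: hopp_uniq; rewrite -hadd_compl haddNr hcomp0l. Qed.

Lemma hoppr X Y Z (p : Hom Y Z) (q : Hom X Y) : p ** hopp q = hopp (p ** q).
Proof. by apply: hopp_uniq; rewrite -hadd_compr haddNr hcomp0r. Qed.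

Lemma hoppK X Y (p : Hom X Y) : hopp (hopp p) = p.
Proof. by symmetry; apply: hopp_uniq; rewrite haddNl. Qed.

Lemma hopp_add X Y (p q : Hom X Y) : hopp (p +! q) = hopp p +! hopp q.
Proof. exact: hadd_compr. Qed.

Lemma hopp0 X Y : hopp (hzero X Y) = hzero X Y.
Proof. by symmetry; apply: hopp_uniq; rewrite hadd0l. Qed.

Lemma hsub_eq0 X Y (p q : Hom X Y) : p +! hopp q = hzero X Y -> p = q.
Proof. by move=> /hopp_uniq e; rewrite -[p]hoppK -e hoppK. Qed.

Lemma hopp_inj0 X Y (p : Hom X Y) : hopp p = hzero X Y -> p = hzero X Y.
Proof. by move=> e; rewrite -[p]hoppK e hopp0. Qed.

Lemma Q_opp X Y (f : chmap X Y) : Q (cm_opp f) = hopp (Q f).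
Proof. by rewrite /hopp -Q_comp; apply: Q_eq. Qed.

Definition hiso X Y (p : Hom X Y) :=
  exists q : Hom Y X, q ** p = h1 X /\ p ** q = h1 Y.

Lemma hisoP X Y (a : dhom X Y) : is_diso a <-> hiso (cl a).
Proof.
split=> [[b [e1 e2]]|[q]].
  by exists (cl b); rewrite !cl_comp; split; apply/clE.
have [b ->] := homP q; rewrite !cl_comp => -[/clE e1 /clE e2].
by exists b.
Qed.

Lemma disoP X Y : diso X Y <-> exists p : Hom X Y, hiso p.
Proof.
split=> [[a /hisoP h]|[p]]; first by exists (cl a).
by have [a ->] := homP p => /hisoP h; exists a.
Qed.

Lemma hiso1 X : hiso (h1 X).
Proof. by exists (h1 X); rewrite hcomp1l. Qed.

Lemma hiso_comp X Y Z (p : Hom Y Z) (q : Hom X Y) :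
  hiso p -> hiso q -> hiso (p ** q).
Proof.
move=> [p' [e1 e2]] [q' [e3 e4]]; exists (q' ** p'); split.
  by rewrite hcompA -(hcompA q') e1 hcomp1r e3.
by rewrite hcompA -(hcompA p) e4 hcomp1r e2.
Qed.

Lemma hiso_Q X Y (s : chmap X Y) : quasi_iso s -> hiso (Q s).
Proof. by move=> qs; exists (Qi qs); rewrite QiK QKi. Qed.

Lemma hiso_epi X Y Z (s : Hom X Y) (p q : Hom Y Z) :
  hiso s -> p ** s = q ** s -> p = q.
Proof.
move=> [t [_ e]] h; rewrite -[p]hcomp1r -[q]hcomp1r -e.
by rewrite !hcompA h.
Qed.

Lemma hiso_mono X Y Z (s : Hom Y Z) (p q : Hom X Y) :
  hiso s -> s ** p = s ** q -> p = q.
Proof.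
move=> [t [e _]] h; rewrite -[p]hcomp1l -[q]hcomp1l -e.
by rewrite -!hcompA h.
Qed.

Section Shift.
Variable n : int.

Lemma dshift_deq X Y (a b : dhom X Y) :
  deq a b -> cl (dshift n a) = cl (dshift n b).
Proof.
case=> W [u [v [q h k]]]; apply/clE.
exists (shift n W), (cm_shift n u), (cm_shift n v); split.
- exact: (quasi_iso_shift n q).
- exact: (homotopic_shift n h).
- exact: (homotopic_shift n k).
Qed.

Definition hsh X Y (p : Hom X Y) : Hom (shift n X) (shift n Y) :=
  cl (dshift n (rep p)).

Lemma cl_shift X Y (a : dhom X Y) : hsh (cl a) = cl (dshift n a).
Proof. by apply: dshift_deq; apply/deq_sym/rep_deq. Qed.

Lemma hsh_Q X Y (f : chmap X Y) : hsh (Q f) = Q (cm_shift n f).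
Proof.
rewrite cl_shift; by apply: cl_homotopic; apply: homotopic_eq.
Qed.

Lemma hsh_comp X Y Z (q : Hom Y Z) (p : Hom X Y) :
  hsh (q ** p) = hsh q ** hsh p.
Proof.
have [[a ->] [b ->]] := (homP p, homP q).
rewrite cl_comp !cl_shift cl_comp; symmetry.
pose t := cm_shift n (hpull_fst (num a) (den b)).
pose f := cm_shift n (hpull_snd (num a) (den b)).
have qt : quasi_iso (cm_comp (den (dshift n a)) t).
  exact: (quasi_iso_shift n (den_quasi_iso (dcomp b a))).
rewrite (@dcompE _ _ _ _ (dshift n b) (dshift n a) _ t f qt).
  by apply: cl_homotopic; apply: homotopic_eq.
exact: (homotopic_shift n (hpull_square (num a) (den b))).
Qed.

Lemma hsh_0 X Y : hsh (hzero X Y) = hzero (shift n X) (shift n Y).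
Proof. by rewrite hsh_Q; apply: Q_eq. Qed.

Lemma hsh_1 X : hsh (h1 X) = h1 (shift n X).
Proof. by rewrite hsh_Q; apply: Q_eq. Qed.

Lemma hsh_add X Y (p q : Hom X Y) : hsh (p +! q) = hsh p +! hsh q.
Proof.
have [W [s [qs [f [g [-> ->]]]]]] := roof2P p q.
rewrite add_roof !hsh_comp -hadd_compl; congr (_ ** _).
by rewrite !hsh_Q add_Q; apply: Q_eq.
Qed.

Lemma hsh_opp X Y (p : Hom X Y) : hsh (hopp p) = hopp (hsh p).
Proof. by apply: hopp_uniq; rewrite -hsh_add haddNr hsh_0. Qed.

Lemma hiso_sh X Y (p : Hom X Y) : hiso p -> hiso (hsh p).
Proof.
move=> [q [e1 e2]]; exists (hsh q).
by rewrite -!hsh_comp e1 e2 !hsh_1.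
Qed.
End Shift.

End Additive.
Notation "p +! q" := (hadd p q) (at level 50, left associativity).

(* A reflexive decision procedure for identities of abelian groups, which
   [ring] does not cover. *)
Inductive zexp := ZVar of nat | ZZero | ZAdd of zexp & zexp | ZOpp of zexp.

Section ZmodExp.
Variables (V : zmodType) (env : seq V).

Fixpoint zeval (e : zexp) : V :=
  match e with
  | ZVar n => nth 0 env n
  | ZZero => 0
  | ZAdd a b => zeval a + zeval b
  | ZOpp a => - zeval a
  end.

Fixpoint zcoef (e : zexp) (n : nat) : int :=
  match e with
  | ZVar m => (m == n)%:R
  | ZZero => 0
  | ZAdd a b => zcoef a n + zcoef b n
  | ZOpp a => - zcoef a n
  end.

Fixpoint zwf (e : zexp) : bool :=
  match e with
  | ZVar n => (n < size env)%N
  | ZZero => true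
  | ZAdd a b => zwf a && zwf b
  | ZOpp a => zwf a
  end.

Lemma zevalE e : zwf e ->
  zeval e = \sum_(n < size env) nth 0 env n *~ zcoef e n.
Proof.
elim: e => /= [m hm||a IHa b IHb /andP[/IHa -> /IHb ->]|a IHa /IHa ->].
- rewrite (bigD1 (Ordinal hm)) //= eqxx big1 ?addr0 // => i ne.
  by rewrite eq_sym; move: ne; rewrite -val_eqE /= => /negbTE ->.
- by rewrite big1 // => i _; rewrite mulr0z.
- by rewrite -big_split; apply: eq_bigr => i _; rewrite mulrzDr.
- by rewrite -sumrN; apply: eq_bigr => i _; rewrite mulrNz.
Qed.

Lemma zeval_eq e1 e2 :
  [&& zwf e1, zwf e2 &
      all (fun n => zcoef e1 n == zcoef e2 n) (iota 0 (size env))] ->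
  zeval e1 = zeval e2.
Proof.
case/and3P=> w1 w2 /allP h; rewrite !zevalE //; apply: eq_bigr => i _.
by congr (_ *~ _); apply/eqP/h; rewrite mem_iota ltn_ord.
Qed.
End ZmodExp.

(** Adds a known equation crosswise to the goal, which leaves an identity that [abel] decides. *)
Lemma addr_comb (V : zmodType) (a b x y : V) : a = b -> x + b = y + a -> x = y.
Proof. by move=> -> /addIr. Qed.

Lemma addr_comb2 (V : zmodType) (a b c d x y : V) :
  a = b -> c = d -> x + b + d = y + a + c -> x = y.
Proof. by move=> -> -> /addIr/addIr. Qed.

Ltac zmod_index t l :=
  lazymatch l with
  | ?x :: ?l' =>
    match goal with
    | _ => let _ := match goal with _ => unify t x end in constr:(O)
    | _ => let n := zmod_index t l' in constr:(S n)
    end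
  end.

Ltac zmod_env t l :=
  lazymatch t with
  | @GRing.add _ ?x ?y => let l' := zmod_env x l in zmod_env y l'
  | @GRing.opp _ ?x => zmod_env x l
  | @GRing.zero _ => l
  | _ =>
    match goal with
    | _ => let _ := zmod_index t l in l
    | _ => constr:(t :: l)
    end
  end.

Ltac zmod_reify t l :=
  lazymatch t with
  | @GRing.add _ ?x ?y =>
    let a := zmod_reify x l in let b := zmod_reify y l in constr:(ZAdd a b)
  | @GRing.opp _ ?x => let a := zmod_reify x l in constr:(ZOpp a)
  | @GRing.zero _ => constr:(ZZero)
  | _ => let n := zmod_index t l in constr:(ZVar n)
  end.

Ltac abel :=
  lazymatch goal with
  | |- @eq ?T ?x ?y =>
    let l := zmod_env x (@nil T) in
    let l := zmod_env y l in
    let e1 := zmod_reify x l in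
    let e2 := zmod_reify y l in
    refine (@zeval_eq _ l e1 e2 _); by vm_compute
  end.


(** * Triangles and shifts *)

Section ConeTheory.
Variable R : nzRingType.
Implicit Types X Y Z W A B : cplx R.

Lemma cone_difE A B (u : chmap A B) i (p : cone u i) :
  dif (cone u) i (i + 1) p =
  (- dif A (i + 1) (i + 1 + 1) p.1, u (i + 1) p.1 + dif B i (i + 1) p.2).
Proof. by congr pair => /=; rewrite transport_id. Qed.

Lemma cone_cocycle A B (u : chmap A B) i (p : cone u i) :
  cocycle p <->
  dif A (i + 1) (i + 1 + 1) p.1 = 0 /\ u (i + 1) p.1 + dif B i (i + 1) p.2 = 0.
Proof.
split=> [c|[e1 e2]].
  have := c (i + 1); rewrite cone_difE => -[/eqP].
  by rewrite oppr_eq0 => /eqP.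
by apply: (cocycle_succ (erefl (i + 1))); rewrite cone_difE e1 e2 oppr0.
Qed.

Lemma cone_coboundary A B (u : chmap A B) i (x : A (i + 1 + 1)) (y : B (i + 1)) :
  @coboundary _ (cone u) (i + 1) (x, y) <->
  exists p q, x = - dif A (i + 1) (i + 1 + 1) p /\
              y = u (i + 1) p + dif B i (i + 1) q.
Proof.
split=> [/(coboundary_succ (erefl (i + 1)))[[p q]]|[p [q [-> ->]]]].
  by rewrite cone_difE => -[-> ->]; exists p, q.
by exists i, (p, q); rewrite cone_difE.
Qed.

Section ConeMap.
Variables (A B A' B' : cplx R) (u : chmap A B) (u' : chmap A' B').
Variables (a : chmap A A') (b : chmap B B').
Variable h : forall i j, {linear A i -> B' j}.
Hypothesis H : hty (cm_comp u' a) (cm_comp b u) h.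

(** The off-diagonal entry -h makes up for a square that commutes only up to the homotopy h. *)
Definition cone_map_fun i (p : cone u i) : cone u' i :=
  (a (i + 1) p.1, b i p.2 - h (i + 1) i p.1).

Lemma cone_map_linear i : linear (@cone_map_fun i).
Proof.
move=> l p q; rewrite /cone_map_fun; congr pair => /=; rewrite !linearP //=.
by rewrite scalerDr addrACA.
Qed.

Lemma cone_map_dif i j p : mklin (@cone_map_linear j) (dif (cone u) i j p) =
  dif (cone u') i j (mklin (@cone_map_linear i) p).
Proof.
apply: (chmap_succ (f := fun i => mklin (@cone_map_linear i))) => {}i _ <- {}p.
rewrite !cone_difE /= /cone_map_fun /=; congr pair.
  by rewrite raddfN /= cm_dif.
rewrite !raddfN opprK raddfD raddfB /= cm_dif.
have /(canRL (subrK _)) /= -> := H (erefl (i + 1)) (erefl (i + 1 + 1)) p.1.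
abel.
Qed.

Definition cone_map : chmap (cone u) (cone u') := Chmap cone_map_dif.

(** The five lemma for the two cones, carried out on cocycles and coboundaries. *)
Lemma cone_map_quasi_iso : quasi_iso a -> quasi_iso b -> quasi_iso cone_map.
Proof.
have hc i (x : A (i + 1)) : dif A (i + 1) (i + 1 + 1) x = 0 ->
    u' _ (a _ x) - b _ (u _ x) = dif B' i (i + 1) (h (i + 1) i x).
  move=> e; have /= -> := H (erefl (i + 1)) (erefl (i + 1 + 1)) x.
  by rewrite e raddf0 addr0.
(* The degree is written as i + 1, so that preimages under the differential lie in degree i without
   a cast. *)
move=> [ai as_] [bi bs]; split=> k; rewrite -(subrK 1 k); move: (k - 1) => i.
  move=> [x y] /cone_cocycle[/= cx cy].
  move=> /cone_coboundary[p [q [ex ey]]].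
  have : coboundary x.
    apply: ai; first exact: cocycle_succ cx.
    by exists (i + 1), (- p); rewrite raddfN -ex.
  move=> /(coboundary_succ (erefl (i + 1 + 1)))[x0 ex0].
  (* Lifting this cocycle to A replaces [p] by the image of p0 - x0, up to the boundary of [r]. *)
  have cp : cocycle (p + a _ x0).
    apply: (cocycle_succ (erefl (i + 1 + 1))).
    by rewrite raddfD /= -cm_dif -ex0 ex addrC subrr.
  have [p0 cp0 /(coboundary_succ (erefl (i + 1)))[r er]] := as_ _ _ cp.
  have ep : p = a _ (p0 - x0) + dif A' i (i + 1) r.
    by rewrite -er raddfB /=; abel.
  have [w ew] : exists w, y - u _ (p0 - x0) = dif B i (i + 1) w.
    apply: (coboundary_succ (erefl (i + 1))); apply: bi.
      apply: (cocycle_succ (erefl (i + 1 + 1))).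
      rewrite raddfB /= -cm_dif raddfB /= cp0 -ex0 sub0r raddfN.
      by apply: etrans cy; abel.
    exists i, (u' i r + q + h (i + 1) i (p0 - x0)).
    have /= e := H (erefl (i + 1)) (erefl (i + 1 + 1)) (p0 - x0).
    move: ey e; rewrite /= ep !(raddfB, raddfD) /= -!cm_dif cp0 -ex0 !(raddfB, raddfD, raddfN, raddf0) /=.
    by move=> ey e; apply: (addr_comb2 ey e); abel.
  apply/cone_coboundary; exists (p0 - x0), w; split.
    by rewrite raddfB /= cp0 ex0 sub0r opprK.
  by rewrite -ew; abel.
move=> [x y] /cone_cocycle[/= cx cy].
have [x1 cx1 /(coboundary_succ (erefl (i + 1 + 1)))[r er]] :=
  as_ _ x (cocycle_succ (erefl _) cx).
have e := hc _ _ (cx1 (i + 1 + 1 + 1)).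
have [w ew] : exists w, u _ x1 = dif B (i + 1) (i + 1 + 1) w.
  apply: (coboundary_succ (erefl (i + 1 + 1))); apply: bi.
    exact: cocycle_cm.
  exists (i + 1), (- (y + u' _ r + h _ (i + 1) x1)).
  rewrite raddfN !raddfD /= -e -cm_dif -er raddfB /=.
  by apply: (addr_comb cy); abel.
(* What [b] still has to hit once x is replaced by the image of [x1]; the terms in [r], [w] and h
   make it a cocycle. *)
pose z := y + u' _ r + b _ w + h _ (i + 1) x1.
have cz : cocycle z.
  apply: (cocycle_succ (erefl (i + 1 + 1))).
  rewrite !raddfD /= -e -!cm_dif -er raddfB /= -ew. apply: etrans cy; abel.
have [z0 cz0 /(coboundary_succ (erefl (i + 1)))[s es]] := bs _ _ cz.
exists (x1, z0 - w).
  apply/cone_cocycle; split; first exact: cx1.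
  by rewrite /= raddfB /= cz0 -ew; abel.
apply/cone_coboundary; exists (- r), s; split.
  by change (x - a _ x1 = - dif A' (i + 1) (i + 1 + 1) (- r)); rewrite raddfN opprK.
change (y - (b _ (z0 - w) - h _ (i + 1) x1) = u' _ (- r) + dif B' i (i + 1) s).
by rewrite -es raddfN (raddfB (b (i + 1))) /= /z; abel.
Qed.

End ConeMap.

Lemma cone_mapP A B A' B' (u : chmap A B) (u' : chmap A' B')
    (a : chmap A A') (b : chmap B B') :
  homotopic (cm_comp u' a) (cm_comp b u) ->
  exists m : chmap (cone u) (cone u'),
    [/\ forall i y, m i (cone_in u i y) = cone_in u' i (b i y),
        forall i p, (m i p).1 = a (i + 1) p.1 &
        quasi_iso a -> quasi_iso b -> quasi_iso m].
Proof.
move=> /homotopicP[h H]; exists (cone_map H); split=> //.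
  by move=> i y; congr pair => /=; rewrite !raddf0 ?addr0.
exact: cone_map_quasi_iso.
Qed.

(** A null-homotopy of k u is exactly the missing component on A of an extension of k to the
    cone. *)
Lemma cone_ext A B W (u : chmap A B) (k : chmap B W) :
  homotopic (cm_comp k u) (cm_zero A W) ->
  exists e : chmap (cone u) W, forall i y, e i (cone_in u i y) = k i y.
Proof.
move=> /homotopicP[h H].
pose e i (p : cone u i) : W i := k i p.2 + h (i + 1) i p.1.
have el i : linear (@e i).
  by move=> l p q; rewrite /e /= !linearP /= scalerDr addrACA.
suff ed i j x : mklin (@el j) (dif (cone u) i j x) =
    dif W i j (mklin (@el i) x).
  by exists (Chmap ed) => i y; rewrite /= /e /= raddf0 addr0.
apply: (chmap_succ (f := fun i => mklin (@el i))) => {}i _ <- {}x.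
rewrite cone_difE /= /e /= !raddfD raddfN /= cm_dif.
have /= := H (i + 1) i _ (erefl (i + 1)) (erefl (i + 1 + 1)) x.1.
by rewrite subr0 => ->; abel.
Qed.

(** A null-homotopy into the cone has two components: the one in A is the lift [q], the one in B the
    homotopy from p to u q. *)
Lemma cone_lift A B V (u : chmap A B) (p : chmap V B) :
  homotopic (cm_comp (cone_in u) p) (cm_zero V (cone u)) ->
  exists q : chmap V A, homotopic p (cm_comp u q).
Proof.
move=> /homotopicP[h H].
pose q i (x : V i) : A i := transport A (i - 1 + 1) i (h i (i - 1) x).1.
have ql i : linear (@q i) by move=> l x y; rewrite /q /= !linearP.
have qE j i (x : V i) : j + 1 = i -> q i x = transport A (j + 1) i (h i j x).1.
  by move=> e; have -> : j = i - 1 by rewrite -e addrK.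
have HE j (x : V (j + 1)) :
    dif A (j + 1) (j + 1 + 1) (h (j + 1) j x).1 =
      (h (j + 1 + 1) (j + 1) (dif V (j + 1) (j + 1 + 1) x)).1 /\
    p (j + 1) x = u (j + 1) (h (j + 1) j x).1 + dif B j (j + 1) (h (j + 1) j x).2
      + (h (j + 1 + 1) (j + 1) (dif V (j + 1) (j + 1 + 1) x)).2.
  have := H (j + 1) j _ (erefl (j + 1)) (erefl (j + 1 + 1)) x.
  rewrite [_ - _]subr0 cone_difE => e; split; last exact: (congr1 snd e).
  have /= e' := congr1 fst e; apply/eqP; rewrite -subr_eq0; apply/eqP.
  by apply: (addr_comb e'); abel.
have qd i j x : mklin (@ql j) (dif V i j x) = dif A i j (mklin (@ql i) x).
  apply: (chmap_succ (f := fun i => mklin (@ql i))) => {}i _ <- {}x /=.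
  rewrite (qE i _ _ erefl) transport_id.
  have [m em] : exists m, m + 1 = i by exists (i - 1); rewrite subrK.
  by subst i; rewrite (qE m _ _ erefl) transport_id; have [-> _] := HE m x.
exists (Chmap qd); apply/homotopicP.
pose k i j (x : V i) : B j := (h i j x).2.
have kl i j : linear (@k i j) by move=> l x y; rewrite /k /= !linearP.
exists (fun i j => mklin (@kl i j)) => i j l ej <- x.
subst i; rewrite /= (qE j _ _ erefl) transport_id /k; have [_ ->] := HE j x.
by abel.
Qed.

Lemma cone_in_null A B (u : chmap A B) :
  homotopic (cm_comp (cone_in u) u) (cm_zero A (cone u)).
Proof.
apply/homotopicP.
pose h i j (x : A i) : cone u j := (transport A i (j + 1) x, 0).
have hl i j : linear (@h i j).
  by move=> l x y; congr pair => /=; rewrite ?linearP ?scaler0 ?addr0.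
exists (fun i j => mklin (@hl i j)) => i j l ej <- x; subst i.
rewrite [LHS]subr0 cone_difE /= /h !transport_id; congr pair => /=.
  by rewrite addNr.
by rewrite raddf0 !addr0.
Qed.

Section ConeRotate.
Variables (A B : cplx R) (u : chmap A B).
Let C2 := cone (cone_in u).

Lemma rot_proj_linear i : linear (fun p : C2 i => p.2.1 : shift 1 A i).
Proof. by []. Qed.
Lemma rot_proj_dif i j p : mklin (@rot_proj_linear j) (dif C2 i j p) =
  dif (shift 1 A) i j (mklin (@rot_proj_linear i) p).
Proof.
apply: (chmap_succ (f := fun i => mklin (@rot_proj_linear i))) => {}i _ <- {}p.
by rewrite cone_difE cone_difE /= add0r.
Qed.
Definition rot_proj : chmap C2 (shift 1 A) := Chmap rot_proj_dif.

(** The entry -u x is forced: it cancels the term u x that the differential of the inner cone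
    produces. *)
Lemma rot_in_linear i :
  linear (fun x : shift 1 A i => (- u (i + 1) x, (x : A (i + 1), 0)) : C2 i).
Proof.
move=> l x y; congr pair => /=; first by rewrite linearP opprD scalerN.
by congr pair => /=; rewrite scaler0 addr0.
Qed.
Lemma rot_in_dif i j x : mklin (@rot_in_linear j) (dif (shift 1 A) i j x) =
  dif C2 i j (mklin (@rot_in_linear i) x).
Proof.
apply: (chmap_succ (f := fun i => mklin (@rot_in_linear i))) => {}i _ <- {}x.
rewrite cone_difE cone_difE; congr pair => /=.
  by rewrite !raddfN /= !opprK cm_dif.
by congr pair => /=; rewrite ?add0r // raddf0 addr0 addNr.
Qed.
Definition rot_in : chmap (shift 1 A) C2 := Chmap rot_in_dif.

(** The double cone contains B twice; the homotopy carries one copy onto the other, and only the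
    shifted A remains. *)
Lemma rot_homotopic : homotopic (cm_id C2) (cm_comp rot_in rot_proj).
Proof.
apply/homotopicP.
pose h i j (p : C2 i) : C2 j := (transport B i (j + 1) p.2.2, 0).
have hl i j : linear (@h i j).
  by move=> l x y; congr pair => /=; rewrite ?linearP ?scaler0 ?addr0.
exists (fun i j => mklin (@hl i j)) => i j l ej <- [b [a b']]; subst i.
rewrite !(@cone_difE _ _ (cone_in u)) /= /h !transport_id.
congr pair => /=; first by rewrite transport_id; abel.
by congr pair => /=; rewrite ?raddf0 ?oppr0; abel.
Qed.

Lemma rot_in_quasi_iso : quasi_iso rot_in.
Proof.
apply: (@quasi_iso_right _ _ _ _ rot_proj).
  by apply: quasi_iso_homotopic (quasi_iso_id _); apply: homotopic_eq.
have e : homotopic (cm_comp rot_in rot_proj) (cm_id C2).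
  exact/homotopic_sym/rot_homotopic.
split=> [i x cx bx|i y cy].
  rewrite -(subrK (rot_in i (rot_proj i x)) x); apply: coboundaryD.
    exact: (homotopic_coboundary rot_homotopic).
  exact: coboundary_cm.
exists (rot_in i y); first exact: cocycle_cm.
by rewrite /= subrr; apply: coboundary0.
Qed.
End ConeRotate.

Definition tri X Y Z (f : Hom X Y) (g : Hom Y Z) (h : Hom Z (shift 1 X)) :=
  exists (A B : cplx R) (u : chmap A B)
         (a : Hom X A) (b : Hom Y B) (c : Hom Z (cone u)),
    [/\ hiso a, hiso b & hiso c] /\
    [/\ b ** f = Q u ** a, c ** g = Q (cone_in u) ** b &
        hsh 1 a ** h = Q (cone_out u) ** c].

Lemma triangleP X Y Z (f : dhom X Y) (g : dhom Y Z) (h : dhom Z (shift 1 X)) :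
  triangle f g h <-> tri (cl f) (cl g) (cl h).
Proof.
split=> [[A [B [u [a [b [c [[ia ib ic] [e1 e2 e3]]]]]]]]|].
  exists A, B, u, (cl a), (cl b), (cl c); split; first by split; apply/hisoP.
  by rewrite cl_shift /Q !cl_comp; split; apply/clE.
case=> A [B [u [p [q [r]]]]].
have [[[a ->] [b ->]] [c ->]] := (homP p, homP q, homP r).
rewrite cl_shift /Q !cl_comp => -[[/hisoP ia /hisoP ib /hisoP ic]].
move=> [/clE e1 /clE e2 /clE e3].
by exists A, B, u, a, b, c.
Qed.

Lemma tri_iso X Y Z X' Y' Z' (f : Hom X Y) (g : Hom Y Z) (h : Hom Z (shift 1 X))
    (f' : Hom X' Y') (g' : Hom Y' Z') (h' : Hom Z' (shift 1 X'))
    (a : Hom X' X) (b : Hom Y' Y) (c : Hom Z' Z) :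
  hiso a -> hiso b -> hiso c -> b ** f' = f ** a -> c ** g' = g ** b ->
  hsh 1 a ** h' = h ** c -> tri f g h -> tri f' g' h'.
Proof.
move=> ia ib ic e1 e2 e3 [A [B [u [x [y [z [[ix iy iz] [e4 e5 e6]]]]]]]].
exists A, B, u, (x ** a), (y ** b), (z ** c).
split; first by split; apply: hiso_comp.
by rewrite hsh_comp -!hcompA e1 e2 e3 !hcompA e4 e5 e6.
Qed.

Lemma tri_cone A B (u : chmap A B) :
  tri (Q u) (Q (cone_in u)) (Q (cone_out u)).
Proof.
exists A, B, u, (h1 _), (h1 _), (h1 _); split; first by split; apply: hiso1.
by rewrite hsh_1 !hcomp1l !hcomp1r.
Qed.

Lemma tri_cone_rot A B (u : chmap A B) :
  tri (Q (cone_in u)) (Q (cone_out u)) (hopp (hsh 1 (Q u))).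
Proof.
apply: (tri_iso (a := h1 _) (b := h1 _) (c := Q (rot_in u)))
  (tri_cone (cone_in u)); try exact: hiso1.
- exact/hiso_Q/rot_in_quasi_iso.
- by rewrite hcomp1l hcomp1r.
- rewrite hcomp1r -Q_comp; apply: Q_homotopic; apply: homotopic_sym.
  apply: homotopic_trans (homotopic_compr (cone_in (cone_in u))
    (rot_homotopic u)) _.
  by apply: homotopic_eq.
- rewrite hsh_1 hcomp1l -Q_comp hsh_Q -Q_opp.
  by apply: Q_eq.
Qed.

Lemma tri_rot X Y Z (f : Hom X Y) (g : Hom Y Z) (h : Hom Z (shift 1 X)) :
  tri f g h -> tri g h (hopp (hsh 1 f)).
Proof.
move=> [A [B [u [a [b [c [[ia ib ic] [e1 e2 e3]]]]]]]].
apply: tri_iso ib ic (hiso_sh 1 ia) e2 e3 _ (tri_cone_rot u).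
by rewrite hoppr hoppl -!hsh_comp e1.
Qed.

Lemma tri_comp0 X Y Z (f : Hom X Y) (g : Hom Y Z) (h : Hom Z (shift 1 X)) :
  tri f g h -> g ** f = hzero X Z.
Proof.
move=> [A [B [u [a [b [c [[ia ib ic] [e1 e2 e3]]]]]]]].
apply: (hiso_mono ic); rewrite hcompA e2 -hcompA e1 hcompA -Q_comp.
by rewrite (Q_homotopic (cone_in_null u)) -/(hzero _ _) hcomp0l hcomp0r.
Qed.

(** The denominator of p sits on B, so u itself is first replaced by a map [u'] over it. After one
    more refinement k u' is null-homotopic and k extends over the new cone, which is
    quasi-isomorphic to the old one. *)
Lemma tri_ext X Y Z W (f : Hom X Y) (g : Hom Y Z) (h : Hom Z (shift 1 X))
    (p : Hom Y W) :
  tri f g h -> p ** f = hzero X W -> exists q, p = q ** g.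
Proof.
move=> [A [B [u [a [b [c [[ia ib ic] [e1 e2 e3]]]]]]]] e0.
have [b' [eb' eb]] := ib; have [a' [ea' ea]] := ia.
suff [q eq] : exists q, p ** b' = q ** Q (cone_in u).
  exists (q ** c); rewrite -hcompA e2 hcompA -eq -hcompA eb'.
  by rewrite hcomp1r.
have : (p ** b') ** Q u = hzero A W.
  apply: (hiso_epi ia); rewrite -hcompA -e1 hcompA -(hcompA p) eb' hcomp1r.
  by rewrite e0 hcomp0l.
move: (p ** b') => p' {e0 e1 e2 e3}.
have [V [s [qs [k ->]]]] := roofP p'.
have [H [t [u' [qt sq]]]] := ore (Roof k qs) (dlift u).
move: t u' qt sq => /= t u' qt sq e0.
have /Q_inj [H' [r [qr e]]] : Q (cm_comp k u') = Q (cm_zero H W).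
  rewrite Q_comp; apply: etrans (hcomp0l _ (Q t)); rewrite -e0 -!hcompA.
  rewrite -(Q_comp u t) (Q_homotopic sq) Q_comp (hcompA (Qi qs)) QKi.
  by rewrite hcomp1l.
have [m [min _ mq]] := @cone_mapP _ _ _ _ (cm_comp u' r) u (cm_comp t r) s
  (homotopic_compr r sq).
have [x xin] : exists x : chmap (cone (cm_comp u' r)) W,
    forall i y, x i (cone_in (cm_comp u' r) i y) = k i y.
  by apply: cone_ext; apply: homotopic_trans e _; apply: homotopic_eq.
have qm : quasi_iso m by apply: mq => //; apply: quasi_iso_comp.
exists (Q x ** Qi qm); apply: (epiQ qs); rewrite -!hcompA QKi hcomp1r -Q_comp.
rewrite -(Q_eq (f := cm_comp m (cone_in (cm_comp u' r)))); last exact: min.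
rewrite Q_comp (hcompA (Qi qm)) QKi hcomp1l -Q_comp.
by apply: Q_eq => i y; rewrite -xin.
Qed.

(** Here only the source W is refined and u stays fixed, so [cone_lift] applies directly. *)
Lemma tri_lift X Y Z W (f : Hom X Y) (g : Hom Y Z) (h : Hom Z (shift 1 X))
    (p : Hom W Y) :
  tri f g h -> g ** p = hzero W Z -> exists q, p = f ** q.
Proof.
move=> [A [B [u [a [b [c [[ia ib ic] [e1 e2 e3]]]]]]]] e0.
suff [q eq] : exists q, b ** p = Q u ** q.
  have [a' [ea' ea]] := ia; exists (a' ** q); apply: (hiso_mono ib).
  by rewrite eq !hcompA e1 -(hcompA _ a) ea hcomp1r.
have : Q (cone_in u) ** (b ** p) = hzero W (cone u).
  by rewrite hcompA -e2 -hcompA e0 hcomp0r.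
move: (b ** p) => p' {e0 e1 e2 e3}.
have [V [s [qs [k ->]]]] := roofP p'; rewrite hcompA -Q_comp => e0.
have /Q_inj [H [r [qr e]]] :
    Q (cm_comp (cone_in u) k) = Q (cm_zero V (cone u)).
  apply: (hiso_epi (s := Qi qs)); last by rewrite e0 -/(hzero _ _) hcomp0l.
  by exists (Q s); rewrite QiK QKi.
have [q hq] : exists q : chmap H A, homotopic (cm_comp k r) (cm_comp u q).
  apply: cone_lift; apply: homotopic_trans e _; exact: homotopic_eq.
exists (Q q ** Qi (quasi_iso_comp qs qr)).
rewrite hcompA -Q_comp -(Q_homotopic hq) -!cl_roof.
exact: cl_refine.
Qed.

End ConeTheory.

(** * Composition and invertibility of shifts *)

Section ShiftIso.
Variable R : nzRingType.
Implicit Types X Y Z W : cplx R.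

Lemma transport_cm X Y (f : chmap X Y) i j x :
  f j (transport X i j x) = transport Y i j (f i x).
Proof.
have [e|ne] := eqVneq i j; first by subst j; rewrite !transport_id.
by rewrite !transport_neq // raddf0.
Qed.

Lemma transportK X i j : i = j -> cancel (transport X i j) (transport X j i).
Proof. by move=> <- x; rewrite !transport_id. Qed.

Lemma odd_abszB (m n : nat) : odd `|(m%:Z - n%:Z)%R|%N = odd m (+) odd n.
Proof.
have [le|/ltnW le] := leqP m n; last by rewrite distnEl // oddB.
by rewrite distnC distnEl // oddB // addbC.
Qed.

(** Ensures that the signs (-1)^n in [shift] multiply when shifts are composed. *)
Lemma odd_abszD (a b : int) : odd `|(a + b)%R|%N = odd `|a|%N (+) odd `|b|%N.
Proof.
have E (x : int) : exists m n : nat, x = m%:Z - n%:Z.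
  by case: x => n; [exists n, 0%N; rewrite subr0 | exists 0%N, n.+1; rewrite sub0r NegzE].
have [[m [n ->]] [p [q ->]]] := (E a, E b).
have -> : m%:Z - n%:Z + (p%:Z - q%:Z) = (m + p)%:Z - (n + q)%:Z.
  by rewrite !PoszD opprD addrACA.
by rewrite !odd_abszB !oddD; case: (odd m) (odd n) (odd p) (odd q) => [] [] [] [].
Qed.

Section Comp.
Variables (a b c : int).
Hypothesis e : a + b = c.

Lemma shm_dif X i j (x : shift a (shift b X) i) :
  (transport X (j + a + b) (j + c) : {linear shift a (shift b X) j -> shift c X j})
    (dif (shift a (shift b X)) i j x) =
  dif (shift c X) i j ((transport X (i + a + b) (i + c) :
    {linear shift a (shift b X) i -> shift c X i}) x).
Proof.
have E k : k + a + b = k + c by rewrite -addrA e.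
rewrite /= {2}/shift_dif -e odd_abszD e /shift_dif.
move: (E i) (E j) x => /=; rewrite /shift_dif.
move: (i + c) (j + c) => i' j' <- <- x; rewrite !transport_id.
by case: (odd `|a|%N); case: (odd `|b|%N) => //=; rewrite opprK.
Qed.
(** The sum is a variable c with a proof of a + b = c, so the comparison fits whatever form the
    total degree takes. *)
Definition shm X : chmap (shift a (shift b X)) (shift c X) :=
  Chmap (@shm_dif X).

Lemma shm_quasi_iso X : quasi_iso (shm X).
Proof.
have E k : k + c = k + a + b by rewrite -addrA e.
have inv_dif i j x :
  (transport X (j + c) (j + a + b) : {linear shift c X j -> shift a (shift b X) j})
    (dif (shift c X) i j x) =
  dif (shift a (shift b X)) i j ((transport X (i + c) (i + a + b) :
    {linear shift c X i -> shift a (shift b X) i}) x).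
  have := shm_dif j (transport X (i + c) (i + a + b) x : shift a (shift b X) i).
  move=> /(congr1 (transport X (j + c) (j + a + b))).
  by rewrite (transportK (esym (E j))) => ->; rewrite /= (transportK (E i)).
apply: (@quasi_iso_bij _ _ _ (shm X) (Chmap inv_dif)) => i.
  exact: (transportK (esym (E i))).
exact: (transportK (E i)).
Qed.

(** Clear for chain maps; it passes to roofs by cancelling the inverted quasi-isomorphism. *)
Lemma shm_nat X Y (p : Hom X Y) :
  hsh c p ** Q (shm X) = Q (shm Y) ** hsh a (hsh b p).
Proof.
have H V Z (f : chmap V Z) :
    hsh c (Q f) ** Q (shm V) = Q (shm Z) ** hsh a (hsh b (Q f)).
  by rewrite !hsh_Q -!Q_comp; apply: Q_eq => i x; exact: (@transport_cm _ _ f (i + a + b) (i + c)).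
have [W [s [qs [f ->]]]] := roofP p.
rewrite !hsh_comp hcompA -H -!hcompA; congr (_ ** _).
apply: (hiso_epi (hiso_sh a (hiso_sh b (hiso_Q qs)))).
by rewrite -!hcompA -!hsh_comp QKi !hsh_1 hcomp1r -H hcompA -hsh_comp QKi hsh_1 hcomp1l.
Qed.

End Comp.

Lemma sh0_dif X i j x :
  (transport X (j + 0) j : {linear shift 0 X j -> X j}) (dif (shift 0 X) i j x) =
  dif X i j ((transport X (i + 0) i : {linear shift 0 X i -> X i}) x).
Proof.
move: x; rewrite /= /shift_dif /=.
have := (addr0 i, addr0 j); move: (i + 0) (j + 0) => i' j' [-> ->] x.
by rewrite !transport_id.
Qed.
Definition sh0 X : chmap (shift 0 X) X := Chmap (@sh0_dif X).

Lemma sh0_quasi_iso X : quasi_iso (sh0 X).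
Proof.
have inv_dif i j x :
  (transport X j (j + 0) : {linear X j -> shift 0 X j}) (dif X i j x) =
  dif (shift 0 X) i j ((transport X i (i + 0) : {linear X i -> shift 0 X i}) x).
  have := sh0_dif j (transport X i (i + 0) x : shift 0 X i).
  move=> /(congr1 (transport X j (j + 0))).
  rewrite (transportK (addr0 j)) => ->.
  by rewrite /= (transportK (esym (addr0 i))).
apply: (@quasi_iso_bij _ _ _ (sh0 X) (Chmap inv_dif)) => i.
  exact: (transportK (addr0 i)).
exact: (transportK (esym (addr0 i))).
Qed.

Lemma sh0_nat X Y (p : Hom X Y) : p ** Q (sh0 X) = Q (sh0 Y) ** hsh 0 p.
Proof.
have H V Z (f : chmap V Z) : Q f ** Q (sh0 V) = Q (sh0 Z) ** hsh 0 (Q f).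
  by rewrite !hsh_Q -!Q_comp; apply: Q_eq => i x; exact: (@transport_cm _ _ f (i + 0) i).
have [W [s [qs [f ->]]]] := roofP p.
rewrite !hsh_comp hcompA -H -!hcompA; congr (_ ** _).
apply: (hiso_epi (hiso_sh 0 (hiso_Q qs))).
by rewrite -!hcompA -!hsh_comp QKi !hsh_1 hcomp1r -H hcompA QKi hcomp1l.
Qed.

Definition shN (n : int) X := Q (sh0 X) ** Q (shm (addNr n) X).

Lemma shN_iso n X : hiso (shN n X).
Proof. apply: hiso_comp; apply: hiso_Q; [exact: sh0_quasi_iso | exact: shm_quasi_iso]. Qed.

Lemma shN_nat n X Y (p : Hom X Y) :
  p ** shN n X = shN n Y ** hsh (- n) (hsh n p).
Proof. by rewrite /shN hcompA sh0_nat -!hcompA shm_nat. Qed.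

Lemma hsh_inj n X Y (p q : Hom X Y) : hsh n p = hsh n q -> p = q.
Proof.
by move=> e; apply: (hiso_epi (shN_iso n X)); rewrite !shN_nat e.
Qed.

(** The shift by -n is an inverse up to the natural isomorphism [shN], so a preimage is obtained by
    conjugating with it. *)
Lemma hsh_full n X Y (q : Hom (shift n X) (shift n Y)) :
  exists p, q = hsh n p.
Proof.
have [t [e1 e2]] := shN_iso n X.
exists (shN n Y ** hsh (- n) q ** t); apply: (@hsh_inj (- n)).
by apply: (hiso_mono (shN_iso n Y)); rewrite -shN_nat -hcompA e1 hcomp1r.
Qed.

Definition hom0 X Y := forall p : Hom X Y, p = hzero X Y.

Lemma hom0P X Y : (forall f : dhom X Y, deq f (dzero X Y)) <-> hom0 X Y.
Proof.
split=> [h p|h f]; last by apply/clE; rewrite (h (cl f)).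
by have [a ->] := homP p; apply/clE.
Qed.

Lemma hom0_iso X X' Y Y' (a : Hom X' X) (b : Hom Y' Y) :
  hiso a -> hiso b -> hom0 X Y -> hom0 X' Y'.
Proof.
move=> [a' [ea _]] ib h p; apply: (hiso_mono ib).
rewrite hcomp0r -[p]hcomp1r -ea !hcompA.
have -> : b ** p ** a' = hzero _ _ by exact: h.
by rewrite hcomp0l.
Qed.

Lemma hom0_shn n X Y : hom0 (shift n X) (shift n Y) <-> hom0 X Y.
Proof.
split=> h p; first by apply: (@hsh_inj n); rewrite (h (hsh n p)) hsh_0.
by have [q ->] := hsh_full p; rewrite (h q) hsh_0.
Qed.

Lemma hom0_shift a b X Y :
  hom0 (shift a X) (shift b Y) <-> hom0 X (shift (b - a) Y).
Proof.
rewrite -(hom0_shn a X).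
have S : hiso (Q (shm (subrKC a b : a + (b - a) = b) Y)).
  exact/hiso_Q/shm_quasi_iso.
split; first exact: hom0_iso (hiso1 _) S.
have [t' [e1' e2']] := S; apply: hom0_iso (hiso1 _) _.
by exists (Q (shm (subrKC a b : a + (b - a) = b) Y)); split; eassumption.
Qed.

Lemma hom0_shift0 X Y : hom0 X (shift 0 Y) <-> hom0 X Y.
Proof.
have S : hiso (Q (sh0 Y)) by exact/hiso_Q/sh0_quasi_iso.
split; last exact: hom0_iso (hiso1 _) S.
have [t [e1 e2]] := S; apply: hom0_iso (hiso1 _) _.
by exists (Q (sh0 Y)); split; eassumption.
Qed.

End ShiftIso.

(** * Coproducts and Milnor colimits *)

Section Milnor.
Variable R : nzRingType.
Implicit Types X Y Z W G : cplx R.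

Definition hcoprod (I : Type) (A : I -> cplx R) S (inj : forall i, Hom (A i) S) :=
  (forall Y (f : forall i, Hom (A i) Y), exists g, forall i, g ** inj i = f i) /\
  (forall Y (g g' : Hom S Y), (forall i, g ** inj i = g' ** inj i) -> g = g').

Lemma is_coprodP (I : Type) (A : I -> cplx R) S (inj : forall i, dhom (A i) S) :
  is_coprod inj <-> hcoprod (fun i => cl (inj i)).
Proof.
split=> [H|[H1 H2] Y f].
  split=> [Y f|Y g g'].
    have [[g hg] _] := H Y (fun i => rep (f i)); exists (cl g) => i.
    by rewrite cl_comp -[f i]repK; apply/clE.
  have [[a ->] [b ->]] := (homP g, homP g') => h.
  apply/clE; have [_] := H Y (fun i => dcomp a (inj i)); apply=> i.
  by apply/clE; rewrite -!cl_comp.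
split=> [|g g' h]; last first.
  by apply/clE; apply: H2 => i; rewrite !cl_comp; apply/clE.
have [g hg] := H1 Y (fun i => cl (f i)); have [a ea] := homP g.
by exists a => i; apply/clE; rewrite -cl_comp -ea.
Qed.

Lemma hcoprod_hom0 (I : Type) (A : I -> cplx R) S (inj : forall i, Hom (A i) S) W :
  hcoprod inj -> (forall i, hom0 (A i) W) -> hom0 S W.
Proof.
by move=> [_ U] h p; apply: U => i; rewrite hcomp0l; apply: h.
Qed.

Lemma hcoprod_proj (I : eqType) (A : I -> cplx R) S (inj : forall i, Hom (A i) S) i :
  hcoprod inj -> exists pr : Hom S (A i),
    pr ** inj i = h1 (A i) /\ forall j, j != i -> pr ** inj j = hzero _ _.
Proof.
move=> [E _].
pose d j : Hom (A j) (A i) :=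
  if j =P i is ReflectT e then ecast k (Hom (A j) (A k)) e (h1 (A j))
  else hzero _ _.
have [pr hpr] := E _ d; exists pr; split=> [|j ne]; rewrite hpr /d.
  by case: eqP => // e; rewrite eq_axiomK.
by case: eqP ne => // ->; rewrite eqxx.
Qed.

(** Every target is isomorphic to some Sigma^n V, so all maps out of Sigma^n S can be unshifted. *)
Lemma hcoprod_shift n (I : Type) (A : I -> cplx R) S (inj : forall i, Hom (A i) S) :
  hcoprod inj -> hcoprod (fun i => hsh n (inj i)).
Proof.
move=> [E U].
have iso Y : exists (V : cplx R) (t : Hom (shift n V) Y), hiso t.
  exists (shift (- n) Y), (Q (sh0 Y) ** Q (shm (subrr n) Y)).
  by apply: hiso_comp; apply: hiso_Q; [exact: sh0_quasi_iso|exact: shm_quasi_iso].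
split=> [Y f|Y g g' h]; have [V [t it]] := iso Y; have [t' [e1 e2]] := it.
  have H i : exists k, t' ** f i = hsh n k by exact: hsh_full.
  have [g hg] := E V (fun i => projT1 (cid (H i))); exists (t ** hsh n g) => i.
  rewrite -hcompA -hsh_comp hg; case: cid => k /= <-.
  by rewrite hcompA e2 hcomp1l.
have [[k ek] [k' ek']] := (hsh_full (t' ** g), hsh_full (t' ** g')).
have it' : hiso t' by exists t.
apply: (hiso_mono it'); rewrite ek ek'; congr hsh; apply: U => i.
by apply: (@hsh_inj _ n); rewrite !hsh_comp -ek -ek' -!hcompA h.
Qed.

Section Coproduct.
Variables (Y : nat -> cplx R) (S : cplx R) (inj : forall n, Hom (Y n) S).
Hypothesis cS : hcoprod inj.

(** The idempotent of the coproduct that projects onto its first N summands. *)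
Definition is_trunc N (e : Hom S S) :=
  forall n, e ** inj n = if (n < N)%N then inj n else hzero _ _.

Lemma truncP N : exists e, is_trunc N e.
Proof.
by have [e he] := cS.1 _ (fun n => if (n < N)%N then inj n else hzero _ _); exists e.
Qed.

Lemma trunc_uniq N e e' : is_trunc N e -> is_trunc N e' -> e = e'.
Proof. by move=> h h'; apply: cS.2 => n; rewrite h h'. Qed.

Lemma trunc_comp M N e e' :
  (N <= M)%N -> is_trunc M e -> is_trunc N e' -> e ** e' = e'.
Proof.
move=> le h h'; apply: cS.2 => n; rewrite -hcompA h'.
case: ifP => lt; last by rewrite hcomp0r.
by rewrite h (leq_trans lt le).
Qed.

(** Compactness of G with respect to this one coproduct: every map factors through finitely many
    summands. The truncation idempotents express this without finite subcoproducts. *)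
Definition fin_supp G := forall x : Hom G S,
  exists N, forall e, is_trunc N e -> e ** x = x.

Lemma trunc_stable G M N e (x : Hom G S) : (N <= M)%N ->
  (forall e, is_trunc N e -> e ** x = x) -> is_trunc M e -> e ** x = x.
Proof.
move=> le h he; have [e' he'] := truncP N.
by rewrite -(h _ he') hcompA (trunc_comp le he he').
Qed.

Lemma fin_supp_iso G G' (a : Hom G G') : hiso a -> fin_supp G' -> fin_supp G.
Proof.
move=> [a' [e1 e2]] F x; have [N hN] := F (x ** a'); exists N => e he.
by rewrite -[x]hcomp1r -e1 (hcompA x) [LHS]hcompA hN.
Qed.

Lemma fin_supp_hom0 G : hom0 G S -> fin_supp G.
Proof. by move=> h x; exists 0%N => e _; rewrite (h x) hcomp0r. Qed.

(** If [e] fixes the restriction of x to A, then x - e x factors through C; a truncation beyond both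
    bounds then fixes x. *)
Lemma fin_supp_tri A B C (f : Hom A B) (g : Hom B C) (h : Hom C (shift 1 A)) :
  tri f g h -> fin_supp A -> fin_supp C -> fin_supp B.
Proof.
move=> t FA FC x; have [N hN] := FA (x ** f); have [e he] := truncP N.
have [|y ey] := tri_ext (p := x +! hopp (e ** x)) t.
  by rewrite hadd_compl hoppl -hcompA (hN _ he) haddNr.
have [M hM] := FC y; exists (maxn N M) => d hd.
have := trunc_stable (leq_maxr N M) hM hd.
move/(congr1 (fun z => z ** g)); rewrite -hcompA -ey hadd_compr hoppr hcompA.
rewrite (trunc_comp (leq_maxl N M) hd he).
by move/(congr1 (fun z => z +! (e ** x))); rewrite -!haddA haddNl !hadd0r.
Qed.

Lemma fin_supp_retract G G' (s : Hom G G') (p : Hom G' G) :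
  p ** s = h1 G -> fin_supp G' -> fin_supp G.
Proof.
move=> e F x; have [N hN] := F (x ** p); exists N => d hd.
by rewrite -[x]hcomp1r -e (hcompA x) [LHS]hcompA hN.
Qed.

Section Telescope.
Variables (beta : forall n, Hom (Y n) (Y n.+1)) (phi : Hom S S) (T : cplx R).
Variables (u : Hom S T) (v : Hom T (shift 1 S)).
Hypothesis phiE : forall n, phi ** inj n = inj n +! hopp (inj n.+1 ** beta n).
Hypothesis tT : tri phi u v.

Lemma colim_comm n : u ** inj n.+1 ** beta n = u ** inj n.
Proof.
have := tri_comp0 tT; move/(congr1 (fun z => z ** inj n)).
rewrite hcomp0l -hcompA phiE hadd_compr hoppr hcompA => /hsub_eq0.
by move->.
Qed.

(** Since [phi] is the identity minus the maps [beta], it moves the n-th summand into the next one,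
    which the larger truncation cuts off; the n-th inclusion is left over. *)
Lemma trunc_phi n e e' :
  is_trunc n e -> is_trunc n.+1 e' -> e' ** phi = phi ** e +! (e' +! hopp e).
Proof.
move=> h h'; apply: cS.2 => m.
rewrite -hcompA phiE hadd_compr hoppr hcompA !h'.
rewrite !hadd_compl hoppl -hcompA h h' !ltnS.
have [lt|gt|->] := ltngtP m n.
- by rewrite phiE haddNr hadd0r.
- by rewrite hcomp0l hcomp0r hopp0 !hadd0l.
- by rewrite hcomp0l hcomp0r hopp0 !hadd0r hadd0l.
Qed.

(** All transition maps of the system Hom(G, Y n) are zero, hence so is its colimit; finite support
    identifies this colimit with Hom(G, T). *)
Lemma telescope_hom0 G : fin_supp G ->
  (forall x : Hom G (shift 1 S),
     exists N, forall e, is_trunc N e -> hsh 1 e ** x = x) ->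
  (forall n (x : Hom G (Y n)), beta n ** x = hzero _ _) -> hom0 G T.
Proof.
move=> F0 F1 b0 x.
have vx0 : v ** x = hzero _ _.
  have e0 : hsh 1 phi ** (v ** x) = hzero _ _.
    apply: hopp_inj0; rewrite hcompA -hoppl -hoppl.
    by rewrite (tri_comp0 (tri_rot (tri_rot tT))) hcomp0l.
  have [N hN] := F1 (v ** x); have [e he] := truncP N.
  (* On maps of finite support [hsh 1 phi] is injective: by [trunc_phi] the truncations of v x
     vanish one after another. *)
  rewrite -(hN e he) => {hN}.
  elim: N e he => [|N IH] e he.
    have -> : e = hzero _ _ by apply: cS.2 => n; rewrite he hcomp0l.
    by rewrite hsh_0 hcomp0l.
  have [e' he'] := truncP N.
  have := congr1 (fun z => hsh 1 z ** (v ** x)) (trunc_phi he' he).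
  rewrite !hsh_add hsh_opp !hsh_comp !hadd_compl hoppl (IH _ he').
  by rewrite -!hcompA e0 (IH _ he') !hcomp0r hopp0 hadd0r hadd0l.
have [y ey] := tri_lift (tri_rot tT) vx0.
have [N hN] := F0 y; have [e he] := truncP N.
(* The [beta] part of [phi] kills maps out of G, so phi fixes y, and x = u y = u phi y = 0. *)
suff E : phi ** (e ** y) = e ** y.
  by rewrite ey -(hN e he) -E !hcompA (tri_comp0 tT) !hcomp0l.
elim: N {hN} e he => [|N IH] e he.
  have -> : e = hzero _ _ by apply: cS.2 => n; rewrite he hcomp0l.
  by rewrite hcomp0l hcomp0r.
have [e' he'] := truncP N.
have [pr [pr1 pr0]] := hcoprod_proj N cS.
have ee : e = e' +! inj N ** pr.
  apply: cS.2 => m; rewrite he hadd_compl he' -hcompA ltnS.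
  have [lt|gt|->] := ltngtP m N; last by rewrite pr1 hcomp1r hadd0l.
    by rewrite pr0 ?hcomp0r ?hadd0r // neq_ltn lt.
  by rewrite pr0 ?hcomp0r ?hadd0r // neq_ltn gt orbT.
rewrite ee hadd_compl hadd_compr (IH _ he'); congr (_ +! _).
rewrite -!hcompA (hcompA phi) phiE hadd_compl hoppl -hcompA b0 hcomp0r hopp0.
by rewrite hadd0r.
Qed.

Section Tower.
Variables (Z : nat -> cplx R) (alpha : forall n, Hom (Z n) (Y n)).
Variable (gamma : forall n, Hom (Y n.+1) (shift 1 (Z n))).
Hypothesis tY : forall n, tri (alpha n) (beta n) (gamma n).
Variable W : cplx R.
Hypothesis Z0 : forall n, hom0 (Z n) W.

(** As Hom(Z n, W) = 0, every map on Y n extends along [beta n]. Choosing extensions recursively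
    shows that composition with [phi] maps Hom(S, W) onto itself, even with the value on Y 0
    prescribed: the vanishing of lim^1. *)
Lemma tower_ext (c : forall n, Hom (Y n) W) (p : Hom (Y 0%N) W) :
  exists g : Hom S W, g ** inj 0%N = p /\ forall n, g ** phi ** inj n = c n.
Proof.
have H n (x : Hom (Y n) W) : exists y : Hom (Y n.+1) W,
      y ** beta n = x +! hopp (c n).
  have [|y ->] := tri_ext (p := x +! hopp (c n)) (tY n).
    exact: Z0.
  by exists y.
pose f := fix f n : Hom (Y n) W := if n is m.+1 then projT1 (cid (H m (f m))) else p.
have [g hg] := cS.1 _ f; exists g; split; first by rewrite hg.
move=> n; rewrite -hcompA phiE hadd_compr hoppr hcompA !hg /=.
case: cid => y /= ->.
by rewrite hopp_add hoppK haddA haddNr hadd0l.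
Qed.

Lemma colim_ext (p : Hom (Y 0%N) W) : exists q, p = q ** (u ** inj 0%N).
Proof.
have [g [<- h]] := tower_ext (fun n => hzero _ _) p.
have [|q ->] := tri_ext (p := g) tT; last by exists q; rewrite hcompA.
by apply: cS.2 => n; rewrite h hcomp0l.
Qed.

(** From Y 0 the vanishing climbs the tower, because Hom(Sigma Z n, Sigma W) = 0; thus q factors
    through v. The factor is the suspension of some g phi by [tower_ext], and (Sigma phi) v = 0. *)
Lemma colim_hom0 (q : Hom T (shift 1 W)) :
  q ** (u ** inj 0%N) = hzero _ _ -> q = hzero _ _.
Proof.
move=> q0; have qu : q ** u = hzero _ _.
  apply: cS.2 => n; rewrite hcomp0l -hcompA.
  elim: n => // n IH.
  have [|x ->] := tri_ext (p := q ** (u ** inj n.+1)) (tri_rot (tY n)).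
    by rewrite -hcompA colim_comm.
  have -> : x = hzero _ _ by apply/hom0_shn: x.
  exact: hcomp0l.
have [x ->] := tri_ext (tri_rot tT) qu; have [y ->] := hsh_full x.
have [g [_ h]] := tower_ext (fun n => y ** inj n) (hzero _ _).
have <- : g ** phi = y by apply: cS.2.
rewrite hsh_comp -hcompA -[hsh 1 phi]hoppK hoppl.
by rewrite (tri_comp0 (tri_rot (tri_rot tT))) hopp0 hcomp0r.
Qed.
End Tower.
End Telescope.
End Coproduct.
End Milnor.

(** * Thick subcategories *)

Section Thick.
Variable R : nzRingType.
Implicit Types X Y Z W : cplx R.

Section Octahedron.
Variables (A B C : cplx R) (u : chmap A B) (v : chmap B C).

Lemma oct_map_linear i :
  linear (fun p : cone u i => (p.1, v i p.2) : cone (cm_comp v u) i).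
Proof. by move=> l x y; congr pair => /=; rewrite linearP. Qed.
Lemma oct_map_dif i j x : mklin (@oct_map_linear j) (dif (cone u) i j x) =
  dif (cone (cm_comp v u)) i j (mklin (@oct_map_linear i) x).
Proof.
apply: (chmap_succ (f := fun i => mklin (@oct_map_linear i))) => {}i _ <- {}x.
by rewrite !cone_difE; congr pair => /=; rewrite raddfD /= cm_dif.
Qed.
Definition oct_map : chmap (cone u) (cone (cm_comp v u)) := Chmap oct_map_dif.

Lemma oct_in_linear i :
  linear (fun p : cone v i => ((0, p.1), (0, p.2)) : cone oct_map i).
Proof.
move=> l x y; congr pair; congr pair => /=; by rewrite ?linearP ?scaler0 ?addr0.
Qed.
Lemma oct_in_dif i j x : mklin (@oct_in_linear j) (dif (cone v) i j x) =
  dif (cone oct_map) i j (mklin (@oct_in_linear i) x).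
Proof.
apply: (chmap_succ (f := fun i => mklin (@oct_in_linear i))) => {}i _ <- {}x.
rewrite !cone_difE; congr pair; congr pair => /=;
  by rewrite ?transport_id ?raddf0; abel.
Qed.
Definition oct_in : chmap (cone v) (cone oct_map) := Chmap oct_in_dif.

(** The octahedral axiom for a composite of chain maps: the two copies of A in the cone of cone u ->
    cone (v u) cancel and cone v remains. *)
Lemma oct_in_quasi_iso : quasi_iso oct_in.
Proof.
split=> k; rewrite -(subrK 1 k); move: (k - 1) => i.
  move=> [y z] _ /cone_coboundary[[a b] [[a' c] []]].
  rewrite !cone_difE => -[ea ey] [ea' ez].
  apply/cone_coboundary; exists (b + u _ a'), c; split.
    move: ey ea'; rewrite /= => -> /eqP; rewrite eq_sym subr_eq0 => /eqP ->.
    by congr (- _); rewrite raddfD /= -cm_dif; abel.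
  by move: ez => /= ->; rewrite raddfD; abel.
move=> [[x y] [x' z]] /cone_cocycle[]; rewrite !cone_difE => -[e1 e2] [e3 e4].
have {e1} c1 : @cocycle _ (cone v) (i + 1) (y + u _ x', z).
  apply/cone_cocycle; split => /=.
    rewrite raddfD /= -cm_dif; apply: etrans e2.
    by rewrite (subr0_eq e3); abel.
  by apply: etrans e4; rewrite raddfD /=; abel.
exists (y + u _ x', z) => //.
apply/cone_coboundary; exists (x', 0), (0, 0).
rewrite !cone_difE; split; congr pair => /=; rewrite ?raddf0.
- by rewrite (subr0_eq e3); abel.
- abel.
- abel.
- abel.
Qed.
End Octahedron.

Lemma tri_complete X Y (f : Hom X Y) : exists Z (g : Hom Y Z) h, tri f g h.
Proof.
have [W [s [qs [k ->]]]] := roofP f.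
have is' : hiso (Qi qs) by exists (Q s); rewrite QiK QKi.
exists (cone k), (Q (cone_in k)), (hsh 1 (Q s) ** Q (cone_out k)).
apply: (tri_iso is' (hiso1 _) (hiso1 _)) (tri_cone k).
- by rewrite hcomp1l.
- by rewrite hcomp1l hcomp1r.
- by rewrite hcompA -hsh_comp QKi hsh_1 hcomp1l hcomp1r.
Qed.

(** The third map of the triangle on a split monomorphism s is zero, so the triangle splits and the
    cone of s is a complement of X. This turns closure under binary coproduct summands into closure
    under retracts. *)
Lemma retract_coprod X Y (s : Hom X Y) (p : Hom Y X) : p ** s = h1 X ->
  exists Z (t : Hom Z Y), forall W (f : Hom X W) (g : Hom Z W),
    (exists k, k ** s = f /\ k ** t = g) /\ (forall k k' : Hom Y W, k ** s = k' ** s -> k ** t = k' ** t -> k = k').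
Proof.
move=> ps; have [Z [g [h T]]] := tri_complete s; exists Z.
have h0 : h = hzero _ _.
  rewrite -[h]hcomp1l -hsh_1 -ps hsh_comp -hcompA.
  rewrite -[hsh 1 s]hoppK hoppl (tri_comp0 (tri_rot (tri_rot T))).
  by rewrite hopp0 hcomp0r.
have gs := tri_comp0 T.
have [|t et] := tri_ext (p := h1 Y +! hopp (s ** p)) T.
  by rewrite hadd_compl hcomp1l hoppl -hcompA ps hcomp1r haddNr.
have epi0 W (x : Hom Z W) : x ** g = hzero _ _ -> x = hzero _ _.
  by move=> e; have [y ->] := tri_ext (tri_rot T) e; rewrite h0 hcomp0r.
have pt : p ** t = hzero _ _.
  apply: epi0; rewrite -hcompA -et hadd_compr hoppr hcompA ps hcomp1l hcomp1r.
  exact: haddNr.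
have gt : g ** t = h1 Z.
  apply: hsub_eq0; apply: epi0; rewrite hadd_compl -hcompA -et hoppl hcomp1l.
  rewrite hadd_compr hcomp1r hoppr hcompA gs hcomp0l hopp0 hadd0r.
  exact: haddNr.
exists t => W a b; split.
  exists (a ** p +! b ** g); rewrite !hadd_compl -!hcompA ps gs pt gt.
  by rewrite !hcomp1r !hcomp0r hadd0l hadd0r.
move=> k k' e1 e2.
have e : h1 Y = s ** p +! t ** g.
  by rewrite -et haddC -haddA haddNl hadd0r.
by rewrite -[k]hcomp1r -[k']hcomp1r e !hadd_compr !hcompA e1 e2.
Qed.

Section Closed.
Variable P : cplx R -> Prop.
Hypotheses (tP : triangulated_subcat P) (sP : summand_closed P).

Lemma closed_iso X Y (f : Hom X Y) : hiso f -> P X -> P Y.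
Proof. by case: tP => sf _ _ _ h; apply: sf; apply/disoP; exists f. Qed.

Lemma closed_tri X Y Z (f : Hom X Y) (g : Hom Y Z) h :
  tri f g h -> P X -> P Y -> P Z.
Proof.
have [[[a ->] [b ->]] [c ->]] := (homP f, homP g, homP h).
by move=> /triangleP; case: tP => _ _ _; apply.
Qed.

Lemma closed_shift n X : P X -> P (shift n X).
Proof.
have S (k : nat) Y : P Y -> P (shift k%:Z Y) /\ P (shift (- k%:Z) Y).
  elim: k Y => [|k IH] Y pY.
    have [t [e1 e2]] := hiso_Q (sh0_quasi_iso Y).
    rewrite oppr0; suff : P (shift 0 Y) by [].
    by apply: closed_iso pY; exists (Q (sh0 Y)); split; eassumption.
  have [p1 p2] := IH _ pY; case: tP => _ _ C _.
  have [/C[q1 _] /C[_ q2]] := (p1, p2); split.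
    have e : 1 + k%:Z = k.+1%:Z by rewrite -intS.
    exact: closed_iso (hiso_Q (shm_quasi_iso e Y)) q1.
  have e : - 1 - k%:Z = - k.+1%:Z by rewrite intS opprD.
  exact: closed_iso (hiso_Q (shm_quasi_iso e Y)) q2.
move=> pX; case: n => n; first by have [] := S n _ pX.
by rewrite NegzE; have [] := S n.+1 _ pX.
Qed.

Lemma closed_unshift n X : P (shift n X) -> P X.
Proof. by move=> /(closed_shift (- n)); apply/closed_iso/shN_iso. Qed.

Lemma closed_tri_mid X Y Z (f : Hom X Y) (g : Hom Y Z) h :
  tri f g h -> P X -> P Z -> P Y.
Proof.
move=> T pX pZ; apply/closed_unshift/(closed_tri (tri_rot (tri_rot T)) pZ).
exact: closed_shift.
Qed.

Lemma closed_retract X Y (s : Hom X Y) (p : Hom Y X) :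
  p ** s = h1 X -> P Y -> P X.
Proof.
move=> /retract_coprod[Z [t H]] pY.
pose inj (b : bool) : dhom (if b then X else Z) Y :=
  if b as b0 return dhom (if b0 then X else Z) Y then rep s else rep t.
apply: (sP (inj := inj)) pY; apply/is_coprodP; split=> [W f|W g g' h].
  have [[k [e1 e2]] _] := H W (f true) (f false); exists k.
  by case; rewrite /= repK.
have [_ U] := H W (g ** s) (g ** t).
by apply: U; [have := h true | have := h false]; rewrite /= repK.
Qed.

Lemma closed_cone_comp A B C (u : chmap A B) (v : chmap B C) :
  P (cone u) -> P (cone v) -> P (cone (cm_comp v u)).
Proof.
move=> pu pv; apply: (closed_tri_mid (tri_cone (oct_map u v)) pu).
exact: closed_iso (hiso_Q (oct_in_quasi_iso u v)) pv.
Qed.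

(** If u is zero in the derived category, the identity of Sigma A lifts to the cone of u, and Sigma
    A is a retract of it. *)
Lemma closed_null A B (u : chmap A B) :
  Q u = hzero A B -> P (cone u) -> P A.
Proof.
move=> u0 pc; apply: (@closed_unshift 1).
have [|s es] := tri_lift (p := h1 (shift 1 A)) (tri_rot (tri_cone_rot u)).
  by rewrite hcomp1r u0 hsh_0 hopp0.
exact: (closed_retract (esym es) pc).
Qed.
End Closed.
End Thick.

(** * Bounded complexes of injectives and of projectives *)

Section Submodule.
Variables (R : nzRingType) (M : lmodType R).

(** Membership is a proposition, so that conditions such as being a cocycle or lying in an image can
    be used. *)
Record submodule := Submodule {
  sm_mem :> M -> Prop;
  sm_0 : sm_mem 0;
  sm_lin : forall a x y, sm_mem x -> sm_mem y -> sm_mem (a *: x + y) }.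

Variable S : submodule.

Record subm := Subm { sm_val : M; sm_valP : S sm_val }.

Lemma subm_inj : injective sm_val.
Proof.
move=> [x hx] [y hy] /= e; subst y; congr Subm; exact: Prop_irrelevance.
Qed.

HB.instance Definition _ := gen_eqMixin subm.
HB.instance Definition _ := gen_choiceMixin subm.

Lemma sm_add x y : S x -> S y -> S (x + y).
Proof. by move=> hx hy; rewrite -[x]scale1r; apply: sm_lin. Qed.
Lemma sm_scale a x : S x -> S (a *: x).
Proof. by move=> hx; rewrite -[_ *: _]addr0; apply: sm_lin => //; apply: sm_0. Qed.
Lemma sm_opp x : S x -> S (- x).
Proof. by move=> hx; rewrite -scaleN1r; apply: sm_scale. Qed.

Definition subm_0 := Subm (sm_0 S).
Definition subm_add (x y : subm) := Subm (sm_add (sm_valP x) (sm_valP y)).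
Definition subm_opp (x : subm) := Subm (sm_opp (sm_valP x)).
Definition subm_scale a (x : subm) := Subm (sm_scale a (sm_valP x)).

Lemma subm_addA : associative subm_add.
Proof. by move=> x y z; apply: subm_inj; apply: addrA. Qed.
Lemma subm_addC : commutative subm_add.
Proof. by move=> x y; apply: subm_inj; apply: addrC. Qed.
Lemma subm_add0 : left_id subm_0 subm_add.
Proof. by move=> x; apply: subm_inj; apply: add0r. Qed.
Lemma subm_addN : left_inverse subm_0 subm_opp subm_add.
Proof. by move=> x; apply: subm_inj; apply: addNr. Qed.
HB.instance Definition _ :=
  GRing.isZmodule.Build subm subm_addA subm_addC subm_add0 subm_addN.

Lemma subm_scaleA a b v : subm_scale a (subm_scale b v) = subm_scale (a * b) v.
Proof. by apply: subm_inj; apply: scalerA. Qed.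
Lemma subm_scale1 : left_id 1 subm_scale.
Proof. by move=> x; apply: subm_inj; apply: scale1r. Qed.
Lemma subm_scaleDr : right_distributive subm_scale +%R.
Proof. by move=> a x y; apply: subm_inj; apply: scalerDr. Qed.
Lemma subm_scaleDl v : {morph subm_scale^~ v : a b / a + b}.
Proof. by move=> a b; apply: subm_inj; apply: scalerDl. Qed.
HB.instance Definition _ := GRing.Zmodule_isLmodule.Build R subm
  subm_scaleA subm_scale1 subm_scaleDr subm_scaleDl.

Lemma sm_val_linear : linear sm_val. Proof. by []. Qed.
Definition sm_incl : {linear subm -> M} := mklin sm_val_linear.

Lemma sm_corestr_linear (N : lmodType R) (f : {linear N -> M})
  (h : forall x, S (f x)) : linear (fun x => Subm (h x)).
Proof. by move=> a x y; apply: subm_inj; rewrite /= linearP. Qed.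
Definition sm_corestr (N : lmodType R) (f : {linear N -> M})
  (h : forall x, S (f x)) : {linear N -> subm} :=
  mklin (@sm_corestr_linear N f h).
End Submodule.

Section Images.
Variable R : nzRingType.
Implicit Types A B I : lmodType R.

Section Image.
Variables (A B : lmodType R) (u : {linear A -> B}).
Lemma im_0 : exists x, u x = 0. Proof. by exists 0; rewrite raddf0. Qed.
Lemma im_lin a x y : (exists z, u z = x) -> (exists z, u z = y) ->
  exists z, u z = a *: x + y.
Proof. by move=> [z <-] [t <-]; exists (a *: z + t); rewrite linearP. Qed.
Definition im_sub := Submodule im_0 im_lin.

Lemma factor_through_im I (v : {linear A -> I}) :
  (forall x, u x = 0 -> v x = 0) ->
  exists w : {linear subm im_sub -> I}, forall x (y : subm im_sub),
    u x = sm_val y -> w y = v x.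
Proof.
move=> h; pose w (y : subm im_sub) := v (projT1 (cid (sm_valP y))).
have wE x (y : subm im_sub) : u x = sm_val y -> w y = v x.
  move=> e; rewrite /w; case: cid => z /= ez; apply: subr0_eq.
  by rewrite -raddfB; apply: h; rewrite raddfB /= ez e subrr.
have wl : linear w.
  move=> a y z; have [[y' ey] [z' ez]] := (sm_valP y, sm_valP z).
  rewrite (wE y' y) // (wE z' z) // -linearP; apply: wE.
  by rewrite linearP ey ez.
by exists (mklin wl).
Qed.
End Image.

(** The condition on kernels lets v factor through the image of u, from which injectivity extends
    it. *)
Lemma injective_module_ext A B I (u : {linear A -> B}) (v : {linear A -> I}) :
  injective_module I -> (forall x, u x = 0 -> v x = 0) ->
  exists w : {linear B -> I}, forall x, w (u x) = v x.
Proof.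
move=> injI /factor_through_im[w hw].
have [w' hw'] := injI _ _ (sm_incl (im_sub u)) w (@subm_inj _ _ _).
exists w' => x; have hx : im_sub u (u x) by exists x.
by rewrite -(hw x (Subm hx)) // -hw'.
Qed.

End Images.

Section Resolutions.
Variable R : nzRingType.
Implicit Types X Y Z W J : cplx R.

Definition acyclic X := forall i (x : X i), cocycle x -> coboundary x.

Lemma cone_acyclic X Y (s : chmap X Y) : quasi_iso s -> acyclic (cone s).
Proof.
move=> [si ss] k; rewrite -(subrK 1 k); move: (k - 1) => i [x y].
move=> /cone_cocycle[/= cx cy].
have [x0 ex0] : exists x0, x = dif X (i + 1) (i + 1 + 1) x0.
  apply: (coboundary_succ (erefl (i + 1 + 1))); apply: si.
    exact: cocycle_succ cx.
  by exists (i + 1), (- y); rewrite raddfN; apply: (addr_comb cy); abel.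
have cz : cocycle (y + s _ x0).
  apply: (cocycle_succ (erefl (i + 1 + 1))); rewrite raddfD /= -cm_dif -ex0.
  by apply: etrans cy; abel.
have [z cz' /(coboundary_succ (erefl (i + 1)))[t et]] := ss _ _ cz.
apply/cone_coboundary; exists (z - x0), t; split.
  by rewrite raddfB /= cz' -ex0; abel.
by rewrite -et raddfB /=; abel.
Qed.

(** The null-homotopy lives on W and X: its part on X is the map [g], and its part on W, with a
    sign, is the homotopy from k to g s. *)
Lemma cone_out_ext W X J (s : chmap W X) (k : chmap W J) :
  homotopic (cm_comp (cm_shift 1 k) (cone_out s)) (cm_zero _ _) ->
  exists g : chmap X J, homotopic k (cm_comp g s).
Proof.
move=> /homotopicP[H HH].
pose g i (x : X i) : J i :=
  transport J (i - 1 + 1) i (H i (i - 1) ((0, x) : cone s i)).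
have gl i : linear (@g i).
  move=> l x y; rewrite /g.
  have -> : (0, l *: x + y) = l *: (0, x) + (0, y) :> cone s i.
    by congr pair; rewrite /= scaler0 addr0.
  by rewrite !linearP.
have gE j i (x : X i) : j + 1 = i ->
    g i x = transport J (j + 1) i (H i j ((0, x) : cone s i)).
  by move=> e; have -> : j = i - 1 by rewrite -e addrK.
have HE j (p : cone s (j + 1)) : k (j + 1 + 1) p.1 =
    - dif J (j + 1) (j + 1 + 1) (H (j + 1) j p) +
    H (j + 1 + 1) (j + 1) (- dif W (j + 1 + 1) (j + 1 + 1 + 1) p.1,
       s (j + 1 + 1) p.1 + dif X (j + 1) (j + 1 + 1) p.2).
  have := HH (j + 1) j _ (erefl (j + 1)) (erefl (j + 1 + 1)) p.
  by rewrite [LHS]subr0 cone_difE.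
have gd i j x : mklin (@gl j) (dif X i j x) = dif J i j (mklin (@gl i) x).
  apply: (chmap_succ (f := fun i => mklin (@gl i))) => {}i _ <- {}x /=.
  rewrite (gE i _ _ erefl) transport_id.
  have [m em] : exists m, m + 1 = i by exists (i - 1); rewrite subrK.
  subst i; rewrite (gE m _ _ erefl) transport_id.
  have /= := HE m (0, x); rewrite !raddf0 add0r => e.
  by apply: (addr_comb (esym e)); abel.
exists (Chmap gd); apply/homotopicP.
pose h a b (w : W a) : J b := - transport J (b - 1 + 1) b
  (H b (b - 1) ((transport W a (b + 1) w, 0) : cone s b)).
have hl a b : linear (@h a b).
  move=> l x y; rewrite /h.
  have -> : (transport W a (b + 1) (l *: x + y), 0) =
    l *: (transport W a (b + 1) x, 0) + (transport W a (b + 1) y, 0) :> cone s b.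
    by congr pair; rewrite /= ?linearP // scaler0 addr0.
  by rewrite !linearP.
exists (fun a b => mklin (@hl a b)) => l i m ei em w; subst l m.
have [j ej] : exists j, j + 1 = i by exists (i - 1); rewrite subrK.
subst i; rewrite /= /h (gE _ _ _ erefl) !transport_id.
have ej : j + 1 - 1 = j by rewrite addrK.
have HE' := HE j (w, 0); move: HE'; rewrite /= raddf0 addr0 => ->.
move: ej; move: (j + 1 - 1) => j' ej; subst j'; rewrite transport_id.
have -> : j + 1 + 1 - 1 = j + 1 by rewrite addrK.
rewrite transport_id raddfN /=.
have -> : (- dif W (j + 1 + 1) (j + 1 + 1 + 1) w, s (j + 1 + 1) w) =
  (0, s (j + 1 + 1) w) - (dif W (j + 1 + 1) (j + 1 + 1 + 1) w, 0)
   :> cone s (j + 1 + 1).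
  by congr pair; rewrite /= ?subr0 ?sub0r.
by rewrite raddfB /=; abel.
Qed.

(** K-injective and, below, K-projective complexes: derived maps into the former and out of the
    latter come from chain maps. *)
Definition kinj J := forall A, acyclic A -> forall f : chmap A J,
  homotopic f (cm_zero A J).
Definition kproj P := forall A, acyclic A -> forall f : chmap P A,
  homotopic f (cm_zero P A).

(** The map to be contracted is cone s -> Sigma W -> Sigma J, which is why the hypothesis is on the
    shifted complex. *)
Lemma kinj_shift1 J : kinj (shift 1 J) -> forall X (p : Hom X J),
  exists f : chmap X J, p = Q f.
Proof.
move=> kJ X p; have [W [s [qs [f ->]]]] := roofP p.
have [g hg] := cone_out_ext (kJ _ (cone_acyclic qs) (cm_comp (cm_shift 1 f) (cone_out s))).
exists g; apply: (epiQ qs).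
by rewrite -hcompA QKi hcomp1r -Q_comp; apply: Q_homotopic.
Qed.

Lemma kinj_homotopic J X (f : chmap X J) : kinj J ->
  Q f = hzero X J -> homotopic f (cm_zero X J).
Proof.
move=> kJ /Q_inj[W [s [qs h]]].
have [|e he] := @cone_ext _ _ _ _ s f.
  by apply: homotopic_trans h _; apply: homotopic_eq.
have := homotopic_compr (cone_in s) (kJ _ (cone_acyclic qs) e).
apply: homotopic_trans; apply: homotopic_eq => i x /=.
by rewrite -he.
Qed.

Lemma kproj_section P W (s : chmap W P) : kproj P -> quasi_iso s ->
  exists t, homotopic (cm_id P) (cm_comp s t).
Proof.
move=> kP qs; apply: cone_lift.
exact: (kP _ (cone_acyclic qs) (cm_comp (cone_in s) (cm_id P))).
Qed.

Lemma kproj_Q P Y (p : Hom P Y) : kproj P -> exists f : chmap P Y, p = Q f.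
Proof.
move=> kP; have [W [s [qs [f ->]]]] := roofP p.
have [t ht] := kproj_section kP qs; exists (cm_comp f t).
rewrite Q_comp; congr (_ ** _); apply: (monoQ qs).
by rewrite QiK -Q_comp -(Q_homotopic ht).
Qed.

Lemma bounded_range X : bounded X ->
  exists N : nat, forall i, (i < - N%:Z) || (N%:Z < i) -> forall x : X i, x = 0.
Proof.
move=> [N hN]; exists N => i hi; apply: hN.
by move: hi; lia.
Qed.

End Resolutions.

(** * Null-homotopies built degree by degree *)

Section BoundedResolutions.
Variable R : nzRingType.
Implicit Types X Y W A : cplx R.

Definition projective_module (P : lmodType R) :=
  forall (A B : lmodType R) (u : {linear A -> B}) (g : {linear P -> B}),
    (forall x, exists a, u a = g x) ->
    exists w : {linear P -> A}, forall x, u (w x) = g x.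

Definition hty_at X Y (f : chmap X Y) (h : forall i j, {linear X i -> Y j}) i :=
  forall j k, j + 1 = i -> i + 1 = k -> forall x,
    f i x = dif Y j i (h i j x) + h k i (dif X i k x).

Lemma hty_at_null X Y (f : chmap X Y) h :
  (forall i, hty_at f h i) -> homotopic f (cm_zero X Y).
Proof.
move=> H; apply/homotopicP; exists h => i j k ej ek x.
by rewrite -(H i j k ej ek) /= subr0.
Qed.

Section Correct.
Variables (X Y : cplx R) (h : forall i j, {linear X i -> Y j}) (a b : int).
Variable w : {linear X a -> Y b}.
(** Alters the single component from degree a to degree b, which permits an induction over
    degrees. *)
Definition hcorrect i j : {linear X i -> Y j} :=
  (h i j \+ (transport Y b j \o (w \o transport X i a))).

Lemma hcorrect_neq i j x : i != a -> hcorrect i j x = h i j x.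
Proof. by move=> ne; rewrite /= (transport_neq _ ne) !raddf0 addr0. Qed.
Lemma hcorrect_neqr i j x : j != b -> hcorrect i j x = h i j x.
Proof.
by move=> ne; rewrite /= [transport Y _ _ _]transport_neq ?addr0 // eq_sym.
Qed.
Lemma hcorrect_eq x : hcorrect a b x = h a b x + w x.
Proof. by rewrite /= !transport_id. Qed.
End Correct.

(** The homotopy is built upwards, starting below the support of Y. In each new degree the defect
    kills the boundaries, which are all the cocycles of A, so it extends along the differential by
    injectivity. *)
Lemma bounded_kinj Y : bounded Y -> (forall i, injective_module (Y i)) ->
  kinj Y.
Proof.
move=> /bounded_range[N Y0] injY A acA f.
suff [h H] : exists h, forall i, i <= N%:Z -> hty_at f h i.
  apply: (hty_at_null (h := h)) => i; have [le|lt] := leP i N%:Z; first exact: H.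
  move=> j k _ _ x; have Z := Y0 i; rewrite lt orbT in Z.
  by rewrite [LHS]Z // [RHS]Z.
suff S (n : nat) : exists h, forall i, i < n%:Z - N%:Z -> hty_at f h i.
  have [h H] := S (N + N).+1; exists h => i le; apply: H.
  by move: le; clear; lia.
elim: n => [|n [h H]].
  exists (fun _ _ => \0) => i lt j k _ _ x; have Z := Y0 i.
  have {}Z : forall x : Y i, x = 0 by apply: Z; move: lt; clear; lia.
  by rewrite [LHS]Z // [RHS]Z.
pose i0 : int := n%:Z - N%:Z; pose i1 : int := i0 + 1; pose i' : int := i0 - 1.
have e' : i' + 1 = i0 by rewrite subrK.
(* The defect of the homotopy identity in degree [i0] for the components found so far. *)
pose v : {linear A i0 -> Y i0} :=
  f i0 \- ((dif Y i' i0 \o h i0 i') \+ (h i1 i0 \o dif A i0 i1)).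
have [x hx|w hw] := @injective_module_ext _ _ _ _ (dif A i0 i1) v (injY i0).
  have [y ey] : exists y, x = dif A i' i0 y.
    exact: (coboundary_succ e' (acA _ _ (cocycle_succ (erefl i1) hx))).
  have Hi' : i' < n%:Z - N%:Z by rewrite /i' /i0; clear; lia.
  have E := H i' Hi' (i' - 1) i0 (subrK _ _) e' y.
  rewrite /v /= hx raddf0 addr0 ey cm_dif E raddfD /= dif_dif add0r.
  exact: subrr.
exists (hcorrect h w) => i lt j k ej ek x.
have [ei|ne] := eqVneq i i0.
  have ek' : k = i1 by rewrite -ek ei.
  have ej' : j = i' by rewrite /i' -ei -ej addrK.
  clear ej ek lt; subst i k j; rewrite hcorrect_eq hw hcorrect_neqr.
    by rewrite /v /=; abel.
  by rewrite /i'; clear; lia.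
have lt' : i < n%:Z - N%:Z by move: ne lt; rewrite /i0; clear; lia.
rewrite (H i lt' j k ej ek) !hcorrect_neqr //.
by move: lt' ej; rewrite /i0; clear; lia.
Qed.

(** Dual to the injective case, downwards from above the support of X: the defect takes values in
    cocycles, which are boundaries, and projectivity lifts it. *)
Lemma bounded_kproj X : bounded X -> (forall i, projective_module (X i)) ->
  kproj X.
Proof.
move=> /bounded_range[N X0] projX A acA f.
suff [h H] : exists h, forall i, - N%:Z <= i -> hty_at f h i.
  apply: (hty_at_null (h := h)) => i.
  have [le|lt] := leP (- N%:Z) i; first exact: H.
  move=> j k _ _ x; have Z := X0 i; rewrite lt in Z.
  by rewrite (Z isT x) !raddf0 addr0.
suff S (n : nat) : exists h, forall i, N%:Z - n%:Z < i -> hty_at f h i.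
  have [h H] := S (N + N).+1; exists h => i le; apply: H.
  by move: le; clear; lia.
elim: n => [|n [h H]].
  exists (fun _ _ => \0) => i lt j k _ _ x; have Z := X0 i.
  have {}Z : forall x : X i, x = 0 by apply: Z; move: lt; clear; lia.
  by rewrite (Z x) !raddf0 addr0.
pose i0 : int := N%:Z - n%:Z; pose i1 : int := i0 + 1; pose i' : int := i0 - 1.
have e' : i' + 1 = i0 by rewrite subrK.
pose v : {linear X i0 -> A i0} := f i0 \- (h i1 i0 \o dif X i0 i1).
have [x|w hw] := @projX i0 _ _ (dif A i' i0) v.
  suff /acA/(coboundary_succ e')[y ey] : cocycle (v x) by exists y.
  apply: (cocycle_succ (erefl i1)).
  have Hi' : N%:Z - n%:Z < i1 by rewrite /i1 /i0; clear; lia.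
  have E := H i1 Hi' i0 (i1 + 1) erefl erefl (dif X i0 i1 x).
  rewrite /v raddfB /= -cm_dif E dif_dif raddf0 addr0.
  exact: subrr.
(* The lift [w] is the whole new component, whereas [hcorrect] adds to the old one. *)
pose w' : {linear X i0 -> A i'} := w \- h i0 i'.
exists (hcorrect h w') => i lt j k ej ek x.
have [ei|ne] := eqVneq i i0.
  have ek' : k = i1 by rewrite -ek ei.
  have ej' : j = i' by rewrite /i' -ei -ej addrK.
  clear ej ek lt; subst i k j; rewrite hcorrect_eq (@hcorrect_neq _ _ _ _ _ _ i1).
    by rewrite raddfD raddfB /= hw /v /=; abel.
  by rewrite /i1; clear; lia.
have lt' : N%:Z - n%:Z < i by move: ne lt; rewrite /i0; clear; lia.
rewrite (H i lt' j k ej ek) !hcorrect_neq //.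
by move: lt' ek; rewrite /i0; clear; lia.
Qed.
End BoundedResolutions.

(** * Truncations and direct sums *)

Section Truncation.
Variable R : nzRingType.
Implicit Types X Y W : cplx R.

(* The canonical truncation in degrees at most [n]. *)
Section Tau.
Variables (n : int) (X : cplx R).

Definition tau_mem i (x : X i) := (n < i -> x = 0) /\ (i = n -> cocycle x).
Lemma tau_0 i : tau_mem (0 : X i).
Proof. by split=> // _ j; rewrite raddf0. Qed.
Lemma tau_lin i a (x y : X i) : tau_mem x -> tau_mem y -> tau_mem (a *: x + y).
Proof.
move=> [x1 x2] [y1 y2]; split=> [lt|e j]; first by rewrite x1 // y1 // scaler0 addr0.
by rewrite linearP /= x2 // y2 // scaler0 addr0.
Qed.
Definition tau_sub i := Submodule (@tau_0 i) (@tau_lin i).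

Lemma tau_closed i j (x : subm (tau_sub i)) : tau_sub j (dif X i j (sm_val x)).
Proof.
case: x => x [x1 x2] /=; split=> [lt|_ k]; last exact: dif_dif.
have [ej|ne] := eqVneq j (i + 1); last exact: dif_shape.
have [e|ne] := eqVneq i n; first exact: x2.
by rewrite x1 ?raddf0 //; move: lt ne; rewrite ej; clear; lia.
Qed.

Definition tau_dif i j : {linear subm (tau_sub i) -> subm (tau_sub j)} :=
  sm_corestr (f := dif X i j \o sm_incl (tau_sub i)) (@tau_closed i j).

Lemma tau_shape i j : j != i + 1 -> forall x, tau_dif i j x = 0.
Proof. by move=> ne x; apply: subm_inj; apply: dif_shape. Qed.
Lemma tau_dif_dif i j k x : tau_dif j k (tau_dif i j x) = 0.
Proof. by apply: subm_inj; apply: dif_dif. Qed.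
Definition tau : cplx R := Cplx tau_shape tau_dif_dif.

Lemma tau_incl_dif i j x : sm_incl (tau_sub j) (dif tau i j x) =
  dif X i j (sm_incl (tau_sub i) x).
Proof. by []. Qed.
Definition tau_incl : chmap tau X := Chmap tau_incl_dif.

Lemma tau_coboundary i (x : tau i) : i <= n ->
  coboundary (tau_incl i x) -> coboundary x.
Proof.
move=> le /coboundaryP[y ey].
have hy : tau_sub (i - 1) y.
  by split=> [lt|e]; move: le; [move: lt | rewrite -e]; clear; lia.
by exists (i - 1), (Subm hy); apply: subm_inj.
Qed.

Lemma tau_quasi_iso : (forall i (x : X i), n < i -> cocycle x -> coboundary x) ->
  quasi_iso tau_incl.
Proof.
move=> H; split=> [i x cx bx|i y cy].
  have [le|lt] := leP i n; first exact: tau_coboundary.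
  have -> : x = 0 by apply: subm_inj; apply: (sm_valP x).1.
  exact: coboundary0.
have [le|lt] := leP i n.
  have hy : tau_sub i y by split=> // lt; rewrite ltNge le in lt.
  exists (Subm hy : tau i); last by rewrite /= subrr; apply: coboundary0.
  by move=> j; apply: subm_inj; apply: cy.
exists 0; first by move=> j; rewrite raddf0.
by rewrite !raddf0 addr0; apply: H.
Qed.

Lemma tau_acyclic : (forall i (x : X i), i <= n -> cocycle x -> coboundary x) ->
  acyclic tau.
Proof.
move=> H i x cx; have [le|lt] := leP i n.
  by apply: tau_coboundary => //; apply: H => //; apply: cocycle_cm.
have -> : x = 0 by apply: subm_inj; apply: (sm_valP x).1.
exact: coboundary0.
Qed.
End Tau.

(** The zero endomorphism of an acyclic complex is a quasi-isomorphism, hence invertible in the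
    derived category. *)
Lemma acyclic_hom0 A Y : acyclic A -> hom0 Y A.
Proof.
move=> aA p; have qz : quasi_iso (cm_zero A A).
  split=> [i x cx _|i y cy]; first exact: aA.
  by exists 0; [move=> j; rewrite raddf0 | rewrite !raddf0 addr0; apply: aA].
apply: (hiso_mono (hiso_Q qz)).
by rewrite -/(hzero _ _) !hcomp0l.
Qed.

(** Orthogonality for the standard t-structure: on the truncated apex, which is quasi-isomorphic to
    the apex, the numerator factors through the acyclic truncation of Y. *)
Lemma trunc_hom0 n X Y :
  (forall i (x : X i), n < i -> cocycle x -> coboundary x) ->
  (forall i (y : Y i), i <= n -> cocycle y -> coboundary y) -> hom0 X Y.
Proof.
move=> HX HY p; have [W [s [qs [f ->]]]] := roofP p.
have HW i (w : W i) : n < i -> cocycle w -> coboundary w.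
  move=> lt cw; apply: qs.1 => //; apply: HX => //; exact: cocycle_cm.
have qt := tau_quasi_iso HW.
have H i (x : tau n W i) : tau_sub n Y i (f i (tau_incl n W i x)).
  case: x => x [x1 x2]; split=> [lt|e]; first by rewrite /= x1 // raddf0.
  by apply: cocycle_cm; apply: x2.
pose g i : {linear tau n W i -> tau n Y i} :=
  sm_corestr (f := f i \o tau_incl n W i) (H i).
have gd i j x : g j (dif (tau n W) i j x) = dif (tau n Y) i j (g i x).
  by apply: subm_inj; rewrite /= cm_dif.
suff -> : Q f = hzero W Y by rewrite hcomp0l.
apply: (epiQ qt); rewrite hcomp0l -Q_comp.
transitivity (Q (cm_comp (tau_incl n Y) (Chmap gd))); first exact: Q_eq.
by rewrite Q_comp (acyclic_hom0 (tau_acyclic HY) (Q (Chmap gd))) hcomp0r.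
Qed.

End Truncation.

(** * Direct sums of modules and complexes *)

Section DirectSum.
Variables (R : nzRingType) (I : eqType) (A : I -> lmodType R).

Record dprod := Dprod { dp_val :> forall i, A i }.
Lemma dprod_ext (x y : dprod) : (forall i, x i = y i) -> x = y.
Proof.
case: x y => x [y] /= e; congr Dprod.
by apply: functional_extensionality_dep.
Qed.
HB.instance Definition _ := gen_eqMixin dprod.
HB.instance Definition _ := gen_choiceMixin dprod.
Definition dprod_zero : dprod := Dprod (fun=> 0).
Definition dprod_add (x y : dprod) : dprod := Dprod (fun i => x i + y i).
Definition dprod_opp (x : dprod) : dprod := Dprod (fun i => - x i).
Lemma dprod_addA : associative dprod_add.
Proof. by move=> x y z; apply: dprod_ext => i /=; rewrite addrA. Qed.
Lemma dprod_addC : commutative dprod_add.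
Proof. by move=> x y; apply: dprod_ext => i /=; rewrite addrC. Qed.
Lemma dprod_add0 : left_id dprod_zero dprod_add.
Proof. by move=> x; apply: dprod_ext => i /=; rewrite add0r. Qed.
Lemma dprod_addN : left_inverse dprod_zero dprod_opp dprod_add.
Proof. by move=> x; apply: dprod_ext => i /=; rewrite addNr. Qed.
HB.instance Definition _ :=
  GRing.isZmodule.Build dprod dprod_addA dprod_addC dprod_add0 dprod_addN.
Definition dprod_scale (a : R) (x : dprod) : dprod := Dprod (fun i => a *: x i).
Lemma dprod_scaleA a b v : dprod_scale a (dprod_scale b v) = dprod_scale (a * b) v.
Proof. by apply: dprod_ext => i /=; rewrite scalerA. Qed.
Lemma dprod_scale1 : left_id 1 dprod_scale.
Proof. by move=> x; apply: dprod_ext => i /=; rewrite scale1r. Qed.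
Lemma dprod_scaleDr : right_distributive dprod_scale +%R.
Proof. by move=> a x y; apply: dprod_ext => i /=; rewrite scalerDr. Qed.
Lemma dprod_scaleDl v : {morph dprod_scale^~ v : a b / a + b}.
Proof. by move=> a b; apply: dprod_ext => i /=; rewrite scalerDl. Qed.
HB.instance Definition _ := GRing.Zmodule_isLmodule.Build R dprod
  dprod_scaleA dprod_scale1 dprod_scaleDr dprod_scaleDl.

Definition supp_in (s : seq I) (x : forall i, A i) := forall i, i \notin s -> x i = 0.
Definition dsum_mem (x : dprod) := exists s, supp_in s x.
Lemma dsum_0 : dsum_mem 0. Proof. by exists [::]. Qed.
Lemma dsum_lin a x y : dsum_mem x -> dsum_mem y -> dsum_mem (a *: x + y).
Proof.
move=> [s hs] [t ht]; exists (s ++ t) => i; rewrite mem_cat negb_or => /andP[h1 h2].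
by rewrite /= hs // ht // scaler0 addr0.
Qed.
Definition dsum_sub := Submodule dsum_0 dsum_lin.
Definition dsum : lmodType R := subm dsum_sub.

End DirectSum.

Section DirectSumMaps.
Variables (R : nzRingType) (I : eqType).
Implicit Types A B : I -> lmodType R.

Definition dcast A i j : {linear A i -> A j} :=
  if i =P j is ReflectT e
  then ecast k {linear A i -> A k} e (idfun : {linear A i -> A i}) else \0.
Lemma dcast_id A i x : dcast A i i x = x.
Proof. by rewrite /dcast; case: eqP => // e; rewrite eq_axiomK. Qed.
Lemma dcast_neq A i j x : i != j -> dcast A i j x = 0.
Proof. by rewrite /dcast; case: eqP. Qed.

Definition dsv A (x : dsum A) i : A i := sm_val x i.

Lemma dsum_eq A (x y : dsum A) : (forall i, dsv x i = dsv y i) -> x = y.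
Proof. by move=> h; apply: subm_inj; apply: dprod_ext. Qed.

Lemma dsvP A a (x y : dsum A) i : dsv (a *: x + y) i = a *: dsv x i + dsv y i.
Proof. by []. Qed.
Definition mkdsum A (x : forall i, A i) (h : exists s, supp_in s x) : dsum A :=
  @Subm R (dprod A) (dsum_sub A) (Dprod x) h.

Lemma dsum_in_supp A i (x : A i) : exists s, supp_in s (fun j => dcast A i j x).
Proof.
by exists [:: i] => j; rewrite inE eq_sym => /dcast_neq ->.
Qed.
Lemma dsum_in_linear A i : linear (fun x : A i => mkdsum (dsum_in_supp x)).
Proof. by move=> a x y; apply: dsum_eq => j; rewrite dsvP /dsv /= linearP. Qed.
Definition dsum_in A i : {linear A i -> dsum A} := mklin (@dsum_in_linear A i).

Lemma dsum_supp A (x : dsum A) : exists2 s, uniq s & supp_in s (dsv x).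
Proof.
have [s hs] := sm_valP x; exists (undup s); first exact: undup_uniq.
by move=> i; rewrite mem_undup; apply: hs.
Qed.

(** Terms outside the common support are 0; this makes [dsum_out_fun] independent of the support
    that is picked. *)
Lemma supp_sum A (W : lmodType R) (f : forall i, {linear A i -> W}) x s t :
  uniq s -> uniq t -> supp_in s x -> supp_in t x ->
  \sum_(i <- s) f i (x i) = \sum_(i <- t) f i (x i).
Proof.
have H (u v : seq I) : supp_in v x ->
    \sum_(i <- u) f i (x i) = \sum_(i <- [seq i <- u | i \in v]) f i (x i).
  move=> hv; rewrite big_filter [RHS]big_mkcond; apply: eq_bigr => i _.
  by case: ifPn => // /hv ->; rewrite raddf0.
move=> us ut hs ht; rewrite (H s t) // (H t s) //; apply: perm_big.
apply: uniq_perm; rewrite ?filter_uniq // => i.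
by rewrite !mem_filter andbC.
Qed.

Definition dsum_out_fun A (W : lmodType R) (f : forall i, {linear A i -> W})
  (x : dsum A) : W := \sum_(i <- projT1 (cid2 (dsum_supp x))) f i (dsv x i).

Lemma dsum_outE A (W : lmodType R) (f : forall i, {linear A i -> W}) x s :
  uniq s -> supp_in s (dsv x) -> dsum_out_fun f x = \sum_(i <- s) f i (dsv x i).
Proof.
by move=> us hs; rewrite /dsum_out_fun; case: cid2 => t ut ht /=; apply: supp_sum.
Qed.

Lemma dsum_out_linear A (W : lmodType R) (f : forall i, {linear A i -> W}) :
  linear (dsum_out_fun f).
Proof.
move=> a x y; have [[s us hs] [t ut ht]] := (dsum_supp x, dsum_supp y).
pose v := undup (s ++ t); have uv : uniq v by apply: undup_uniq.
have hx : supp_in v (dsv x).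
  by move=> i; rewrite mem_undup mem_cat negb_or => /andP[/hs].
have hy : supp_in v (dsv y).
  by move=> i; rewrite mem_undup mem_cat negb_or => /andP[_ /ht].
have hxy : supp_in v (dsv (a *: x + y)).
  by move=> i iv; rewrite dsvP hx // hy // scaler0 addr0.
rewrite !(dsum_outE _ uv) // scaler_sumr -big_split; apply: eq_bigr => i _.
by rewrite dsvP linearP.
Qed.
Definition dsum_out A (W : lmodType R) (f : forall i, {linear A i -> W}) :
  {linear dsum A -> W} := mklin (@dsum_out_linear A W f).

Lemma dsum_out_in A (W : lmodType R) (f : forall i, {linear A i -> W}) i x :
  dsum_out f (dsum_in A i x) = f i x.
Proof.
rewrite /= (@dsum_outE _ _ _ _ [:: i]) //; last first.
  by move=> j; rewrite inE eq_sym => /dcast_neq; apply.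
by rewrite big_seq1 /dsv /= dcast_id.
Qed.

Lemma dsum_decomp A (x : dsum A) s : uniq s -> supp_in s (dsv x) ->
  x = \sum_(i <- s) dsum_in A i (dsv x i).
Proof.
move=> us hs; apply: dsum_eq => j.
have -> : dsv (\sum_(i <- s) dsum_in A i (dsv x i)) j =
    \sum_(i <- s) dcast A i j (dsv x i).
  by elim/big_rec2: _ => // i y z _ <-.
have [js|/[dup] jn /hs ->] := boolP (j \in s).
  rewrite (bigD1_seq j) //= dcast_id big1 ?addr0 // => i ne.
  exact: dcast_neq.
rewrite big1_seq // => i /= i_s; rewrite dcast_neq //.
by apply: contraNneq jn => <-.
Qed.

Lemma dsum_out_ext A (W : lmodType R) (f g : {linear dsum A -> W}) :
  (forall i x, f (dsum_in A i x) = g (dsum_in A i x)) -> f =1 g.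
Proof.
move=> h x; have [s us hs] := dsum_supp x.
by rewrite (dsum_decomp us hs) !raddf_sum; apply: eq_bigr => i _; exact: h.
Qed.

Lemma dsum_map_supp A B (g : forall i, {linear A i -> B i}) (x : dsum A) :
  exists s, supp_in s (fun i => g i (dsv x i)).
Proof.
by have [s _ hs] := dsum_supp x; exists s => i /hs ->; rewrite raddf0.
Qed.
Lemma dsum_map_linear A B (g : forall i, {linear A i -> B i}) :
  linear (fun x => mkdsum (dsum_map_supp g x)).
Proof. by move=> a x y; apply: dsum_eq => j; rewrite dsvP /dsv /= linearP. Qed.
Definition dsum_map A B (g : forall i, {linear A i -> B i}) :
  {linear dsum A -> dsum B} :=
  mklin (@dsum_map_linear A B g).
Lemma dsum_mapE A B (g : forall i, {linear A i -> B i}) x i :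
  dsv (dsum_map g x) i = g i (dsv x i).
Proof. by []. Qed.
End DirectSumMaps.

Section DirectSumComplex.
Variables (R : nzRingType) (I : eqType).
Implicit Types X V : I -> cplx R.

Definition ds_dif X a b := dsum_map (fun i => dif (X i) a b).
Lemma ds_shape X a b : b != a + 1 -> forall x, ds_dif X a b x = 0.
Proof. by move=> ne x; apply: dsum_eq => i; rewrite dsum_mapE dif_shape. Qed.
Lemma ds_dif_dif X a b c x : ds_dif X b c (ds_dif X a b x) = 0.
Proof. by apply: dsum_eq => i; rewrite !dsum_mapE dif_dif. Qed.
Definition ds X : cplx R := Cplx (@ds_shape X) (@ds_dif_dif X).

Lemma ds_in_dif X i a b x :
  dsum_in (fun i => X i b) i (dif (X i) a b x) =
  dif (ds X) a b (dsum_in (fun i => X i a) i x).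
Proof.
apply: dsum_eq => j; rewrite dsum_mapE /dsv /=.
have [e|ne] := eqVneq i j; first by subst j; rewrite !dcast_id.
by rewrite !dcast_neq // raddf0.
Qed.
Definition ds_in X i : chmap (X i) (ds X) :=
  @Chmap _ (X i) (ds X) (fun a => dsum_in (fun i => X i a) i) (@ds_in_dif X i).

Lemma ds_out_dif X W (f : forall i, chmap (X i) W) a b x :
  dsum_out (fun i => f i b) (dif (ds X) a b x) =
  dif W a b (dsum_out (fun i => f i a) x).
Proof.
pose l : {linear ds X a -> W b} := dsum_out (fun i => f i b) \o dif (ds X) a b.
pose r : {linear ds X a -> W b} := dif W a b \o dsum_out (fun i => f i a).
apply: (@dsum_out_ext _ _ _ _ l r) => i y.
transitivity (dsum_out (fun i => f i b) (ds_in X i b (dif (X i) a b y))).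
  by rewrite cm_dif.
transitivity (dif W a b (f i a y)); last by rewrite -(dsum_out_in (fun i => f i a)).
by rewrite -cm_dif -(dsum_out_in (fun i => f i b)).
Qed.
Definition ds_out X W (f : forall i, chmap (X i) W) : chmap (ds X) W := Chmap (@ds_out_dif X W f).

Lemma ds_out_in X W (f : forall i, chmap (X i) W) i a x :
  ds_out f a (ds_in X i a x) = f i a x.
Proof. exact: dsum_out_in. Qed.

Lemma ds_map_dif X V (f : forall i, chmap (X i) (V i)) a b x :
  dsum_map (fun i => f i b) (dif (ds X) a b x) =
  dif (ds V) a b (dsum_map (fun i => f i a) x).
Proof. by apply: dsum_eq => i; rewrite !dsum_mapE cm_dif. Qed.
Definition ds_map X V (f : forall i, chmap (X i) (V i)) : chmap (ds X) (ds V) :=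
  @Chmap _ (ds X) (ds V) (fun a => dsum_map (fun i => f i a)) (@ds_map_dif X V f).

Lemma ds_map_in X V (f : forall i, chmap (X i) (V i)) i a x :
  ds_map f a (ds_in X i a x) = ds_in V i a (f i a x).
Proof.
apply: dsum_eq => j; rewrite dsum_mapE /dsv /=.
have [e|ne] := eqVneq i j; first by subst j; rewrite !dcast_id.
by rewrite !dcast_neq // raddf0.
Qed.

Lemma ds_cocycle X a (x : ds X a) i : cocycle x -> cocycle (dsv x i).
Proof. by move=> c b; have := congr1 (fun z => dsv z i) (c b). Qed.

(** Componentwise choices form an element of the direct sum because 0 is taken wherever x is 0. *)
Lemma dsum_choice (A B : I -> lmodType R) (P : forall i, A i -> B i -> Prop)
    (x : dsum A) :
  (forall i, P i (dsv x i) 0 \/ dsv x i <> 0 /\ exists y, P i (dsv x i) y) ->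
  exists y : dsum B, forall i, P i (dsv x i) (dsv y i).
Proof.
move=> h; have H i : exists y, P i (dsv x i) y /\ (dsv x i = 0 -> y = 0).
  by case: (h i) => [p|[ne [y py]]]; [exists 0 | exists y].
have [s _ hs] := dsum_supp x.
have hy : exists s, supp_in s (fun i => projT1 (cid (H i))).
  by exists s => i /hs; case: cid => y /= [_ hy] /hy.
by exists (mkdsum hy) => i; rewrite {2}/dsv /=; case: cid => y [].
Qed.

Lemma ds_coboundary X a (x : ds X a) :
  (forall i, coboundary (dsv x i)) -> coboundary x.
Proof.
move=> h.
have [i|y hy] := @dsum_choice _ (fun i => X i (a - 1))
    (fun i u v => u = dif (X i) (a - 1) a v) x.
  have [->|ne] := pselect (dsv x i = 0); first by left; rewrite raddf0.
  by right; split=> //; apply/coboundaryP.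
by exists (a - 1), y; apply: dsum_eq => i; rewrite hy.
Qed.

Lemma ds_cocycleP X a (x : ds X a) :
  (forall i, cocycle (dsv x i)) -> cocycle x.
Proof. by move=> h b; apply: dsum_eq => i; rewrite dsum_mapE h. Qed.

Lemma ds_map_quasi_iso X V (f : forall i, chmap (X i) (V i)) :
  (forall i, quasi_iso (f i)) -> quasi_iso (ds_map f).
Proof.
move=> q; split=> [a x cx /coboundaryP[y ey]|a y cy].
  apply: ds_coboundary => i; apply: (q i).1; first exact: ds_cocycle.
  by exists (a - 1), (dsv y i); have := congr1 (fun z => dsv z i) ey.
have [i|x hx] := @dsum_choice _ (fun i => X i a)
    (fun i u v => cocycle v /\ coboundary (u - f i a v)) y.
  have [->|ne] := pselect (dsv y i = 0).
    by left; split; [move=> j; rewrite raddf0 | rewrite !raddf0 addr0; apply: coboundary0].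
  right; split=> //; have [x cx bx] := (q i).2 a _ (ds_cocycle i cy).
  by exists x.
exists x; first by apply: ds_cocycleP => i; have [] := hx i.
by apply: ds_coboundary => i; have [_] := hx i.
Qed.

Lemma ds_homotopic X W (f g : chmap (ds X) W) :
  (forall i, homotopic (cm_comp f (ds_in X i)) (cm_comp g (ds_in X i))) ->
  homotopic f g.
Proof.
move=> H; have {}H i := cid (iffLR (homotopicP _ _) (H i)).
apply/homotopicP; exists (fun a b => dsum_out (fun i => projT1 (H i) a b)).
move=> a b c eb ec.
pose l : {linear ds X a -> W a} := f a \- g a.
pose r : {linear ds X a -> W a} :=
  (dif W b a \o dsum_out (fun i => projT1 (H i) a b)) \+
  (dsum_out (fun i => projT1 (H i) c a) \o dif (ds X) a c).
apply: (@dsum_out_ext _ _ _ _ l r) => i x.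
apply: (etrans (projT2 (H i) a b c eb ec x)).
rewrite -(dsum_out_in (fun i => projT1 (H i) a b)).
rewrite -(dsum_out_in (fun i => projT1 (H i) c a)).
by rewrite ds_in_dif.
Qed.

(** Direct sums of quasi-isomorphisms are quasi-isomorphisms and homotopies on the summands add up,
    so families of roofs assemble to a roof and the coproduct of complexes stays one in the derived
    category. *)
Lemma ds_coprod X : hcoprod (fun i => Q (ds_in X i)).
Proof.
split=> [Y f|Y g g' h].
  have H i : exists p : {V : cplx R & (chmap V (X i) * chmap V Y)%type},
      exists qs : quasi_iso (tagged p).1, f i = Q (tagged p).2 ** Qi qs.
    have [V [s [qs [k e]]]] := roofP (f i).
    by exists (existT _ V (s, k)), qs.
  pose V i := tag (projT1 (cid (H i))).
  pose s i : chmap (V i) (X i) := (tagged (projT1 (cid (H i)))).1.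
  pose k i : chmap (V i) Y := (tagged (projT1 (cid (H i)))).2.
  have qs i : quasi_iso (s i) by rewrite /s; case: (projT2 (cid (H i))).
  have fE i : f i = Q (k i) ** Qi (qs i).
    have [q e] := projT2 (cid (H i)); apply: (etrans e); congr (_ ** _).
    by apply: cl_homotopic => //; apply: homotopic_refl.
  exists (Q (ds_out k) ** Qi (ds_map_quasi_iso qs)) => i.
  apply: (epiQ (qs i)); rewrite fE -!hcompA QKi hcomp1r -Q_comp.
  rewrite -(Q_eq (f := cm_comp (ds_map s) (ds_in V i))); last exact: ds_map_in.
  rewrite Q_comp (hcompA (Qi _)) QKi hcomp1l -Q_comp.
  by apply: Q_eq; apply: ds_out_in.
apply: hsub_eq0; have {h} : forall i, (g +! hopp g') ** Q (ds_in X i) = hzero _ _.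
  by move=> i; rewrite hadd_compl hoppl h haddNr.
move: (g +! hopp g') => {g'}{}g h.
have [W [s [qs [k eg]]]] := roofP g; rewrite eg in h *.
(* On each summand a refinement makes the numerator null-homotopic; apex and legs are bundled so
   that choice picks them for all i at once. *)
have H i : exists p : {V : cplx R & (chmap V (X i) * chmap V W)%type},
    [/\ quasi_iso (tagged p).1,
      homotopic (cm_comp (ds_in X i) (tagged p).1) (cm_comp s (tagged p).2) &
      homotopic (cm_comp k (tagged p).2) (cm_zero _ _)].
  have [V [t [l [qt sq]]]] := ore (Roof k qs) (dlift (ds_in X i)).
  move: t l qt sq => /= t l qt sq.
  have /Q_inj[V' [r [qr e]]] : Q (cm_comp k l) = Q (cm_zero V Y).
    rewrite Q_comp; apply: etrans (hcomp0l _ (Q t)); rewrite -(h i) -!hcompA.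
    rewrite -(Q_comp (ds_in X i) t) (Q_homotopic sq) Q_comp (hcompA (Qi qs)).
    by rewrite QKi hcomp1l.
  exists (existT _ V' (cm_comp t r, cm_comp l r)); split.
  - exact: quasi_iso_comp.
  - exact: (homotopic_compr r sq).
  - by apply: homotopic_trans e _; apply: homotopic_eq.
pose V i := tag (projT1 (cid (H i))).
pose t i : chmap (V i) (X i) := (tagged (projT1 (cid (H i)))).1.
pose l i : chmap (V i) W := (tagged (projT1 (cid (H i)))).2.
have qt i : quasi_iso (t i) by rewrite /t; case: (projT2 (cid (H i))).
have e1 i : homotopic (cm_comp (ds_in X i) (t i)) (cm_comp s (l i)).
  by rewrite /t /l; case: (projT2 (cid (H i))).
have e2 i : homotopic (cm_comp k (l i)) (cm_zero _ _).
  by rewrite /l; case: (projT2 (cid (H i))).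
apply: (epiQ (ds_map_quasi_iso qt)); rewrite hcomp0l.
have -> : Q (ds_map t) = Q s ** Q (ds_out l).
  rewrite -Q_comp; apply: Q_homotopic; apply: ds_homotopic => i.
  apply: homotopic_trans (homotopic_trans (e1 i) _); apply: homotopic_eq.
    exact: ds_map_in.
  by move=> a x; apply: esym; apply: (congr1 (s a)); apply: ds_out_in.
rewrite -hcompA (hcompA (Qi qs)) QKi hcomp1l -Q_comp; apply: Q_homotopic.
apply: ds_homotopic => i; apply: homotopic_trans (homotopic_trans (e2 i) _).
  by apply: homotopic_eq => a x; apply: (congr1 (k a)); apply: ds_out_in.
by apply: homotopic_eq.
Qed.
End DirectSumComplex.

(** * Generation by one module *)

Section Cells.
Variable R : nzRingType.
Implicit Types (X Y : cplx R) (M N : lmodType R).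

Lemma rV0_eq0 (x : 'rV[R]_0) : x = 0.
Proof. by apply/rowP => -[]. Qed.

Section Guard.
Variables (M : lmodType R).
(** The terms of a stalk complex are conditional types; this map and [guard_out] confine the case
    split. *)
Definition guard_in (b : bool) : {linear (if b then M else 'rV[R]_0) -> M} :=
  if b as b' return {linear (if b' then M else 'rV[R]_0) -> M}
  then (idfun : {linear M -> M}) else \0.
Definition guard_out (b : bool) : {linear M -> (if b then M else 'rV[R]_0)} :=
  if b as b' return {linear M -> (if b' then M else 'rV[R]_0)}
  then (idfun : {linear M -> M}) else \0.
Lemma guard_inK b : cancel (guard_in b) (guard_out b).
Proof. by case: b => //= x; rewrite (rV0_eq0 x). Qed.
Lemma guard_outK b x : guard_in b (guard_out b x) = if b then x else 0.
Proof. by case: b. Qed.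
End Guard.

(** M placed in cohomological degree n. *)
Definition cell n M := shift (- n) (stalk M).

Lemma cell_dif n M i j x : dif (cell n M) i j x = 0.
Proof. by rewrite /= /shift_dif; case: ifP => _ /=; rewrite ?oppr0. Qed.

Definition cell_val n M i : {linear cell n M i -> M} := guard_in M (i - n == 0).
Definition cell_mk n M i : {linear M -> cell n M i} := guard_out M (i - n == 0).

Lemma cell_valK n M i : cancel (@cell_val n M i) (@cell_mk n M i).
Proof. exact: guard_inK. Qed.
Lemma cell_mkK n M x : @cell_val n M n (@cell_mk n M n x) = x.
Proof. by rewrite /cell_val /cell_mk guard_outK subrr eqxx. Qed.
Lemma cell_neq n M i (x : cell n M i) : i != n -> x = 0.
Proof.
move=> ne; rewrite -[x]cell_valK; suff -> : cell_val n M i x = 0 by rewrite raddf0.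
rewrite -[x]cell_valK /cell_val /cell_mk guard_outK ifN //.
by rewrite subr_eq0.
Qed.

Section CellOut.
Variables (n : int) (M : lmodType R) (X : cplx R) (f : {linear M -> X n}).
Hypothesis cf : forall x, cocycle (f x).
Lemma cell_out_dif i j x :
  (transport X n j \o f \o @cell_val n M j) (dif (cell n M) i j x) =
  dif X i j ((transport X n i \o f \o @cell_val n M i) x).
Proof.
rewrite cell_dif raddf0 /=; have [e|ne] := eqVneq n i.
  by subst i; rewrite transport_id cf.
by rewrite transport_neq ?raddf0.
Qed.
Definition cell_out : chmap (cell n M) X :=
  @Chmap _ (cell n M) X
    (fun i => (transport X n i \o f) \o @cell_val n M i) cell_out_dif.
Lemma cell_outE x : cell_out n x = f (cell_val n M n x).
Proof. by rewrite /= transport_id. Qed.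
Lemma cell_out_mk x : cell_out n (@cell_mk n M n x) = f x.
Proof. by rewrite cell_outE cell_mkK. Qed.
End CellOut.

Section CellIn.
Variables (n : int) (M : lmodType R) (X : cplx R) (f : {linear X n -> M}).
Hypothesis cf : forall i x, f (dif X i n x) = 0.
Lemma cell_in_dif i j x :
  (@cell_mk n M j \o (f \o transport X j n)) (dif X i j x) =
  dif (cell n M) i j ((@cell_mk n M i \o (f \o transport X i n)) x).
Proof.
rewrite cell_dif /=; have [e|ne] := eqVneq j n.
  by subst j; rewrite transport_id cf raddf0.
by rewrite transport_neq ?raddf0.
Qed.
Definition cell_in : chmap X (cell n M) :=
  @Chmap _ X (cell n M)
    (fun i => @cell_mk n M i \o (f \o transport X i n)) cell_in_dif.
Lemma cell_inE x : cell_in n x = @cell_mk n M n (f x).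
Proof. by rewrite /= transport_id. Qed.
End CellIn.

Lemma regular_projective : projective_module (R^o : lmodType R).
Proof.
move=> A B u g h; have [a ea] := h 1.
have wl : linear (fun x : R^o => (x : R) *: a).
  by move=> l x y; rewrite scalerDl scalerA.
exists (mklin wl) => x; rewrite /= linearZ /= ea -linearZ /=.
by congr (g _); exact: mulr1.
Qed.

Lemma cell_bounded n M : bounded (cell n M).
Proof.
exists `|n|%N => i lt x; apply: cell_neq; apply: contraTneq lt => ->.
by rewrite ltnn.
Qed.

Lemma rV0_projective : projective_module ('rV[R]_0).
Proof.
move=> A B u g _; exists \0 => x.
by rewrite (rV0_eq0 x) !raddf0.
Qed.

Lemma cell_kproj n M : projective_module M -> kproj (cell n M).
Proof.
move=> pM; apply: bounded_kproj; first exact: cell_bounded.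
by move=> i; rewrite /= /stalk_obj; case: ifP => _ //; apply: rV0_projective.
Qed.

(* A map out of a free cell into a direct sum is determined by the image of 1,
   which has finite support. *)
Lemma cell_fin_supp n (Y : nat -> cplx R) :
  fin_supp (fun i => Q (ds_in Y i)) (cell n (R^o : lmodType R)).
Proof.
move=> x; have [f ->] := kproj_Q x (cell_kproj (n := n) regular_projective).
pose z : ds Y n := f n (@cell_mk n R^o n 1).
have [s _ hs] := dsum_supp z.
pose N := (\max_(i <- s) i.+1)%N.
have zN i : (N <= i)%N -> dsv z i = 0.
  move=> le; apply: hs; apply: contraL le => i_s; rewrite -ltnNge.
  by rewrite /N (big_rem i i_s) leq_max leqnn.
exists N => e he.
(* A chain-level model of the truncation idempotent, which represents [e] by uniqueness. *)
pose T a i : {linear Y i a -> Y i a} :=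
  if (i < N)%N then (idfun : {linear Y i a -> Y i a})
  else (\0 : {linear Y i a -> Y i a}).
have Td i a b y : T b i (dif (Y i) a b y) = dif (Y i) a b (T a i y).
  by rewrite /T; case: ifP => //= _; rewrite raddf0.
pose t := ds_map (fun i => Chmap (Td i)).
have -> : e = Q t.
  apply: (trunc_uniq (ds_coprod Y) he) => i.
  rewrite -Q_comp.
  rewrite (Q_eq (g := cm_comp (ds_in Y i) (Chmap (Td i)))); last exact: ds_map_in.
  case: ifP => lt.
    by apply: Q_eq => a y; rewrite /= /T lt.
  apply: Q_eq => a y; apply: dsum_eq => j; rewrite /dsv /= /T lt.
  by rewrite raddf0.
rewrite -Q_comp; apply: Q_eq => a y.
have [ea|ne] := eqVneq a n; last by rewrite (cell_neq y ne) !raddf0.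
subst a; rewrite -[y](cell_valK (i := n)).
have -> : cell_val n R^o n y = (cell_val n R^o n y : R) *: (1 : R^o).
  exact: (esym (mulr1 _)).
rewrite !linearZ /=; congr (_ *: _); apply: dsum_eq => i.
rewrite dsum_mapE -/z /= /T; case: ifP => // /negbT; rewrite -leqNgt => /zN.
by move->.
Qed.

End Cells.

(** * Brutal truncation, finite sums and countable smallness *)

Section Generation.
Variable R : nzRingType.
Implicit Types (X Y : cplx R) (M N : lmodType R).

Section Brutal.
Variables (n : int) (X : cplx R).
Definition sig_mem i (x : X i) := i < n -> x = 0.
Lemma sig_0 i : sig_mem (0 : X i). Proof. by []. Qed.
Lemma sig_lin i a (x y : X i) : sig_mem x -> sig_mem y -> sig_mem (a *: x + y).
Proof. by move=> hx hy lt; rewrite hx // hy // scaler0 addr0. Qed.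
Definition sig_sub i := Submodule (@sig_0 i) (@sig_lin i).
Lemma sig_closed i j (x : subm (sig_sub i)) : sig_sub j (dif X i j (sm_val x)).
Proof.
move=> lt; have [ej|ne] := eqVneq j (i + 1); last exact: dif_shape.
by rewrite (sm_valP x) ?raddf0 //; move: lt; rewrite ej; clear; lia.
Qed.
Definition sig_dif i j : {linear subm (sig_sub i) -> subm (sig_sub j)} :=
  sm_corestr (f := dif X i j \o sm_incl (sig_sub i)) (@sig_closed i j).
Lemma sig_shape i j : j != i + 1 -> forall x, sig_dif i j x = 0.
Proof. by move=> ne x; apply: subm_inj; apply: dif_shape. Qed.
Lemma sig_dif_dif i j k x : sig_dif j k (sig_dif i j x) = 0.
Proof. by apply: subm_inj; apply: dif_dif. Qed.
Definition sig : cplx R := Cplx sig_shape sig_dif_dif.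
Lemma sig_incl_dif i j x : sm_incl (sig_sub j) (dif sig i j x) =
  dif X i j (sm_incl (sig_sub i) x).
Proof. by []. Qed.
Definition sig_incl : chmap sig X := Chmap sig_incl_dif.
End Brutal.

Section BrutalStep.
Variables (n : int) (X : cplx R).

Lemma sig_step_mem i (x : sig (n + 1) X i) : sig_sub n X i (sm_val x).
Proof. by move=> lt; apply: (sm_valP x); move: lt; clear; lia. Qed.
Definition sig_step_fun i : {linear sig (n + 1) X i -> sig n X i} :=
  sm_corestr (f := sm_incl (sig_sub (n + 1) X i)) (@sig_step_mem i).
Lemma sig_step_dif i j x : sig_step_fun j (dif (sig (n + 1) X) i j x) =
  dif (sig n X) i j (sig_step_fun i x).
Proof. exact: subm_inj. Qed.
Definition sig_step : chmap (sig (n + 1) X) (sig n X) := Chmap sig_step_dif.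

Lemma sig_top_linear : linear (fun p : cone sig_step n => sm_val p.2).
Proof. by []. Qed.
Definition sig_top_fun : {linear cone sig_step n -> X n} := mklin sig_top_linear.
Lemma sig_top_dif i x : sig_top_fun (dif (cone sig_step) i n x) = 0.
Proof.
have [e|ne] := eqVneq n (i + 1); last by rewrite dif_shape ?raddf0.
have lt : i < n by rewrite e; clear; lia.
have lt' : i + 1 < n + 1 by rewrite e; clear; lia.
change (sm_val (transport (sig n X) (i + 1) n (sig_step (i + 1) x.1) +
  dif (sig n X) i n x.2) = 0).
have -> : sig_step (i + 1) x.1 = 0.
  by apply: subm_inj; apply: (sm_valP x.1).
by rewrite raddf0 add0r /= (sm_valP x.2 lt) raddf0.
Qed.
Definition sig_top : chmap (cone sig_step) (cell n (X n)) := cell_in sig_top_dif.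

(** The layers of the brutal filtration are the terms of X: up to quasi-isomorphism, passing from n
    + 1 to n adds X n in degree n. *)
Lemma sig_top_quasi_iso : quasi_iso sig_top.
Proof.
split=> [i [a x] /cone_cocycle[/= ca cx]|i y _].
  move=> /coboundaryP[y]; rewrite cell_dif => e0.
  have xm : sig_sub (n + 1) X i (sm_val x).
    move=> lt; have [e|ne] := eqVneq i n; last first.
      by apply: (sm_valP x); move: lt ne; clear; lia.
    subst i; move: e0; rewrite transport_id => /(congr1 (cell_val n (X n) n)).
    by rewrite cell_mkK raddf0.
  pose p : sig (n + 1) X i := Subm xm.
  have [k ek] : exists k, k + 1 = i by exists (i - 1); rewrite subrK.
  subst i; apply/cone_coboundary; exists p, 0.
  have ep : sig_step _ p = x by apply: subm_inj.
  rewrite ep raddf0 addr0; split=> //.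
  apply: subm_inj; have /= := congr1 (@sm_val _ _ _) cx.
  by move/eqP; rewrite addr_eq0 => /eqP.
have [e|ne] := eqVneq i n; last first.
  by rewrite (cell_neq y ne); exists 0; [move=> j; rewrite raddf0 |
    rewrite !raddf0 addr0; apply: coboundary0].
subst i; pose v := cell_val n (X n) n y.
have hv : sig_sub n X n v by move=> lt; move: lt; rewrite ltxx.
pose x : sig n X n := Subm hv.
have hd : sig_sub (n + 1) X (n + 1) (- dif X n (n + 1) v).
  by move=> lt; move: lt; rewrite ltxx.
exists ((Subm hd : sig (n + 1) X (n + 1)), x).
  apply/cone_cocycle; split; apply: subm_inj => /=.
    by rewrite raddfN /= dif_dif oppr0.
  by rewrite addNr.
rewrite /sig_top cell_inE /= -/v cell_valK subrr; exact: coboundary0.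
Qed.
End BrutalStep.

Section Closed.
Variable P : cplx R -> Prop.
Hypotheses (tP : triangulated_subcat P) (sP : summand_closed P).

(** The cone of an identity lies in P and is acyclic, and all acyclic complexes are isomorphic zero
    objects. *)
Lemma closed_acyclic A : acyclic A -> P A.
Proof.
move=> aA; case: (tP) => _ [X pX] _ _.
have pC : P (cone (cm_id X)) by exact: (closed_tri tP (tri_cone (cm_id X))).
have aC := cone_acyclic (quasi_iso_id X).
apply: (closed_iso tP (f := hzero _ A)) pC.
exists (hzero _ _); rewrite !hcomp0l; split; apply: esym; exact: acyclic_hom0.
Qed.

(** Induction along the brutal filtration, from 0 above the support down to a subcomplex that is all
    of X. *)
Lemma closed_bounded X : bounded X -> (forall i, P (stalk (X i))) -> P X.
Proof.
move=> /bounded_range[N X0] pX.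
have S (k : nat) : P (sig (N%:Z + 1 - k%:Z) X).
  elim: k => [|k IH].
    apply: closed_acyclic => i x _; suff -> : x = 0 by apply: coboundary0.
    apply: subm_inj; have [lt|ge] := ltP i (N%:Z + 1 - 0%:Z).
      exact: (sm_valP x).
    by apply: X0; apply/orP; right; move: ge; clear; lia.
  have e : N%:Z + 1 - k%:Z = N%:Z + 1 - k.+1%:Z + 1 by clear; lia.
  rewrite e in IH; apply: (closed_tri_mid tP (tri_cone (sig_step _ X)) IH).
  have pc : P (cell (N%:Z + 1 - k.+1%:Z) (X (N%:Z + 1 - k.+1%:Z))).
    exact: closed_shift.
  have [t [e1 e2]] := hiso_Q (sig_top_quasi_iso (N%:Z + 1 - k.+1%:Z) X).
  apply: closed_iso pc => //; exists (Q (sig_top (N%:Z + 1 - k.+1%:Z) X)).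
  by split; eassumption.
have H i (x : X i) : sig_sub (N%:Z + 1 - (N + N + 1)%N%:Z) X i x.
  by move=> lt; apply: X0; apply/orP; left; move: lt; clear; lia.
have q : quasi_iso (sig_incl (N%:Z + 1 - (N + N + 1)%N%:Z) X).
  split=> [i x cx /coboundaryP[y ey]|i y cy].
    by exists (i - 1), (Subm (H _ y)); apply: subm_inj.
  exists (Subm (H _ y) : sig _ X i); last by rewrite /= subrr; apply: coboundary0.
  by move=> j; apply: subm_inj; apply: cy.
exact: closed_iso (hiso_Q q) (S _).
Qed.

(** The first inclusion is split, and its cone is the coproduct of the remaining summands. *)
Lemma closed_coprod n (A : 'I_n -> cplx R) S (inj : forall i, Hom (A i) S) :
  hcoprod inj -> (forall i, P (A i)) -> P S.
Proof.
elim: n A S inj => [|n IH] A S inj cS pA.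
  have e0 : h1 S = hzero S S by apply: cS.2 => -[].
  have [A0 aA0] : exists A0 : cplx R, acyclic A0.
    by exists (cone (cm_id S)); apply: cone_acyclic (quasi_iso_id S).
  apply: (closed_iso tP (f := hzero A0 S)) (closed_acyclic aA0).
  exists (hzero _ _); rewrite !hcomp0l e0; split=> //.
  by apply: esym; apply: acyclic_hom0.
have [pr [pr1 pr0]] := hcoprod_proj ord0 cS.
have [Z [g [h T]]] := tri_complete (inj ord0).
have h0 : h = hzero _ _.
  rewrite -[h]hcomp1l -hsh_1 -pr1 hsh_comp -hcompA.
  rewrite -[hsh 1 (inj _)]hoppK hoppl (tri_comp0 (tri_rot (tri_rot T))).
  by rewrite hopp0 hcomp0r.
have epi0 W (x : Hom Z W) : x ** g = hzero _ _ -> x = hzero _ _.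
  by move=> e; have [y ->] := tri_ext (tri_rot T) e; rewrite h0 hcomp0r.
apply: (closed_tri_mid tP T) => //.
apply: (IH (fun i => A (lift ord0 i)) Z (fun i => g ** inj (lift ord0 i))) => //.
split=> [W f|W x y e].
  (* The family f is extended by 0 at [ord0]; the cast reconciles the type of f j with that of a map
     on A i when i = lift ord0 j. *)
  have H i : exists k : Hom (A i) W, match unlift ord0 i with
      | None => k = hzero _ _ | Some _ => True end /\
      forall j (e : i = lift ord0 j), ecast i (Hom (A i) W) e k = f j.
    case: (unliftP ord0 i) => [j ei|ei]; last first.
      by exists (hzero _ _); split=> // j; rewrite ei.
    subst i; exists (f j); split=> // j' e.
    by have /lift_inj ej := e; subst j'; rewrite eq_axiomK.
  have [k hk] := cS.1 W (fun i => projT1 (cid (H i))).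
  have [|q eq] := tri_ext (p := k) T.
    by rewrite hk; case: cid => x /= [+ _]; rewrite unlift_none.
  exists q => i; rewrite hcompA -eq hk; case: cid => x /= [_ hx].
  by rewrite -(hx i erefl).
apply: hsub_eq0; apply: epi0; apply: cS.2 => i; rewrite hcomp0l -hcompA.
case: (unliftP ord0 i) => [j ->|->]; last by rewrite (tri_comp0 T) hcomp0r.
by rewrite hadd_compl hoppl e haddNr.
Qed.

(** Such endomorphisms are closed under sums, so an identity that is a sum of them makes Y a retract
    of an object of P. *)
Definition factors Y (e : Hom Y Y) :=
  exists A (s : Hom Y A) (p : Hom A Y), P A /\ e = p ** s.

Lemma factors_add Y (e e' : Hom Y Y) : factors e -> factors e' ->
  factors (e +! e').
Proof.
move=> [A [s [p [pA ->]]]] [A' [s' [p' [pA' ->]]]].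
pose B (i : 'I_2) := if i == ord0 then A else A'.
have cB := ds_coprod B; exists (ds B).
have [q hq] := cB.1 Y (fun i => if i == ord0 as b
  return Hom (if b then A else A') Y then p else p').
pose i0 : Hom A (ds B) := Q (ds_in B ord0).
pose i1 : Hom A' (ds B) := Q (ds_in B (lift ord0 ord0)).
exists (i0 ** s +! i1 ** s'), q; split.
  by apply: closed_coprod cB _ => i; rewrite /B; case: ifP.
rewrite hadd_compr !hcompA.
have -> : q ** i0 = p := hq ord0.
by have -> : q ** i1 = p' := hq (lift ord0 ord0).
Qed.

Lemma factors_id Y : factors (h1 Y) -> P Y.
Proof. by move=> [A [s [p [pA e]]]]; exact: (closed_retract sP (esym e) pA). Qed.

Section StalkMap.
Variables (M N : lmodType R) (f : {linear M -> N}).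
Definition stalk_map_fun i : {linear stalk M i -> stalk N i} :=
  guard_out N (i == 0) \o (f \o guard_in M (i == 0)).
Lemma stalk_map_dif i j x :
  stalk_map_fun j (dif (stalk M) i j x) = dif (stalk N) i j (stalk_map_fun i x).
Proof. by rewrite /= !raddf0. Qed.
Definition stalk_map : chmap (stalk M) (stalk N) := Chmap stalk_map_dif.
End StalkMap.

Lemma guard_comp M N (f : {linear M -> N}) b y :
  guard_out N b (f (guard_in M b (guard_out M b y))) = guard_out N b (f y).
Proof. by case: b. Qed.

Lemma stalk_map_comp M N N' (f : {linear N -> N'}) (g : {linear M -> N}) :
  Q (stalk_map f) ** Q (stalk_map g) = Q (stalk_map (f \o g)).
Proof.
by rewrite -Q_comp; apply: Q_eq => i x /=; apply: guard_comp.
Qed.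

(** Exhibits M as a direct summand of N^n, with inclusion (a k) and retraction (b k). *)
Definition dual_basis N M (n : nat) (a : 'I_n -> {linear M -> N})
  (b : 'I_n -> {linear N -> M}) := forall x, x = \sum_k b k (a k x).

Lemma closed_stalk N M n (a : 'I_n -> {linear M -> N}) b :
  dual_basis a b -> P (stalk N) -> P (stalk M).
Proof.
move=> ab pN; apply: factors_id.
suff S (e : {linear M -> M}) : (forall x, e x = \sum_k b k (a k x)) ->
    factors (Q (stalk_map e)).
  suff -> : h1 (stalk M) = Q (stalk_map (idfun : {linear M -> M})) by apply: S.
  by apply: Q_eq => i x; rewrite /= guard_inK.
elim: n a b {ab} e => [|n IH] a b e he.
  exists (stalk N), (hzero _ _), (hzero _ _); split=> //.
  rewrite hcomp0l; apply: Q_eq => i x /=.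
  by rewrite he big_ord0 raddf0.
pose e1 : {linear M -> M} := b ord0 \o a ord0.
pose e2 : {linear M -> M} := e \- e1.
have -> : Q (stalk_map e) = Q (stalk_map e1) +! Q (stalk_map e2).
  by rewrite add_Q; apply: Q_eq => i x; rewrite /= -raddfD /= addrC subrK.
apply: factors_add.
  exists (stalk N), (Q (stalk_map (a ord0))), (Q (stalk_map (b ord0))).
  by rewrite stalk_map_comp.
apply: (IH (fun k => a (lift ord0 k)) (fun k => b (lift ord0 k))) => x.
by rewrite /= he big_ord_recl /= addrAC subrr add0r.
Qed.
End Closed.

(** Compactness tested on sequential coproducts, the ones that occur in telescopes. *)
Definition countably_small (G : cplx R) := forall (Y : nat -> cplx R) S
  (inj : forall n, Hom (Y n) S), hcoprod inj -> fin_supp inj G.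

Lemma fin_supp_coprod (Y : nat -> cplx R) S S' (inj : forall n, Hom (Y n) S)
    (inj' : forall n, Hom (Y n) S') G :
  hcoprod inj -> hcoprod inj' -> fin_supp inj G -> fin_supp inj' G.
Proof.
move=> cS cS' F x; have [t ht] := cS'.1 _ inj; have [r hr] := cS.1 _ inj'.
have rt : r ** t = h1 S'.
  by apply: cS'.2 => n; rewrite -hcompA ht hr hcomp1l.
have [N hN] := F (t ** x); exists N => e' he'.
have [e he] := truncP cS N.
have -> : e' = r ** e ** t.
  apply: cS'.2 => n; rewrite he' -!hcompA ht he.
  by case: ifP => _; rewrite ?hr ?hcomp0r.
by rewrite -[in RHS](hcomp1l x) -rt -!hcompA hN.
Qed.

Lemma countably_small_sh n (G : cplx R) :
  countably_small G -> countably_small (shift n G).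
Proof.
move=> sG Y S inj cS x.
have cS' := hcoprod_shift (- n) cS; have [t [e1 e2]] := shN_iso n G.
have [N hN] := sG _ _ _ cS' (hsh (- n) x ** t); exists N => e he.
apply: (@hsh_inj _ (- n)); have it : hiso t by exists (shN n G).
apply: (hiso_epi it); rewrite hsh_comp -hcompA; apply: hN => m.
by rewrite -hsh_comp he; case: ifP => _ //; rewrite hsh_0.
Qed.

Lemma mk_triangulated (P : cplx R -> Prop) :
  (forall X Y (f : Hom X Y), hiso f -> P X -> P Y) -> (exists X, P X) ->
  (forall n X, P X -> P (shift n X)) ->
  (forall X Y Z (f : Hom X Y) (g : Hom Y Z) h, tri f g h -> P X -> P Y -> P Z) ->
  triangulated_subcat P.
Proof.
move=> H1 H2 H3 H4; split=> //.
- by move=> X Y /disoP[f]; apply: H1.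
- by move=> X pX; split; apply: H3.
- by move=> X Y Z f g h /triangleP; apply: H4.
Qed.

Lemma mk_summand (P : cplx R -> Prop) :
  (forall X Y (s : Hom X Y) (p : Hom Y X), p ** s = h1 X -> P Y -> P X) ->
  summand_closed P.
Proof.
move=> H X X' Y inj /is_coprodP cY pY.
have [pr [e _]] := hcoprod_proj true cY; exact: H e pY.
Qed.

Lemma countably_small_summand : summand_closed countably_small.
Proof.
apply: mk_summand => X Y s p e sY V S inj cS.
exact: (fin_supp_retract e (sY _ _ _ cS)).
Qed.

Lemma countably_small_cell n : countably_small (cell n (R^o : lmodType R)).
Proof.
move=> Y S inj cS.
exact: (fin_supp_coprod (ds_coprod Y) cS (@cell_fin_supp R n Y)).
Qed.

Lemma countably_small_iso X Y (f : Hom X Y) :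
  hiso f -> countably_small X -> countably_small Y.
Proof.
move=> [g [e1 e2]] sX V S inj cS.
by apply: fin_supp_iso (sX _ _ _ cS); exists f; split; eassumption.
Qed.

Lemma countably_small_triangulated : triangulated_subcat countably_small.
Proof.
apply: mk_triangulated.
- exact: countably_small_iso.
- by exists (cell 0 (R^o : lmodType R)); apply: countably_small_cell.
- exact: countably_small_sh.
- move=> X Y Z f g h T sX sY V S inj cS.
  apply: (fin_supp_tri cS (tri_rot T)); first exact: sY.
  exact: countably_small_sh.
Qed.

Lemma countably_small_stalk : countably_small (stalk (R^o : lmodType R)).
Proof.
apply: (countably_small_iso (f := Q (sh0 (stalk R^o)))).
  exact/hiso_Q/sh0_quasi_iso.
exact: (countably_small_cell (n := 0)).
Qed.

End Generation.

(** * Finite-dimensional modules and the dual of the algebra *)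

Section KLinear.
Variables (K : fieldType) (L : falgType K).
Implicit Types M N : rmodType L.

Lemma kscalE c (x : L) : (kscal L c * (x : L^c) : L^c) = (c *: x : L).
Proof. by change (x * c%:A = c *: x); rewrite mulr_algr. Qed.
Lemma kscalM a b : kscal L (a * b) = kscal L a * kscal L b.
Proof. by change ((a * b)%:A = b%:A * a%:A :> L); rewrite mulr_algl scalerA mulrC. Qed.
Lemma kscalD a b : kscal L (a + b) = kscal L a + kscal L b.
Proof. exact: scalerDl. Qed.
Lemma kscalN a : kscal L (- a) = - kscal L a.
Proof. exact: scaleNr. Qed.
Lemma kscal1 : kscal L 1 = 1. Proof. exact: scale1r. Qed.
Lemma kscal0 : kscal L 0 = 0. Proof. exact: scale0r. Qed.

(** K acts on a module through the scalars of L, so linearity over K is phrased with [kscal]. *)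
Definition klin M (psi : M -> K) :=
  forall c x y, psi (kscal L c *: x + y) = c * psi x + psi y.

Lemma klin0 M (psi : M -> K) : klin psi -> psi 0 = 0.
Proof.
move=> h; have := h 1 0 0; rewrite scaler0 addr0 mul1r => e.
by apply: (addrI (psi 0)); rewrite addr0 -e.
Qed.

Definition ksub M (S : M -> Prop) :=
  S 0 /\ forall c x y, S x -> S y -> S (kscal L c *: x + y).

Lemma ksubZ M (S : M -> Prop) c x : ksub S -> S x -> S (kscal L c *: x).
Proof. by move=> [S0 Sl] Sx; rewrite -[_ *: _]addr0; apply: Sl. Qed.

Lemma ksubB M (S : M -> Prop) x y : ksub S -> S x -> S y -> S (x - y).
Proof.
move=> kS Sx Sy; rewrite addrC -scaleN1r -kscal1 -kscalN.
exact: kS.2.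
Qed.

(* A maximal subspace containing [S] but not [z] is a hyperplane. *)
Lemma ksep M (S : M -> Prop) z : ksub S -> ~ S z ->
  exists psi : M -> K, [/\ klin psi, forall x, S x -> psi x = 0 & psi z = 1].
Proof.
move=> kS Sz.
pose T := {H : M -> Prop | [/\ ksub H, forall x, S x -> H x & ~ H z]}.
pose le (a b : T) := `[< forall x, sval a x -> sval b x >].
have [||||[H [kH SH Hz]] maxH] := @Zorn T le.
- by move=> a; apply/asboolP.
- move=> b a c /asboolP h1 /asboolP h2; apply/asboolP => x /h1; exact: h2.
- move=> [a pa] [b pb] /asboolP /= h1 /asboolP /= h2.
  have e : a = b by apply/funext => x; apply/propext; split=> [/h1|/h2].
  by subst b; congr exist; apply: Prop_irrelevance.
- move=> A tA; have [[a Aa]|An] := pselect (exists a, A a); last first.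
    have hS : [/\ ksub S, forall x, S x -> S x & ~ S z] by [].
    by exists (exist _ S hS) => s As; case: An; exists s.
  pose U x := exists2 b : T, A b & sval b x.
  have hU : [/\ ksub U, forall x, S x -> U x & ~ U z].
    split=> [|x Sx|[[b [? ? bz]] _] //]; last first.
      by exists a => //; case: (svalP a) => _ h _; apply: h.
    split=> [|c x y [b Ab bx] [d Ad dy]].
      by exists a => //; case: (svalP a) => -[].
    case: (tA _ _ Ab Ad) => /asboolP h.
      by exists d => //; case: (svalP d) => -[_ kd] _ _; apply: kd => //; apply: h.
    by exists b => //; case: (svalP b) => -[_ kb] _ _; apply: kb => //; apply: h.
  exists (exist _ U hU) => b Ab; apply/asboolP => x bx /=.
  by exists b.
(* Modulo the maximal [H] every b is a multiple of z: otherwise H + K b would be larger and still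
   avoid z. *)
have ex b : exists c, H (b - kscal L c *: z).
  have [Hb|nHb] := pselect (H b).
    by exists 0; rewrite kscal0 scale0r subr0.
  pose H' x := exists h c, H h /\ x = kscal L c *: b + h.
  have kH' : ksub H'.
    split=> [|c _ _ [h [d [Hh ->]]] [h' [d' [Hh' ->]]]].
      by exists 0, 0; rewrite kscal0 scale0r addr0; split=> //; apply: kH.1.
    exists (kscal L c *: h + h'), (c * d + d'); split; first exact: kH.2.
    by rewrite kscalD kscalM scalerDl scalerDr -scalerA; abel.
  have H'z : H' z.
    apply: contrapT => nz.
    have hH' : [/\ ksub H', forall x, S x -> H' x & ~ H' z].
      split=> // x /SH Hx; exists x, 0; split=> //.
      by rewrite kscal0 scale0r add0r.
    have /(congr1 sval) /= e : exist _ H' hH' = exist _ H (And3 kH SH Hz) :> T.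
      apply: maxH; apply/asboolP => x Hx /=; exists x, 0; split=> //.
      by rewrite kscal0 scale0r add0r.
    apply: nHb; rewrite -e; exists 0, 1; split; first exact: kH.1.
    by rewrite kscal1 scale1r addr0.
  have [h [c [Hh ez]]] := H'z.
  have c0 : c != 0.
    apply/eqP => c0; apply: (Hz); rewrite ez c0 kscal0 scale0r add0r //.
  exists c^-1; rewrite ez scalerDr scalerA -kscalM mulVf // kscal1 scale1r.
  rewrite opprD addrA subrr add0r -scaleNr -kscalN.
  exact: ksubZ.
have uniq_c b c d : H (b - kscal L c *: z) -> H (b - kscal L d *: z) -> c = d.
  move=> h1 h2; have := ksubB kH h2 h1.
  have -> : b - kscal L d *: z - (b - kscal L c *: z) = kscal L (c - d) *: z.
    by rewrite kscalD kscalN scalerDl scaleNr; abel.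
  have [//|ne] := eqVneq c d; move=> /(ksubZ (c - d)^-1 kH).
  by rewrite scalerA -kscalM mulVf ?subr_eq0 // kscal1 scale1r.
exists (fun b => projT1 (cid (ex b))); split.
- move=> c x y; case: cid => d /= hd; case: cid => e /= he; case: cid => f /= hf.
  apply: uniq_c hd _.
  have -> : kscal L c *: x + y - kscal L (c * e + f) *: z =
    kscal L c *: (x - kscal L e *: z) + (y - kscal L f *: z).
    by rewrite kscalD kscalM scalerDl scalerBr -scalerA; abel.
  exact: kH.2.
- move=> x Sx; case: cid => c /= hc; apply: uniq_c hc _.
  by rewrite kscal0 scale0r subr0; apply: (SH).
- case: cid => c /= hc; apply: uniq_c hc _.
  by rewrite kscal1 scale1r subrr; apply: kH.1.
Qed.

Lemma dual_mk (g : L -> K) : (forall c x y, g (c *: x + y) = c * g x + g y) ->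
  exists d : dual L, forall x, d x = g x.
Proof.
move=> h; have gl : linear (g : L -> K^o) by move=> c x y; rewrite h.
by exists (linfun (mklin gl)) => x; rewrite lfunE.
Qed.

(* Hom_L(M, D(L)) = D(M). *)
Lemma to_dual M (psi : M -> K) : klin psi ->
  exists f : {linear M -> dual L}, forall m (x : L), f m x = psi ((x : L^c) *: m).
Proof.
move=> kp; have H m : exists d : dual L, forall x : L, d x = psi ((x : L^c) *: m).
  apply: dual_mk => c x y; rewrite -kp scalerA -scalerDl.
  by congr (psi (_ *: _)); congr (_ + _); rewrite kscalE.
pose f m := projT1 (cid (H m)).
have fE m (x : L) : f m x = psi ((x : L^c) *: m) by rewrite /f; case: cid.
have fl : linear f.
  move=> a m n; apply/lfunP => x; rewrite add_lfunE dual_scaleE !fE.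
  have := kp 1 ((x : L^c) *: (a *: m)) ((x : L^c) *: n).
  rewrite kscal1 scale1r mul1r -scalerDr => ->.
  by rewrite scalerA.
by exists (mklin fl).
Qed.

(** Through Hom_L(M, D(L)) = D(M), evaluation at 1 turns the extension problem into one for a linear
    functional on A, which a separating functional on B solves. *)
Lemma dual_injective : injective_module (dual L).
Proof.
move=> A B u v inju.
have kphi : klin (fun a : A => v a 1 : K).
  move=> c x y; rewrite linearP /= add_lfunE dual_scaleE mulr1.
  by rewrite /kscal linearZ.
have [psi kpsi hpsi] : exists2 psi : B -> K, klin psi &
    forall a, psi (u a) = v a 1.
  have [[a0 ha0]|h0] := pselect (exists a0, v a0 1 != 0 :> K); last first.
    exists (fun=> 0) => [c x y|a]; first by rewrite mulr0 addr0.
    apply: esym; apply/eqP; apply: contrapT => /negP ne.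
    by apply: h0; exists a.
  pose S b := exists2 a, b = u a & v a 1 = 0 :> K.
  have kS : ksub S.
    split=> [|c _ _ [a -> ea] [b -> eb]].
      by exists 0; [rewrite raddf0 | exact: (klin0 kphi)].
    exists (kscal L c *: a + b); first by rewrite linearP.
    by apply: (etrans (kphi c a b)); rewrite /= ea eb mulr0 addr0.
  have Sz : ~ S (u a0) by move=> [a /inju ea e]; rewrite ea e eqxx in ha0.
  have [psi [kpsi psi0 psi1]] := ksep kS Sz.
  have kv : klin (fun b => (v a0 1 : K) * psi b).
    by move=> c x y; rewrite kpsi mulrDr mulrCA.
  exists (fun b => (v a0 1 : K) * psi b) => // a.
  pose d : K := (v a 1 : K) / (v a0 1 : K).
  have : psi (u (kscal L (- d) *: a0 + a)) = 0.
    apply: psi0; exists (kscal L (- d) *: a0 + a) => //.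
    by apply: (etrans (kphi _ _ _)); rewrite /d mulNr divfK // addNr.
  rewrite linearP kpsi psi1 mulr1 => /eqP; rewrite addrC subr_eq0 => /eqP ->.
  by rewrite /d mulrC divfK.
have [w hw] := to_dual kpsi; exists w => a; apply/lfunP => x.
by rewrite hw -linearZ hpsi linearZ /= dual_scaleE mulr1.
Qed.

Fixpoint kspan M (s : seq M) x : Prop :=
  if s is b :: s' then exists c, kspan s' (x - kscal L c *: b) else x = 0.

Lemma kspan_sub M (s : seq M) : ksub (kspan s).
Proof.
elim: s => [|b s [S0 Sl]] /=; first by split=> // c x y -> ->; rewrite scaler0 addr0.
split=> [|c x y [d hd] [e he]].
  by exists 0; rewrite kscal0 scale0r subr0.
exists (c * d + e).
have -> : kscal L c *: x + y - kscal L (c * d + e) *: b =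
    kscal L c *: (x - kscal L d *: b) + (y - kscal L e *: b).
  by rewrite kscalD kscalM scalerDl scalerBr -scalerA; abel.
exact: Sl.
Qed.

Lemma kspan_mem M (s : seq M) b : List.In b s -> kspan s b.
Proof.
elim: s => //= a s IH [->|/IH h].
  by exists 1; rewrite kscal1 scale1r subrr; apply: (kspan_sub s).1.
by exists 0; rewrite kscal0 scale0r subr0.
Qed.

Lemma kspan_incl M (s : seq M) (S : M -> Prop) x :
  ksub S -> (forall b, List.In b s -> S b) -> kspan s x -> S x.
Proof.
move=> kS; elim: s x => [|b s IH] x h /=; first by move=> ->; exact: kS.1.
move=> [c hc]; rewrite -[x](subrK (kscal L c *: b)) addrC.
apply: kS.2; first by apply: h; left.
by apply: IH hc => d ds; apply: h; right.
Qed.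

Definition kfin M := exists s : seq M, forall x, kspan s x.

(** Finitely many functionals with no common zero but 0 take the place of a dimension count. *)
Lemma kspan_separated M (s : seq M) : exists n (psi : nat -> M -> K),
  (forall k, klin (psi k)) /\ forall x, kspan s x -> (forall k, (k < n)%N -> psi k x = 0) -> x = 0.
Proof.
elim: s => [|b s [n [psi [kpsi hpsi]]]].
  by exists 0%N, (fun _ _ => 0); split=> // k c x y; rewrite mulr0 addr0.
have [bs|nbs] := pselect (kspan s b).
  exists n, psi; split=> // x [c hc]; apply: hpsi.
  rewrite -[x](subrK (kscal L c *: b)) addrC.
  exact: (kspan_sub s).2.
have [f [kf f0 f1]] := ksep (kspan_sub s) nbs.
exists n.+1, (fun k => if k is k'.+1 then psi k' else f); split=> [[|k] //|x].
move=> /= [c hc] h; apply: hpsi => [|k lt]; last exact: (h k.+1).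
have := f0 _ hc; rewrite addrC -scaleNr -kscalN kf f1 (h 0%N) // addr0 mulr1.
by move=> /eqP; rewrite oppr_eq0 => /eqP c0; move: hc; rewrite c0 kscal0 scale0r subr0.
Qed.

(** Elimination: a vector on which the first functional is nonzero is split off, and the rest lies
    in the kernel of that functional. With the converse above, this yields finite spanning sets of
    subspaces. *)
Lemma separated_kspan M n (psi : nat -> M -> K) (S : M -> Prop) :
  (forall k, klin (psi k)) -> ksub S ->
  (forall x, S x -> (forall k, (k < n)%N -> psi k x = 0) -> x = 0) ->
  exists s : seq M, (forall b, List.In b s -> S b) /\ forall x, S x -> kspan s x.
Proof.
elim: n psi S => [|n IH] psi S kpsi kS h.
  by exists [::]; split=> // x Sx; apply: h.
pose S' x := S x /\ psi 0%N x = 0.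
have kS' : ksub S'.
  split; first by split; [exact: kS.1 | exact: klin0].
  move=> c x y [Sx ex] [Sy ey]; split; first exact: kS.2.
  by rewrite kpsi ex ey mulr0 addr0.
have [|s [s1 s2]] := IH (fun k => psi k.+1) S' (fun k => kpsi k.+1) kS'.
  by move=> x [Sx e0] e; apply: h => // -[|k] // lt; apply: e.
have [[b [Sb nb]]|nex] := pselect (exists b, S b /\ psi 0%N b != 0); last first.
  exists s; split=> [b /s1 []|x Sx] //; apply: s2; split=> //.
  by apply/eqP; apply: contrapT => /negP ne; apply: nex; exists x.
exists (b :: s); split=> [c [<-|/s1 []]|x Sx] //=.
exists (psi 0%N x / psi 0%N b); apply: s2; split.
  by apply: ksubB => //; apply: ksubZ.
rewrite addrC -scaleNr -kscalN kpsi mulNr divfK // addNr //.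
Qed.

Lemma kfin_sub M (S : M -> Prop) : kfin M -> ksub S ->
  exists s : seq M, (forall b, List.In b s -> S b) /\ forall x, S x -> kspan s x.
Proof.
move=> [s hs] kS; have [n [psi [kpsi h]]] := kspan_separated s.
by apply: (separated_kspan kpsi kS) => x _; apply: h.
Qed.

Lemma findim_kfin M : findim M -> kfin M.
Proof.
move=> [n [b hb]]; exists [seq b i | i <- enum 'I_n] => x.
have [c ->] := hb x; have kS := kspan_sub [seq b i | i <- enum 'I_n].
elim/big_ind: _ => [|y z hy hz|i _]; first exact: kS.1.
  by rewrite -[y]scale1r -kscal1; apply: kS.2.
apply: ksubZ => //; apply: kspan_mem.
have : i \in enum 'I_n by rewrite mem_enum.
elim: (enum 'I_n) => //= j t IH; rewrite inE => /orP[/eqP ->|/IH]; first by left.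
by right.
Qed.

Lemma kfin_prod M N : kfin M -> kfin N -> kfin (M * N)%type.
Proof.
move=> [s hs] [t ht].
exists ([seq (b, 0) | b <- s] ++ [seq (0, b) | b <- t]) => -[x y].
have := hs x; elim: s x {hs} => [|b s IH] x /=.
  move=> ->; have := ht y; elim: t y {ht} => [|b t IH] y /=; first by move=> ->.
  move=> [c /IH h]; exists c; suff -> : (0, y) - kscal L c *: (0, b) =
    (0, y - kscal L c *: b) :> (M * N)%type by [].
  by congr pair; rewrite /= scaler0 subr0.
move=> [c /IH h]; exists c; suff -> : (x, y) - kscal L c *: (b, 0) =
  (x - kscal L c *: b, y) :> (M * N)%type by [].
by congr pair; rewrite /= scaler0 subr0.
Qed.
End KLinear.

(** * D(L) as injective cogenerator, and its endomorphism ring *)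

Section DualModule.
Variables (K : fieldType) (L : falgType K).
Implicit Types M N : rmodType L.

Lemma kspan_sum M (s : seq M) x : kspan s x ->
  exists c : 'I_(size s) -> K, x = \sum_i kscal L (c i) *: nth 0 s i.
Proof.
elim: s x => [|b s IH] x /=; first by move=> ->; exists (fun=> 0); rewrite big_ord0.
move=> [c /IH[d hd]].
exists (fun i => if unlift ord0 i is Some j then d j else c).
rewrite big_ord_recl unlift_none /=.
under eq_bigr => i _ do rewrite liftK /=.
by rewrite -hd addrC subrK.
Qed.

Lemma kfin_findim M : kfin M -> findim M.
Proof.
move=> [s hs]; exists (size s), (fun i => nth 0 s i) => x.
exact: kspan_sum (hs x).
Qed.

Lemma kspan_sumP M (s : seq M) n (c : 'I_n -> K) (b : 'I_n -> M) :
  (forall i, kspan s (b i)) -> kspan s (\sum_i kscal L (c i) *: b i).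
Proof.
move=> h; have kS := kspan_sub s.
elim/big_ind: _ => [|y z hy hz|i _]; first exact: kS.1.
  by rewrite -[y]scale1r -kscal1; apply: kS.2.
exact: ksubZ.
Qed.

Lemma dualZ c (phi : dual L) x : (kscal L c *: phi) x = c * phi x.
Proof. by rewrite dual_scaleE /kscal mulr_algl linearZ. Qed.

Let e := vbasis {:L}.
Let n := \dim {:L}.

Lemma vbasis_coord (x : L) : x = \sum_(i < n) coord e i x *: e`_i.
Proof. by apply: coord_vbasis; rewrite memvf. Qed.

Lemma dual_coord (i : 'I_n) : exists d : dual L, forall x, d x = coord e i x.
Proof. by apply: dual_mk => c x y; rewrite linearP. Qed.

Definition edual i : dual L := projT1 (cid (dual_coord i)).
Lemma edualE i x : edual i x = coord e i x.
Proof. by rewrite /edual; case: cid. Qed.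

Lemma dual_sum (I : Type) (r : seq I) (F : I -> dual L) x :
  (\sum_(i <- r) F i) x = \sum_(i <- r) F i x.
Proof. by elim/big_rec2: _ => [|i y z _ <-]; rewrite ?zero_lfunE ?add_lfunE. Qed.

Lemma dual_decomp (phi : dual L) :
  phi = \sum_(i < n) kscal L (phi e`_i) *: edual i.
Proof.
apply/lfunP => x; rewrite dual_sum {1}[x]vbasis_coord raddf_sum.
apply: eq_bigr => i _; rewrite /= linearZ /= dualZ edualE.
by rewrite mulrC.
Qed.

Lemma dual_kfin : kfin (dual L : rmodType L).
Proof.
exists [seq edual i | i <- enum 'I_n] => phi; rewrite [phi]dual_decomp.
apply: kspan_sumP => i; apply: kspan_mem.
have : i \in enum 'I_n by rewrite mem_enum.
elim: (enum 'I_n) => //= j t IH; rewrite inE => /orP[/eqP ->|/IH]; first by left.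
by right.
Qed.

(** The map f is determined by the functional psi -> f psi 1 on D(L), and this is evaluation at an
    element l because L is finite-dimensional. Hence End(D(L)) = L. *)
Lemma dual_end (f : {linear dual L -> dual L}) :
  exists l : L, forall phi, f phi = dual_lact l phi.
Proof.
exists (\sum_(i < n) (f (edual i) 1 : K) *: e`_i) => phi.
have H (psi : dual L) : f psi 1 = psi (\sum_(i < n) (f (edual i) 1 : K) *: e`_i).
  rewrite {1}[psi]dual_decomp raddf_sum dual_sum raddf_sum.
  apply: eq_bigr => i _. rewrite /= linearZ dualZ. rewrite /= linearZ /=.
  exact: mulrC.
apply/lfunP => x; rewrite dual_lactE -dual_scaleE -H.
have -> : f (dual_scale x phi) = dual_scale x (f phi) by exact: (linearZ_LR f (x : L^c) phi).
by rewrite dual_scaleE mulr1.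
Qed.

Lemma dual_lact_inj (l l' : L) :
  (forall phi, dual_lact l phi = dual_lact l' phi) -> l = l'.
Proof.
move=> h; rewrite [l]vbasis_coord [l']vbasis_coord; apply: eq_bigr => i _.
have /lfunP/(_ 1) := h (edual i); rewrite !dual_lactE !mul1r !edualE.
by move->.
Qed.

Lemma fg_kfin M : finitely_generated M -> kfin M.
Proof.
move=> [m [b hb]].
exists (allpairs (fun (i : 'I_n) j => (e`_i : L^c) *: b j) (enum 'I_n)
  (enum 'I_m)) => x.
have [a ->] := hb x.
set s := allpairs _ _ _; have kS := kspan_sub s.
elim/big_ind: _ => [|y z hy hz|j _]; first exact: kS.1.
  by rewrite -[y]scale1r -kscal1; apply: kS.2.
have -> : a j = \sum_(i < n) kscal L (coord e i (a j)) * (e`_i : L^c).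
  rewrite {1}[a j](vbasis_coord (a j : L)); apply: eq_bigr => i _.
  by rewrite kscalE.
rewrite scaler_suml; under eq_bigr => i _ do rewrite -scalerA.
apply: kspan_sumP => i; apply: kspan_mem.
have : i \in enum 'I_n by rewrite mem_enum.
rewrite /s; elim: (enum 'I_n) => //= k t IH; rewrite inE => h.
apply/List.in_or_app; case/orP: h => [/eqP ->|/IH]; last by right.
left; have : j \in enum 'I_m by rewrite mem_enum.
elim: (enum 'I_m) => //= l u IHu; rewrite inE => /orP[/eqP ->|/IHu]; first by left.
by right.
Qed.

Definition dual_summand M := exists n
  (a : 'I_n -> {linear M -> dual L}) (b : 'I_n -> {linear dual L -> M}),
  dual_basis a b.

(** Separating functionals, viewed as maps to D(L), embed M into a finite power of D(L), and the
    embedding splits by injectivity. *)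
Lemma injective_dual_summand M :
  injective_module M -> kfin M -> dual_summand M.
Proof.
move=> injM [s hs].
have [m [psi [kpsi sep]]] := kspan_separated s.
have H (k : 'I_m) := cid (to_dual (kpsi k)).
pose a (k : 'I_m) : {linear M -> dual L} := projT1 (H k).
have aE k x (l : L) : a k x l = psi k ((l : L^c) *: x) by apply: (projT2 (H k)).
pose D := fun _ : 'I_m => (dual L : rmodType L).
have uP x : exists s, supp_in (A := D) s (fun k => a k x).
  by exists (enum 'I_m) => i; rewrite mem_enum.
have ul : linear (fun x => mkdsum (uP x)).
  by move=> c x y; apply: dsum_eq => k; rewrite dsvP /dsv /= linearP.
have uinj : injective (mklin ul).
  move=> x y exy; apply: subr0_eq; apply: sep; first exact: hs.
  move=> k lt; have := congr1 (fun z => (dsv z (Ordinal lt) : dual L) 1) exy.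
  rewrite /dsv /= !aE !scale1r => e1.
  have := aE (Ordinal lt) (x - y) 1; rewrite scale1r => <-.
  by rewrite raddfB /= add_lfunE opp_lfunE !aE !scale1r e1 subrr.
have [w hw] := injM _ _ (mklin ul) (idfun : {linear M -> M}) uinj.
exists m, a, (fun k => w \o dsum_in D k) => x.
rewrite -[LHS](hw x) -[in RHS]raddf_sum; congr (w _).
apply: (dsum_decomp (s := index_enum 'I_m)) => [|k]; first exact: index_enum_uniq.
by rewrite mem_index_enum.
Qed.

Section HomDual.
Variables (M : rmodType L) (m : nat).
Variables (a : 'I_m -> {linear M -> dual L}) (b : 'I_m -> {linear dual L -> M}).
Hypothesis ab : dual_basis a b.

Definition hd_b k : homdual M := HomDual (fun l x y => linearP (b k) l x y).

Lemma hd_coef_ex k (p : homdual M) :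
  exists l : L, forall phi, a k (p phi) = dual_lact l phi.
Proof.
have fl : linear (fun phi => a k (p phi)).
  by move=> l x y; rewrite hd_linear linearP.
exact: (dual_end (mklin fl)).
Qed.
Definition hd_coef k (p : homdual M) : L^c := projT1 (cid (hd_coef_ex k p)).
Lemma hd_coefE k (p : homdual M) phi : a k (p phi) = dual_lact (hd_coef k p) phi.
Proof. by rewrite /hd_coef; case: cid. Qed.

Lemma hd_coef_linear k : linear (hd_coef k : homdual M -> (L^c)^o).
Proof.
move=> l p q; apply: dual_lact_inj => phi.
rewrite -hd_coefE /= raddfD /= !hd_coefE; apply/lfunP => x.
rewrite add_lfunE !dual_lactE mulrDr linearD; congr (_ + _).
by congr (phi _); rewrite -mulrA.
Qed.

Lemma hd_mul_linear k : linear (fun x : (L^c)^o => (x : L^c) *: hd_b k).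
Proof. by move=> l x y; rewrite scalerDl -scalerA. Qed.

(** A splitting of M off D(L)^m becomes a splitting of its image off L^m, since the coefficients a k
    p lie in End(D(L)) = L. *)
Lemma homdual_basis : dual_basis (fun k => mklin (hd_coef_linear k))
  (fun k => mklin (hd_mul_linear k)).
Proof.
move=> p; apply: hd_ext => phi; rewrite [LHS]ab.
have S (I : Type) (r : seq I) (F : I -> homdual M) :
    (\sum_(i <- r) F i) phi = \sum_(i <- r) F i phi.
  by elim/big_rec2: _ => [|i y z _ <-].
by rewrite S; apply: eq_bigr => k _ /=; rewrite hd_coefE.
Qed.

(** Full on summands of D(L)^m: g sends b k to what must be G composed with b k, and x is the sum of
    the b k (a k x). *)
Lemma hd_map_full N (g : {linear homdual M -> homdual N}) :
  exists G : {linear M -> N}, forall p, g p = hd_map G p.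
Proof.
pose G x := \sum_k g (hd_b k) (a k x).
have Gl : linear G.
  move=> l x y; rewrite /G scaler_sumr -big_split; apply: eq_bigr => k _.
  by rewrite linearP hd_linear.
exists (mklin Gl) => p; apply: hd_ext => phi /=; rewrite /G.
rewrite {1}[p]homdual_basis raddf_sum.
have S (I : Type) (r : seq I) (F : I -> homdual N) :
    (\sum_(i <- r) F i) phi = \sum_(i <- r) F i phi.
  by elim/big_rec2: _ => [|i y z _ <-].
rewrite S; apply: eq_bigr => k _; rewrite hd_coefE.
by have /= -> := linearZ_LR g (hd_coef k p) (hd_b k).
Qed.

Lemma hd_map_faithful N (G : {linear M -> N}) :
  (forall p, hd_map G p = 0) -> forall x, G x = 0.
Proof.
move=> h x; rewrite [x]ab raddf_sum big1 // => k _.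
by have := congr1 (fun q : homdual N => q (a k x)) (h (hd_b k)).
Qed.

Lemma homdual_projective : projective_module (homdual M).
Proof.
move=> A B u g h.
have H k : exists w : {linear (L^c)^o -> A}, forall x : (L^c)^o,
    u (w x) = g ((x : L^c) *: hd_b k).
  have gl : linear (fun x : (L^c)^o => g ((x : L^c) *: hd_b k)).
    by move=> l x y; rewrite scalerDl -scalerA linearP.
  apply: (@regular_projective _ A B u (mklin gl)) => x; exact: h.
pose w k := projT1 (cid (H k)).
have wE k (x : (L^c)^o) : u (w k x) = g ((x : L^c) *: hd_b k).
  by rewrite /w; case: cid.
have wl : linear (fun p => \sum_k w k (hd_coef k p)).
  move=> l x y; rewrite scaler_sumr -big_split; apply: eq_bigr => k _.
  by rewrite hd_coef_linear linearP.
exists (mklin wl) => p; rewrite /= raddf_sum [in RHS](homdual_basis p) raddf_sum.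
by apply: eq_bigr => k _ /=; rewrite wE.
Qed.
End HomDual.
End DualModule.

(** * The inverse Nakayama functor *)

Section NuFunctor.
Variables (K : fieldType) (L : falgType K).
Implicit Types A B T : cplx L^c.

Lemma nu_map_dif A B (f : chmap A B) i j p :
  hd_map (f j) (dif (nu_inv A) i j p) = dif (nu_inv B) i j (hd_map (f i) p).
Proof. by apply: hd_ext => x /=; rewrite cm_dif. Qed.
Definition nu_map A B (f : chmap A B) : chmap (nu_inv A) (nu_inv B) :=
  @Chmap _ (nu_inv A) (nu_inv B) (fun i => hd_map (f i)) (nu_map_dif f).

Lemma nu_map_homotopic A B (f g : chmap A B) :
  homotopic f g -> homotopic (nu_map f) (nu_map g).
Proof.
move=> /homotopicP[h H]; apply/homotopicP.
exists (fun i j => hd_map (h i j)) => i j k ej ek p.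
by apply: hd_ext => x /=; apply: H.
Qed.

(** Fullness in each degree provides the components, and faithfulness makes them commute with the
    differentials. *)
Lemma nu_full A B (g : chmap (nu_inv A) (nu_inv B)) :
  (forall i, dual_summand (A i)) ->
  exists G : chmap A B, forall i p, g i p = nu_map G i p.
Proof.
move=> sA; have H i : exists G : {linear A i -> B i}, forall p, g i p = hd_map G p.
  have [n [a [b ab]]] := sA i; exact: (hd_map_full ab (g i)).
pose G i := projT1 (cid (H i)).
have GE i p : g i p = hd_map (G i) p by rewrite /G; case: cid.
have Gd i j x : G j (dif A i j x) = dif B i j (G i x).
  have [n [a [b ab]]] := sA i; apply: subr0_eq.
  apply: (hd_map_faithful ab (G := (G j \o dif A i j) \- (dif B i j \o G i))).
  move=> p; apply: hd_ext => phi /=; apply/eqP; rewrite subr_eq0; apply/eqP.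
  have := congr1 (fun q : homdual (B j) => q phi) (cm_dif g j (p : nu_inv A i)).
  by rewrite /= !GE.
by exists (Chmap Gd).
Qed.

Section NuCone.
Variables (A B : cplx L^c) (f : chmap A B).

Lemma pair_hd_linear i (p : cone (nu_map f) i) :
  linear (fun phi => (p.1 phi, p.2 phi) : cone f i).
Proof. by move=> l x y; rewrite !hd_linear. Qed.
Definition pair_hd i (p : cone (nu_map f) i) : homdual (cone f i) :=
  HomDual (pair_hd_linear p).
Lemma nu_cone_linear i : linear (@pair_hd i).
Proof. by move=> l p q; apply: hd_ext. Qed.
Lemma nu_cone_dif i j p : mklin (@nu_cone_linear j) (dif (cone (nu_map f)) i j p) =
  dif (nu_inv (cone f)) i j (mklin (@nu_cone_linear i) p).
Proof.
apply: (@chmap_succ _ (cone (nu_map f)) (nu_inv (cone f))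
  (fun i => mklin (@nu_cone_linear i))) => {}i _ <- {}p.
rewrite cone_difE; apply: hd_ext => phi.
transitivity (dif (cone f) i (i + 1) (p.1 phi, p.2 phi)); last by [].
by rewrite cone_difE.
Qed.
Definition nu_cone : chmap (cone (nu_map f)) (nu_inv (cone f)) :=
  @Chmap _ (cone (nu_map f)) (nu_inv (cone f))
   (fun i => mklin (@nu_cone_linear i)) nu_cone_dif.

Lemma hd_fst_linear i (q : homdual (cone f i)) : linear (fun phi => (q phi).1).
Proof. by move=> l x y; rewrite hd_linear. Qed.
Lemma hd_snd_linear i (q : homdual (cone f i)) : linear (fun phi => (q phi).2).
Proof. by move=> l x y; rewrite hd_linear. Qed.

(** Hom out of D(L) commutes with binary products, so this is even an isomorphism of complexes. *)
Lemma nu_cone_quasi_iso : quasi_iso nu_cone.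
Proof.
pose g i (q : nu_inv (cone f) i) : cone (nu_map f) i :=
  (HomDual (hd_fst_linear q), HomDual (hd_snd_linear q)).
have gl i : linear (@g i).
  by move=> l p q; congr pair; apply: hd_ext.
have fK i : cancel (nu_cone i) (mklin (@gl i)).
  by move=> [p q]; congr pair; apply: hd_ext.
have gK i : cancel (mklin (@gl i)) (nu_cone i).
  by move=> q; apply: hd_ext => phi /=; case: (q phi).
have gd i j q : mklin (@gl j) (dif (nu_inv (cone f)) i j q) =
    dif (cone (nu_map f)) i j (mklin (@gl i) q).
  by rewrite -{1}(gK i q) -cm_dif fK.
exact: (quasi_iso_bij (g := Chmap gd) fK gK).
Qed.
End NuCone.

Section NuShift.
Variables (n : int) (T : cplx L^c).
Lemma nu_shift_dif i j p :
  (idfun : {linear shift n (nu_inv T) j -> nu_inv (shift n T) j})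
    (dif (shift n (nu_inv T)) i j p) =
  dif (nu_inv (shift n T)) i j p.
Proof.
by apply: hd_ext => x; rewrite /= /shift_dif; case: ifP.
Qed.
Definition nu_shift : chmap (shift n (nu_inv T)) (nu_inv (shift n T)) :=
  @Chmap _ (shift n (nu_inv T)) (nu_inv (shift n T))
   (fun i => (idfun : {linear shift n (nu_inv T) i -> nu_inv (shift n T) i}))
   nu_shift_dif.
Lemma nu_shift_quasi_iso : quasi_iso nu_shift.
Proof.
have gd i j q : (idfun : {linear nu_inv (shift n T) j -> shift n (nu_inv T) j})
    (dif (nu_inv (shift n T)) i j q) = dif (shift n (nu_inv T)) i j q.
  by rewrite /= -[LHS](nu_shift_dif).
exact: (@quasi_iso_bij _ _ _ nu_shift (@Chmap _ (nu_inv (shift n T))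
  (shift n (nu_inv T)) (fun i => (idfun : {linear nu_inv (shift n T) i ->
  shift n (nu_inv T) i})) gd)).
Qed.
End NuShift.

Lemma nu_bounded T : bounded T -> bounded (nu_inv T).
Proof.
by move=> [N hN]; exists N => i lt p; apply: hd_ext => x; apply: hN.
Qed.

Section NuDual.
Lemma lact_linear (l : L) : linear (dual_lact l : dual L -> dual L).
Proof. exact: dual_lact_linear. Qed.
Definition lact_hd (l : L) : homdual (dual L : rmodType L) := HomDual (lact_linear l).
Lemma lact_hd_linear : linear (lact_hd : (L^c)^o -> homdual (dual L)).
Proof.
move=> a x y; apply: hd_ext => phi /=; apply/lfunP => z.
rewrite add_lfunE !dual_lactE -linearD; congr (phi _).
by rewrite mulrDr -mulrA.
Qed.

Let tau : {linear homdual (dual L) -> (L^c)^o} :=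
  mklin (hd_coef_linear (fun _ : 'I_1 => (idfun : {linear dual L -> dual L})) ord0).

Lemma lact_hdK x : tau (lact_hd x) = x.
Proof. by apply: dual_lact_inj => phi; rewrite /tau /= -hd_coefE. Qed.

Lemma guard_lact b y : guard_out (L^c)^o b (tau (hd_map (guard_in (dual L) b)
  (hd_map (guard_out (dual L) b) (lact_hd y)))) = guard_out (L^c)^o b y.
Proof.
case: b => //; apply: (congr1 (guard_out (L^c)^o true)).
by rewrite -[RHS]lact_hdK; congr (tau _); apply: hd_ext.
Qed.

(** The retraction comes from Hom(D(L), D(L)) = L, through l -> [dual_lact l] and its inverse. *)
Lemma closed_nu_dual (P : cplx L^c -> Prop) : summand_closed P ->
  P (nu_inv (stalk (dual L))) -> P (stalk (L^c)^o).
Proof.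
move=> sP.
pose s i : {linear stalk (L^c)^o i -> nu_inv (stalk (dual L)) i} :=
  hd_map (guard_out (dual L) (i == 0)) \o (mklin lact_hd_linear \o guard_in (L^c)^o (i == 0)).
pose p i : {linear nu_inv (stalk (dual L)) i -> stalk (L^c)^o i} :=
  guard_out (L^c)^o (i == 0) \o (tau \o hd_map (guard_in (dual L) (i == 0))).
have sd i j x : s j (dif (stalk (L^c)^o) i j x) =
    dif (nu_inv (stalk (dual L))) i j (s i x).
  by rewrite [dif (stalk _) _ _ _]/= raddf0; apply: hd_ext.
have pd i j x : p j (dif (nu_inv (stalk (dual L))) i j x) =
    dif (stalk (L^c)^o) i j (p i x).
  have -> : dif (nu_inv (stalk (dual L))) i j x = 0 by apply: hd_ext.
  by rewrite raddf0.
apply: (closed_retract sP (s := Q (Chmap sd)) (p := Q (Chmap pd))).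
rewrite -Q_comp; apply: Q_eq => i x; rewrite /= -[RHS](guard_inK x).
exact: guard_lact.
Qed.
End NuDual.
End NuFunctor.

(** * Rickard's construction *)

Section InjectiveComplexes.
Variable R : nzRingType.
Implicit Types X Y J : cplx R.

Definition binj J := bounded J /\ forall i, injective_module (J i).

Lemma bounded_shift n X : bounded X -> bounded (shift n X).
Proof.
move=> [N hN]; exists (N + `|n|)%N => i lt x; apply: hN.
by move: lt; clear; lia.
Qed.

Lemma binj_shift n J : binj J -> binj (shift n J).
Proof. by move=> [bJ iJ]; split=> [|i]; [apply: bounded_shift | apply: iJ]. Qed.

Lemma binj_kinj J : binj J -> kinj J.
Proof. by move=> [bJ iJ]; apply: bounded_kinj. Qed.

Lemma binj_Q J X (p : Hom X J) : binj J -> exists f : chmap X J, p = Q f.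
Proof. by move=> /(binj_shift 1)/binj_kinj/kinj_shift1; apply. Qed.

Lemma hom0_disjoint J X : binj J ->
  (forall i, (forall x : X i, x = 0) \/ (forall y : J i, y = 0)) -> hom0 X J.
Proof.
move=> bJ h p; have [f ->] := binj_Q p bJ; apply: Q_eq => i x.
by case: (h i) => e; [rewrite (e x) !raddf0 | rewrite [LHS]e [RHS]e].
Qed.

Lemma hom0_shiftD a b X Y :
  hom0 X (shift a (shift b Y)) <-> hom0 X (shift (a + b) Y).
Proof.
have S : hiso (Q (shm (erefl (a + b)) Y)) by exact/hiso_Q/shm_quasi_iso.
split; last exact: hom0_iso (hiso1 _) S.
have [t [e1 e2]] := S; apply: hom0_iso (hiso1 _) _.
by exists (Q (shm (erefl (a + b)) Y)); split; eassumption.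
Qed.

Lemma bounded_hom0 X J : bounded X -> binj J ->
  exists N : nat, forall k, N%:Z < k -> hom0 X (shift k J).
Proof.
move=> [N hN] bJ; have [[M hM] _] := bJ; exists (N + M)%N => k lt.
apply: hom0_disjoint; first exact: binj_shift.
move=> i; have [lti|gei] := ltnP N `|i|%N; [left | right].
  exact: hN.
by move=> y; apply: hM; move: lt gei; clear; lia.
Qed.
End InjectiveComplexes.

(** * Detection of cohomology by D(L) and smallness of D^b(mod) *)

Section Cohomology.
Variables (K : fieldType) (L : falgType K).
Implicit Types X Y C : cplx L^c.
Notation DL := (dual L : rmodType L).

Lemma binj_cell n : binj (cell n DL).
Proof.
split; first exact: cell_bounded.
move=> i; rewrite /= /stalk_obj; case: ifP => _; first exact: dual_injective.
by move=> A B u v _; exists \0 => x; rewrite (rV0_eq0 (v x)).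
Qed.

(** A cocycle that does not bound is separated from the coboundaries by a functional. This is a map
    Y i -> D(L) that kills coboundaries, so a chain map to a cell, and it is not null-homotopic. *)
Lemma dual_detects Y i : hom0 Y (cell i DL) ->
  forall x : Y i, cocycle x -> coboundary x.
Proof.
move=> h x cx; apply: contrapT => nbx.
have kS : ksub (@coboundary _ Y i).
  split=> [|c y z hy hz]; first exact: coboundary0.
  apply: coboundaryD => //; have [j [w ->]] := hy.
  by exists j, (kscal L c *: w); rewrite linearZ.
have [psi [kpsi psi0 psi1]] := ksep kS nbx.
have [F hF] := to_dual kpsi.
have cF j y : F (dif Y j i y) = 0.
  apply/lfunP => l; rewrite hF zero_lfunE; apply: psi0.
  by exists j, ((l : L^c) *: y); rewrite linearZ.
have := kinj_homotopic (binj_kinj (binj_cell i)) (h (Q (cell_in cF))).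
move=> /homotopic_coboundary/(_ cx)/coboundaryP[y].
rewrite cell_inE cell_dif [_ - _]subr0 => /(congr1 (cell_val i DL i)).
rewrite cell_mkK raddf0 => /lfunP/(_ 1).
by rewrite hF scale1r psi1 zero_lfunE => /eqP; rewrite oner_eq0.
Qed.

(* Vanishing of the cohomology below degree [c]: maps to [D(L)] placed in
   degree [i] detect the cohomology in degree [i]. *)
Definition coh_ge (c : int) Y := forall i, i < c -> hom0 Y (cell i DL).

Lemma coh_ge_tri c X Y Z (f : Hom X Y) (g : Hom Y Z) h :
  tri f g h -> coh_ge c Y -> coh_ge c (shift 1 X) -> coh_ge c Z.
Proof.
move=> T cY cX i lt p; have [|q ->] := tri_ext (p := p) (tri_rot T).
  exact: (cY i lt).
by rewrite (cX i lt q) hcomp0l.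
Qed.

Lemma coh_ge_shift n c Y : coh_ge (c + n) Y -> coh_ge c (shift n Y).
Proof.
move=> h i lt; apply/hom0_shift; rewrite -opprD; apply: h.
by rewrite ltrD2r.
Qed.

Lemma coh_ge_iso c X Y (f : Hom X Y) : hiso f -> coh_ge c Y -> coh_ge c X.
Proof. by move=> hf h i lt; apply: hom0_iso hf (hiso1 _) (h i lt). Qed.

Lemma bounded_coh_ge Y : bounded Y ->
  exists N : nat, forall c, c <= - N%:Z -> coh_ge c Y.
Proof.
move=> [N hN]; exists N => c le i lt; apply: hom0_disjoint; first exact: binj_cell.
move=> j; have [->|ne] := eqVneq j i; last by right=> y; apply: cell_neq.
by left; apply: hN; move: le lt; clear; lia.
Qed.

Lemma kfin_regular : kfin ((L^c)^o : rmodType L).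
Proof.
exists [seq ((vbasis {:L})`_i : L^c) | i : 'I_(\dim {:L}) <- enum 'I_(\dim {:L})] => x.
have e := vbasis_coord (x : L).
have -> : x = \sum_i kscal L (coord (vbasis {:L}) i x) *:
    ((vbasis {:L})`_i : (L^c)^o).
  by rewrite {1}e; apply: eq_bigr => i _; apply: esym; apply: kscalE.
apply: kspan_sumP => i; apply: kspan_mem.
have : i \in enum 'I_(\dim {:L}) by rewrite mem_enum.
elim: (enum _) => //= j t IH; rewrite inE => /orP[/eqP ->|/IH]; first by left.
by right.
Qed.

Lemma kfin_cell n (M : rmodType L) i : kfin M -> kfin (cell n M i).
Proof.
rewrite /= /stalk_obj; case: ifP => // _ _.
by exists [::] => x; rewrite (rV0_eq0 x).
Qed.

Section Resolve.
Variables (Y : nat -> cplx L^c) (S : cplx L^c) (inj : forall n, Hom (Y n) S).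
Hypothesis cS : hcoprod inj.
Variable c : int.
Hypothesis hS : coh_ge c S.

(* Free cells are attached to kill the cohomology from the top down; once it
   vanishes from degree [c] on, there are no maps to [S]. *)
Lemma kfin_fin_supp (k : nat) C : (forall i, kfin (C i)) ->
  (forall i (x : C i), c + k%:Z <= i -> cocycle x -> coboundary x) ->
  fin_supp inj C.
Proof.
elim: k C => [|k IHk] C fC hC.
  (* Here C has cohomology only below c and S only from c on. *)
  apply: fin_supp_hom0; apply: (@trunc_hom0 _ (c - 1)) => i x lt.
    by apply: hC; move: lt; clear; lia.
  by apply: dual_detects; apply: hS; move: lt; clear; lia.
(* The top degree that may carry cohomology is c + k; it is written as q + 1 because the cone
   criteria are stated in successor degrees. *)
pose q : int := c + k%:Z - 1.
have eq : q + 1 = c + k%:Z by rewrite subrK.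
have kZ : ksub (@cocycle _ C (q + 1)).
  split=> [j|a x y cx cy j]; first by rewrite raddf0.
  by rewrite linearP /= cx cy scaler0 addr0.
have [s [s1 s2]] := kfin_sub (fC (q + 1)) kZ.
have {s2} : forall x : C (q + 1), cocycle x ->
    exists y, kspan s y /\ coboundary (x - y).
  move=> x /s2 hx; exists x; split=> //; rewrite subrr; exact: coboundary0.
(* Inner induction on the number of cocycles that span the cohomology in degree q + 1; a cell
   attached along the first one, z, makes it bound. *)
move: {-1}(size s) (erefl (size s)) => n; clear kZ; move: n C fC hC s s1.
elim=> [|n IHs] C fC hC [|z s] //= s1 sz s2.
  apply: IHk => // i x le cx; have [e|ne] := eqVneq i (q + 1).
    by subst i; have [y [/= -> ]] := s2 x cx; rewrite subr0.
  by apply: hC => //; move: le ne; rewrite eq; clear; lia.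
case: sz => sz.
have cz : cocycle z by apply: s1; left.
have fl : linear (fun x : (L^c)^o => (x : L^c) *: z).
  by move=> l x y; rewrite scalerDl -scalerA.
have cf x : cocycle (mklin fl x) by move=> j; rewrite /= linearZ /= cz scaler0.
pose f := cell_out (f := mklin fl) cf.
apply: (fin_supp_tri cS (tri_cone f)).
  exact: (countably_small_cell cS).
apply: (IHs (cone f) _ _ [seq cone_in f (q + 1) b | b <- s]) => //.
- move=> i; apply: kfin_prod => //; apply: kfin_cell; exact: kfin_regular.
- move=> i [a x] le cax; have a0 : a = 0.
    by apply: (@cell_neq _ (q + 1)); move: le; rewrite eq; clear; lia.
  subst a; have -> : (0, x) = cone_in f i x by [].
  apply: coboundary_cm; apply: hC => //.
  apply: (cocycle_succ (erefl (i + 1))).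
  by move/cone_cocycle: cax => [_]; rewrite [f _ _]raddf0 add0r.
- have : forall b, List.In b s -> cocycle b by move=> b bs; apply: s1; right.
  elim: (s) => //= b t IH h x [<-|]; first by apply: (cocycle_cm (cone_in f)); apply: h; left.
  by apply: IH => w wt; apply: h; right.
- by rewrite size_map.
move=> [a x] cax; have a0 : a = 0.
  by apply: (@cell_neq _ (q + 1)); rewrite -subr_eq0 addrAC subrr add0r oner_eq0.
subst a; have cx : cocycle x.
  apply: (cocycle_succ (erefl (q + 1 + 1))).
  by move/cone_cocycle: cax => [_]; rewrite [f _ _]raddf0 add0r.
have [y [[l hy] /(coboundary_succ (erefl (q + 1)))[w ew]]] := s2 x cx.
exists (cone_in f (q + 1) (y - kscal L l *: z)); split.
  have : forall b t, kspan t b -> kspan [seq cone_in f (q + 1) b | b <- t]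
    (cone_in f (q + 1) b).
    move=> b t; elim: t b => [|d t IH] b; first by move=> ->; apply: (raddf0 (cone_in f (q + 1))).
    move=> [e /IH h]; exists e.
    by move: h; rewrite linearB linearZ.
  move=> /(_ _ _ hy); congr kspan.
have -> : (0, x) - cone_in f (q + 1) (y - kscal L l *: z) =
    (0, x - (y - kscal L l *: z)) :> cone f (q + 1).
  by congr pair; rewrite /= subrr.
apply/cone_coboundary.
exists (cell_mk (q + 1) (L^c)^o (q + 1) (kscal L l : (L^c)^o)), w.
rewrite cell_dif oppr0 /f cell_out_mk -ew; split=> //=.
by abel.
Qed.

Lemma Db_fin_supp X : Db_mod X -> fin_supp inj X.
Proof.
move=> [Y' [/disoP[t it] bY fY]]; apply: (fin_supp_iso it).
have [N hN] := bY; apply: (@kfin_fin_supp (N.+1 + `|c|)%N).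
  by move=> i; apply: findim_kfin.
move=> i x le _; suff -> : x = 0 by apply: coboundary0.
by apply: hN; move: le; clear; lia.
Qed.
End Resolve.

Lemma Db_mod_shift n X : Db_mod X -> Db_mod (shift n X).
Proof.
move=> [Y [/disoP[t it] bY fY]]; exists (shift n Y); split.
- by apply/disoP; exists (hsh n t); apply: hiso_sh.
- exact: bounded_shift.
- by move=> i; apply: fY.
Qed.
End Cohomology.

(** * Vanishing of maps into and out of the T_i *)

Section RickardTower.
Variables (K : fieldType) (L : falgType K) (r : nat).
Implicit Types (X T : 'I_r -> cplx L^c) (Y Z W J : cplx L^c).
Notation DL := (dual L : rmodType L).

Definition hscale c (Y : cplx L^c) : Hom Y Y := Q (cm_scale c (cm_id Y)).

Lemma hscale_nat c Y Z (p : Hom Y Z) : hscale c Z ** p = p ** hscale c Y.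
Proof.
have H A B (f : chmap A B) : hscale c B ** Q f = Q f ** hscale c A.
  by rewrite -!Q_comp; apply: Q_eq => i x /=; rewrite linearZ.
have [W [s [qs [f ->]]]] := roofP p.
rewrite hcompA H -!hcompA; congr (_ ** _); apply: (epiQ qs).
by rewrite -!hcompA QKi hcomp1r H hcompA QKi hcomp1l.
Qed.

Lemma cl_dscale c Y Z (a : dhom Y Z) : cl (dscale c a) = cl a ** hscale c Y.
Proof.
rewrite -hscale_nat; case: a => W s f qs; rewrite /dscale !cl_roof hcompA /=.
by congr (_ ** _); rewrite -Q_comp; apply: Q_eq.
Qed.

Lemma cl_dscaleN1 Y Z (a : dhom Y Z) : cl (dscale (- 1) a) = hopp (cl a).
Proof.
rewrite cl_dscale -hscale_nat /hopp; congr (_ ** _); apply: Q_eq => i x /=.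
by rewrite kscalN kscal1 scaleN1r.
Qed.

(** Rickard's construction for one index, on the level of [Hom]. The coproduct Z n of negative
    shifts is recorded through the vanishing of maps out of it, and the choice of bases through the
    fact that [beta] kills. *)
Record rickard_tower X (X0 T0 : cplx L^c) := RickardTower {
  rt_Y : nat -> cplx L^c;
  rt_Y0 : rt_Y 0%N = X0;
  rt_Z : nat -> cplx L^c;
  rt_alpha : forall n, Hom (rt_Z n) (rt_Y n);
  rt_beta : forall n, Hom (rt_Y n) (rt_Y n.+1);
  rt_gamma : forall n, Hom (rt_Y n.+1) (shift 1 (rt_Z n));
  rt_tri : forall n, tri (rt_alpha n) (rt_beta n) (rt_gamma n);
  rt_Z_hom0 : forall n W,
    (forall j m, m < 0 -> hom0 (shift m (X j)) W) -> hom0 (rt_Z n) W;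
  rt_kill : forall n j m (x : Hom (shift m (X j)) (rt_Y n)), m < 0 ->
    rt_beta n ** x = hzero _ _;
  rt_S : cplx L^c;
  rt_inj : forall n, Hom (rt_Y n) rt_S;
  rt_coprod : hcoprod rt_inj;
  rt_phi : Hom rt_S rt_S;
  rt_phiE : forall n, rt_phi ** rt_inj n =
    rt_inj n +! hopp (rt_inj n.+1 ** rt_beta n);
  rt_u : Hom rt_S T0;
  rt_v : Hom T0 (shift 1 rt_S);
  rt_colim : tri rt_phi rt_u rt_v }.

(** Every x is a combination of basis elements, all of which factor through alpha, and beta alpha =
    0. *)
Lemma rickard_stepP X (Y Y' : cplx L^c) (beta : dhom Y Y') :
  rickard_step X beta -> exists Z (alpha : Hom Z Y) (gamma : Hom Y' (shift 1 Z)),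
  [/\ tri alpha (cl beta) gamma,
      forall W, (forall j m, m < 0 -> hom0 (shift m (X j)) W) -> hom0 Z W &
      forall j m (x : Hom (shift m (X j)) Y), m < 0 -> cl beta ** x = hzero _ _].
Proof.
move=> [B [e [Z [inj [alpha [gamma [bas /is_coprodP cZ comm /triangleP T]]]]]]].
exists Z, (cl alpha), (cl gamma); split=> //.
  by move=> W h; apply: (hcoprod_hom0 cZ) => k; apply: h; apply: si_neg.
move=> j m x lt; suff [y ->] : exists y, x = cl alpha ** y.
  by rewrite hcompA (tri_comp0 T) hcomp0l.
have [f ->] := homP x; have [s /clE ->] := (bas j m lt).1 f.
elim: s => [|[c b] s [y ey]].
  by exists (hzero _ _); rewrite hcomp0r.
have eb : cl (e j m b) = cl alpha ** cl (inj (StepIndex lt b)).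
  by rewrite cl_comp; apply/clE/deq_sym/comm.
exists (cl (inj (StepIndex lt b)) ** hscale c _ +! y).
by rewrite /= -cl_add ey cl_dscale eb hadd_compr hcompA.
Qed.

Lemma rickard_towerP X T i : rickard X T ->
  exists t : rickard_tower X (X i) (T i), True.
Proof.
move=> [[Xn [beta [X0 st mil]]] _].
have H n := rickard_stepP (st n i).
have H1 n := cid (H n); have H2 n := cid (projT2 (H1 n)).
have H3 n := cid (projT2 (H2 n)).
have [S [inj [phi [u [v [/is_coprodP cS ephi /triangleP T0]]]]]] := mil i.
unshelve eexists (@RickardTower X (X i) (T i) (fun n => Xn n i) (X0 i)
  (fun n => projT1 (H1 n)) (fun n => projT1 (H2 n)) (fun n => cl (beta n i))
  (fun n => projT1 (H3 n)) _ _ _ S (fun n => cl (inj n)) cS (cl phi) _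
  (cl u) (cl v) T0) => //.
- by move=> n; have [] := projT2 (H3 n).
- by move=> n; have [] := projT2 (H3 n).
- by move=> n; have [] := projT2 (H3 n).
- move=> n; rewrite !cl_comp -cl_dscaleN1 cl_add; apply/clE/ephi.
Qed.

Section Facts.
Variables X T : 'I_r -> cplx L^c.
Hypothesis dbX : forall i, Db_mod (X i).
Hypothesis rk : rickard X T.

Lemma tower_of i : exists t : rickard_tower X (X i) (T i), True.
Proof. exact: rickard_towerP. Qed.

Lemma X_coh_ge : exists c, forall j, coh_ge c (X j).
Proof.
have H j : exists N : nat, forall c, c <= - N%:Z -> coh_ge c (X j).
  have [Y [/disoP[t it] bY _]] := dbX j; have [N hN] := bounded_coh_ge bY.
  by exists N => c le; apply: coh_ge_iso it (hN c le).
pose N j := projT1 (cid (H j)); exists (- (\max_j N j)%N%:Z) => j.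
have := projT2 (cid (H j)); rewrite -/(N j); apply.
by rewrite lerN2 lez_nat; apply: leq_bigmax.
Qed.

(** Smallness of X_j is available only against coproducts with cohomology bounded below, so one
    bound c must serve for all stages of the tower; the suspended coproduct uses c - 1. *)
Lemma X_T_hom0_lt m i j : m < 0 -> hom0 (shift m (X j)) (T i).
Proof.
move=> lt; have [t _] := tower_of i; have [c hc] := X_coh_ge.
(* Sigma Z n is made of Sigma^{m+1} X_j with m + 1 <= 0, whose cohomology still starts no lower than
   c. *)
have hY n : coh_ge c (rt_Y t n).
  elim: n => [|n IH]; first by rewrite rt_Y0.
  apply: coh_ge_tri (rt_tri t n) IH _ => a lta.
  apply/hom0_shift; apply: rt_Z_hom0 => k p ltp; apply/hom0_shift.
  have -> : - a - 1 - p = - (a + 1 + p) by rewrite !opprD.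
  by apply: (hc k (a + 1 + p)); move: lta ltp; clear; lia.
have hS : coh_ge c (rt_S t).
  by move=> a lta; apply: (hcoprod_hom0 (rt_coprod t)) => n; apply: hY.
have dbG : Db_mod (shift m (X j)) by apply: Db_mod_shift.
apply: (telescope_hom0 (rt_coprod t) (rt_phiE t) (rt_colim t)).
- exact: (Db_fin_supp (rt_coprod t) hS dbG).
- have hS1 : coh_ge (c - 1) (shift 1 (rt_S t)).
    by apply: coh_ge_shift; rewrite subrK.
  move=> x; have [N hN] :=
    Db_fin_supp (hcoprod_shift 1 (rt_coprod t)) hS1 dbG x.
  exists N => e he; apply: hN => n.
  by rewrite -hsh_comp he; case: ifP => _ //; rewrite hsh_0.
- by move=> n x; apply: rt_kill.
Qed.

Lemma X_T_hom0 p i j : 0 < p -> hom0 (X j) (shift p (T i)).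
Proof.
move=> lt; have /hom0_shift0/hom0_shift : hom0 (shift (- p) (X j)) (T i).
  by apply: X_T_hom0_lt; rewrite oppr_lt0.
by rewrite opprK add0r.
Qed.

Lemma Z_hom0 i (t : rickard_tower X (X i) (T i)) n p W :
  (forall j k, p < k -> hom0 (X j) (shift k W)) -> hom0 (rt_Z t n) (shift p W).
Proof.
move=> h; apply: rt_Z_hom0 => j m lt; apply/hom0_shift; apply: h.
by move: lt; clear; lia.
Qed.

(** A map from the telescope to Sigma W is determined by its restriction to X_i as soon as Hom(Z n,
    W) = 0. *)
Lemma T_T_hom0 p i j : 0 < p -> hom0 (T i) (shift p (T j)).
Proof.
move=> lt; have [t _] := tower_of i.
(* With W = Sigma^{p-1} T_j, maps from Z n to W amount to maps X_k -> Sigma^a T_j with a > p - 1 >=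
   0. *)
have H : hom0 (T i) (shift 1 (shift (p - 1) (T j))).
  move=> q; apply: (colim_hom0 (rt_coprod t) (rt_phiE t) (rt_colim t) (rt_tri t)).
    move=> n; apply: Z_hom0 => k a lta; apply: X_T_hom0.
    by move: lt lta; clear; lia.
  move: (q ** _); have -> : rt_Y t 0 = X i by apply: rt_Y0.
  move=> x; suff h : hom0 (X i) (shift 1 (shift (p - 1) (T j))) by exact: h.
  by apply/hom0_shiftD; rewrite subrKC; apply: X_T_hom0.
by move: H => /hom0_shiftD; rewrite subrKC.
Qed.

(** Descending induction on k, which starts where boundedness gives the vanishing. Maps Z n ->
    Sigma^k J involve only larger degrees, so every map X_i -> Sigma^k J extends to T_i and is
    therefore zero. *)
Lemma X_J_hom0 J : binj J ->
  (forall i k, 0 < k -> hom0 (T i) (shift k J)) ->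
  forall i k, 0 < k -> hom0 (X i) (shift k J).
Proof.
move=> bJ hT.
have H j : exists N : nat, forall k, N%:Z < k -> hom0 (X j) (shift k J).
  have [Y [/disoP[t it] bY _]] := dbX j; have [N hN] := bounded_hom0 bY bJ.
  by exists N => k lt; apply: hom0_iso it (hiso1 _) (hN k lt).
pose N j := projT1 (cid (H j)).
have hN j k : (\max_j N j)%N%:Z < k -> hom0 (X j) (shift k J).
  move=> lt; have := projT2 (cid (H j)); rewrite -/(N j); apply.
  by apply: le_lt_trans lt; rewrite lez_nat; apply: leq_bigmax.
suff S (d : nat) i k : (\max_j N j)%N%:Z - d%:Z < k -> 0 < k ->
    hom0 (X i) (shift k J).
  by move=> i k lt; apply: (S (\max_j N j)%N) => //; rewrite subrr.
elim: d i k => [|d IH] i k lt k0; first by apply: hN; rewrite subr0 in lt.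
move=> x; have [t _] := tower_of i.
have hZ n : hom0 (rt_Z t n) (shift k J).
  apply: Z_hom0 => j a lta; apply: IH; last exact: lt_trans lta.
  by move: lt lta; clear; lia.
have := colim_ext (rt_coprod t) (rt_phiE t) (rt_colim t) (rt_tri t) hZ.
move: (rt_u t ** rt_inj t 0%N); rewrite rt_Y0 => v /(_ x)[q ->].
by rewrite (hT i k k0 q) hcomp0l.
Qed.

(** The bound is quantified before J. Objects that admit such a uniform bound form a thick
    subcategory, and each X_i belongs to it with bound 0. *)
Lemma dual_J_bound : (forall Y, Db_mod Y <-> thick (fun Z => exists i, Z = X i) Y) ->
  exists c : nat, forall J, binj J ->
  (forall i k, 0 < k -> hom0 (T i) (shift k J)) ->
  forall k, c%:Z < k -> hom0 (stalk DL) (shift k J).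
Proof.
move=> thX.
pose P Y := exists c : nat, forall J, binj J ->
  (forall i k, 0 < k -> hom0 (T i) (shift k J)) ->
  forall k, c%:Z < k -> hom0 Y (shift k J).
have dbDL : Db_mod (stalk DL).
  exists (stalk DL); split.
  - by apply/disoP; exists (h1 _); apply: hiso1.
  - exists 0%N => i lt; rewrite /= /stalk_obj; case: eqP lt => [-> //|_ _ x].
    exact: rV0_eq0.
  - move=> i; rewrite /= /stalk_obj; case: ifP => _; apply: kfin_findim.
      exact: dual_kfin.
    by exists [::] => x; rewrite (rV0_eq0 x).
apply: ((thX _).1 dbDL P).
- apply: mk_triangulated.
  + move=> Y Z f [g [e1 e2]] [c hc]; exists c => J bJ hJ k lt.
    apply: hom0_iso (hiso1 _) (hc J bJ hJ k lt); by exists f; split; eassumption.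
  + exists (cone (cm_id (stalk DL))), 0%N => J _ _ k _ p.
    have aC := cone_acyclic (quasi_iso_id (stalk DL)).
    by rewrite -[p]hcomp1r (acyclic_hom0 aC (h1 _)) hcomp0r.
  + move=> n Y [c hc]; exists (c + `|n|)%N => J bJ hJ k lt.
    apply/hom0_shift; apply: hc => //; by move: lt; clear; lia.
  + move=> Y Z W f g h Tr [c hc] [d hd]; exists (c.+1 + d)%N => J bJ hJ k lt p.
    have [|q ->] := tri_ext (p := p) (tri_rot Tr).
      by apply: (hd J bJ hJ k _ (p ** g)); move: lt; clear; lia.
    suff h0 : hom0 (shift 1 Y) (shift k J) by rewrite (h0 q) hcomp0l.
    by apply/hom0_shift; apply: hc => //; move: lt; clear; lia.
- apply: mk_summand => Y Z s p e [c hc]; exists c => J bJ hJ k lt q.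
  by rewrite -[q]hcomp1r -e hcompA (hc J bJ hJ k lt (q ** p)) hcomp0l.
- move=> _ [i ->]; exists 0%N => J bJ hJ k lt.
  exact: X_J_hom0.
Qed.

End Facts.
End RickardTower.

(** * Generation of the perfect complexes *)

Section ChainMapSpan.
Variables (K : fieldType) (L : falgType K) (A J : cplx L^c).

Definition cm_lin c (f g : chmap A J) := cm_add (cm_scale c f) g.
Definition cm_functional (psi : chmap A J -> K) :=
  forall c f g, psi (cm_lin c f g) = c * psi f + psi g.

(** The property holds on a subspace of finite codimension in the chain maps. *)
Definition detected (Phi : chmap A J -> Prop) := exists n (psi : nat -> chmap A J -> K),
  (forall k, cm_functional (psi k)) /\
  forall f, (forall k, (k < n)%N -> psi k f = 0) -> Phi f.

Lemma detectedW (Phi Psi : chmap A J -> Prop) :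
  (forall f, Phi f -> Psi f) -> detected Phi -> detected Psi.
Proof. by move=> h [n [psi [l d]]]; exists n, psi; split=> // f /d/h. Qed.

Lemma detectedT : detected (fun _ => True).
Proof. by exists 0%N, (fun _ _ => 0); split=> // k c f g; rewrite mulr0 addr0. Qed.

Lemma detectedI (Phi Psi : chmap A J -> Prop) :
  detected Phi -> detected Psi -> detected (fun f => Phi f /\ Psi f).
Proof.
move=> [n [a [la da]]] [m [b [lb db]]].
exists (n + m)%N, (fun k => if (k < n)%N then a k else b (k - n)%N); split=> [k|f h].
  by case: ifP.
split; [apply: da => k lt | apply: db => k lt].
  by have := h k; rewrite lt; apply; apply: ltn_addr.
by have := h (n + k)%N; rewrite ltn_add2l lt ltnNge leq_addr addKn; apply.
Qed.

Lemma detected_degree i : kfin (A i) -> kfin (J i) ->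
  detected (fun f => forall x, f i x = 0).
Proof.
move=> [s hs] [t ht]; have [n [chi [lchi dchi]]] := kspan_separated t.
suff : detected (fun f => forall b, List.In b s -> f i b = 0).
  apply: detectedW => f h x; apply: (kspan_incl _ h (hs x)).
  split=> [|c y z ey ez]; first by rewrite raddf0.
  by rewrite linearP ey ez scaler0 addr0.
elim: s {hs} => [|b s IH]; first by apply: detectedW detectedT => f _ b [].
have : detected (fun f => f i b = 0).
  exists n, (fun k (f : chmap A J) => chi k (f i b)); split=> [k c f g|f h].
    exact: lchi.
  exact: (dchi _ (ht _) h).
move=> /detectedI/(_ IH); apply: detectedW => f [e h] d [<- //|]; exact: h.
Qed.

Lemma detected_zero : bounded A -> (forall i, kfin (A i)) ->
  (forall i, kfin (J i)) -> detected (fun f => Q f = hzero A J).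
Proof.
move=> [N hN] fA fJ.
suff S (m : nat) : detected (fun f => forall i, (`|i| < m)%N -> forall x, f i x = 0).
  apply: detectedW (S N.+1) => f h; apply: Q_eq => i x.
  by have [le|lt] := leqP `|i|%N N; [apply: h | rewrite (hN i lt x) !raddf0].
elim: m => [|m IH]; first by apply: detectedW detectedT.
have := detectedI IH (detectedI (detected_degree (fA m%:Z) (fJ m%:Z))
  (detected_degree (fA (- m%:Z)) (fJ (- m%:Z)))).
apply: detectedW => f [h [hp hn]] i; rewrite ltnS leq_eqVlt.
case/orP => [/eqP e|]; last exact: h.
have [->|->] // : i = m%:Z \/ i = - m%:Z by move: e; clear; lia.
Qed.

Fixpoint hspan (X Y : cplx L^c) (s : seq (Hom X Y)) (p : Hom X Y) : Prop :=
  if s is b :: s' then exists c, hspan s' (p +! hopp (b ** hscale c X))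
  else p = hzero X Y.

Lemma chmap_hspan n (psi : nat -> chmap A J -> K) (S : chmap A J -> Prop) :
  (forall k, cm_functional (psi k)) ->
  (forall c f g, S f -> S g -> S (cm_lin c f g)) ->
  (forall f, S f -> (forall k, (k < n)%N -> psi k f = 0) -> Q f = hzero A J) ->
  exists s, forall f, S f -> hspan s (Q f).
Proof.
elim: n psi S => [|n IH] psi S lpsi lS h.
  by exists [::] => f Sf; apply: h.
have [|||s hs] := IH (fun k => psi k.+1) (fun f => S f /\ psi 0%N f = 0).
- by [].
- move=> c f g [Sf ef] [Sg eg]; split; first exact: lS.
  by rewrite lpsi ef eg mulr0 addr0.
- by move=> f [Sf e0] e; apply: h => // -[|k lt] //; apply: e.
have [[b [Sb nb]]|nex] := pselect (exists b, S b /\ psi 0%N b != 0); last first.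
  exists s => f Sf; apply: hs; split=> //.
  have [->|ne] := eqVneq (psi 0%N f) 0; first by [].
  by case: nex; exists f.
exists (Q b :: s) => f Sf; exists (psi 0%N f / psi 0%N b).
set d := _ / _; have -> : Q f +! hopp (Q b ** hscale d A) = Q (cm_lin (- d) b f).
  rewrite -Q_comp -Q_opp add_Q; apply: Q_eq => i x /=.
  by rewrite linearZ /= kscalN scaleNr addrC.
apply: hs; split; first exact: lS.
by rewrite lpsi mulNr divfK // addNr.
Qed.

Lemma hom_finite : bounded A -> (forall i, kfin (A i)) -> binj J ->
  (forall i, kfin (J i)) -> exists s, forall p : Hom A J, hspan s p.
Proof.
move=> bA fA bJ fJ; have [n [psi [lpsi dpsi]]] := detected_zero bA fA fJ.
have [s hs] := @chmap_hspan n psi (fun=> True) lpsi (fun _ _ _ _ _ => I)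
  (fun f _ => dpsi f).
by exists s => p; have [f ->] := binj_Q p bJ; apply: hs.
Qed.
End ChainMapSpan.

Section InjectiveProducts.
Variable R : nzRingType.
Implicit Types A B J X Y : cplx R.

Lemma injective_prod (M N : lmodType R) :
  injective_module M -> injective_module N -> injective_module (M * N)%type.
Proof.
move=> iM iN A B u v uinj.
have l1 : linear (fun x => (v x).1) by move=> a x y; rewrite linearP.
have l2 : linear (fun x => (v x).2) by move=> a x y; rewrite linearP.
have [w1 h1] := iM _ _ u (mklin l1) uinj; have [w2 h2] := iN _ _ u (mklin l2) uinj.
have wl : linear (fun x => (w1 x, w2 x)) by move=> a x y; rewrite !linearP.
by exists (mklin wl) => x; rewrite /= h1 h2 /=; case: (v x).
Qed.

Lemma bounded_cone A B (u : chmap A B) : bounded A -> bounded B -> bounded (cone u).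
Proof.
move=> [N hN] [M hM]; exists (N + M).+1 => i lt [x y].
have -> : x = 0 by apply: hN; move: lt; clear; lia.
by have -> : y = 0 by apply: hM; move: lt; clear; lia.
Qed.

Lemma binj_cone A B (u : chmap A B) : binj A -> binj B -> binj (cone u).
Proof.
move=> [bA iA] [bB iB]; split; first exact: bounded_cone.
by move=> i; apply: injective_prod.
Qed.

Section Closed.
Variable P : cplx R -> Prop.
Hypotheses (tP : triangulated_subcat P) (sP : summand_closed P).

Lemma closed_cone_homotopic A B (u v : chmap A B) :
  homotopic u v -> P (cone u) -> P (cone v).
Proof.
move=> h; have h' : homotopic (cm_comp v (cm_id A)) (cm_comp (cm_id B) u).
  exact: homotopic_sym.
have [m [_ _ q]] := cone_mapP h'.
apply: (closed_iso tP (f := Q m)); apply: hiso_Q.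
by apply: q; apply: quasi_iso_id.
Qed.

Lemma closed_cone_quasi_iso A B (u : chmap A B) : quasi_iso u -> P (cone u).
Proof. by move=> q; apply: (closed_acyclic tP); apply: cone_acyclic. Qed.

Lemma closed_cone_in A B (u : chmap A B) : P A -> P (cone (cone_in u)).
Proof.
move=> pA; apply: (closed_iso tP (hiso_Q (rot_in_quasi_iso u))).
exact: closed_shift.
Qed.
End Closed.
End InjectiveProducts.

(** * Approximation of D(L) by complexes without maps from the T_i *)

Section Approximation.
Variables (K : fieldType) (L : falgType K) (r : nat).
Variables X T : 'I_r -> cplx L^c.
Notation DL := (dual L : rmodType L).
Hypothesis dbX : forall i, Db_mod (X i).
Hypothesis rk : rickard X T.

Definition good (J : cplx L^c) := binj J /\ forall i, kfin (J i).

Lemma good_T i : good (T i).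
Proof.
have [bT iT] := rk.2 i; split; first by split=> // k; have [] := iT k.
by move=> k; apply: fg_kfin; have [] := iT k.
Qed.

Lemma good_shift n J : good J -> good (shift n J).
Proof. by move=> [bJ fJ]; split=> [|i]; [apply: binj_shift | apply: fJ]. Qed.

Lemma good_cone A B (u : chmap A B) : good A -> good B -> good (cone u).
Proof.
move=> [bA fA] [bB fB]; split; first exact: binj_cone.
by move=> i; apply: kfin_prod.
Qed.

Lemma good_stalk : good (stalk DL).
Proof.
split; last first.
  move=> i; rewrite /= /stalk_obj; case: ifP => _; first exact: dual_kfin.
  by exists [::] => x; rewrite (rV0_eq0 x).
have [[N hN] iC] := binj_cell L 0.
split; last first.
  by move=> i; have := iC i; rewrite /= addr0.
by exists N => i lt x; have := hN i lt; rewrite /= addr0; apply.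
Qed.

(* [p] is a combination of the given maps with coefficients in the category. *)
Fixpoint pspan (a : int) (J : cplx L^c) (l : seq {i : 'I_r & Hom (shift a (T i)) J})
    j (p : Hom (shift a (T j)) J) : Prop :=
  if l is b :: l' then
    exists x : Hom (shift a (T j)) (shift a (T (tag b))),
      pspan l' (p +! hopp (tagged b ** x))
  else p = hzero _ _.

Lemma pspan_catl a J (l1 l2 : seq {i : 'I_r & Hom (shift a (T i)) J}) j
  (p : Hom (shift a (T j)) J) : pspan l1 p -> pspan (l1 ++ l2) p.
Proof.
elim: l1 p => [|b l1 IH] p /=; last by move=> [x /IH]; exists x.
move=> ->; elim: l2 => //= b l2 IH; exists (hzero _ _).
by rewrite hcomp0r haddNr.
Qed.

Lemma pspan_catr a J (l1 l2 : seq {i : 'I_r & Hom (shift a (T i)) J}) j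
  (p : Hom (shift a (T j)) J) : pspan l2 p -> pspan (l1 ++ l2) p.
Proof.
move=> h; elim: l1 => //= b l1 IH; exists (hzero _ _).
by rewrite hcomp0r hopp0 hadd0r.
Qed.

Lemma pspan_map a J J' (g : Hom J J') (l : seq {i : 'I_r & Hom (shift a (T i)) J}) j
  (p : Hom (shift a (T j)) J) : pspan l p ->
  pspan [seq Tagged (fun i => Hom (shift a (T i)) J') (g ** tagged b) | b <- l] (g ** p).
Proof.
elim: l p => [|b l IH] p /=; first by move=> ->; rewrite hcomp0r.
by move=> [x /IH]; rewrite hadd_compr hoppr hcompA; exists x.
Qed.

Lemma pspan_exists a J : good J ->
  exists l, forall j (p : Hom (shift a (T j)) J), pspan l p.
Proof.
move=> [bJ fJ].
suff [l hl] : exists l, forall j, j \in enum 'I_r ->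
    forall p : Hom (shift a (T j)) J, pspan l p.
  by exists l => j; apply: hl; rewrite mem_enum.
elim: (enum 'I_r) => [|i e [l hl]]; first by exists [::].
have [[bT _] fT] := good_shift a (good_T i).
have [s hs] := hom_finite bT fT bJ fJ.
exists ([seq Tagged (fun i => Hom (shift a (T i)) J) q | q <- s] ++ l) => j.
rewrite inE => /orP[/eqP ->|/hl h] p; last exact: pspan_catr.
apply: pspan_catl; have := hs p; elim: s p {hs} => //= b s IH p [c /IH].
by exists (hscale c _).
Qed.

Section Closed.
Variable P : cplx L^c -> Prop.
Hypotheses (tP : triangulated_subcat P) (sP : summand_closed P).
Hypothesis PT : forall i, P (nu_inv (T i)).

(** Stands for the statement that the images of J and J' under nu^{-1} agree modulo P, with a chain
    map as witness. *)
Definition conn J J' := exists w : chmap J J', P (cone (nu_map w)).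

Lemma conn_refl J : conn J J.
Proof.
exists (cm_id J); apply: (closed_cone_quasi_iso tP).
apply: quasi_iso_homotopic (quasi_iso_id _); apply: homotopic_eq => i x.
exact: hd_ext.
Qed.

Lemma conn_trans J J' J'' : conn J J' -> conn J' J'' -> conn J J''.
Proof.
move=> [w pw] [w' pw']; exists (cm_comp w' w).
apply: (closed_cone_homotopic tP) (closed_cone_comp tP pw pw').
by apply: homotopic_eq => i x; apply: hd_ext.
Qed.

(** The cone of the inclusion into a cone is the suspended source, here nu^{-1} of a shift of
    T_i. *)
Lemma conn_cone a i J (q : chmap (shift a (T i)) J) : conn J (cone q).
Proof.
exists (cone_in q).
apply: (@closed_cone_homotopic _ _ tP _ _ (cm_comp (nu_cone q) (cone_in (nu_map q)))).
  by apply: homotopic_eq => k x; apply: hd_ext.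
apply: closed_cone_comp => //; last exact/(closed_cone_quasi_iso tP)/nu_cone_quasi_iso.
apply: (closed_cone_in tP).
apply: (closed_iso tP (hiso_Q (nu_shift_quasi_iso a (T i)))).
exact: closed_shift.
Qed.

(** Induction on the length of a generating list of the maps from the Sigma^a T_j. Passing to the
    cone of one generator kills it, and the others still generate. *)
Lemma approx_step a J : good J ->
  (forall i b, b < a -> hom0 (shift b (T i)) J) ->
  exists J', [/\ good J', conn J J' &
    forall i b, b <= a -> hom0 (shift b (T i)) J'].
Proof.
move=> gJ h; have [l hl] := pspan_exists a gJ.
have [n sz] := ubnP (size l).
elim: n J l gJ h hl sz => // n IH J [|[i q] l] gJ h hl /= sz.
  exists J; split=> // [|i b]; first exact: conn_refl.
  by rewrite le_eqVlt => /orP[/eqP -> p|]; [apply: hl | apply: h].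
have [f ef] := binj_Q q gJ.1; pose g := Q (cone_in f).
(* No new maps arise: the obstruction lies in Hom(Sigma^b T_j, Sigma^{a+1} T_i), which is 0 as a + 1
   - b > 0. *)
have lift b j (p : Hom (shift b (T j)) (cone f)) : b <= a ->
    exists p', p = g ** p'.
  move=> le; apply: (tri_lift (tri_cone_rot f)).
  suff h0 : hom0 (shift b (T j)) (shift 1 (shift a (T i))) by apply: h0.
  apply/hom0_shiftD/hom0_shift; apply: (T_T_hom0 dbX rk).
  by move: le; clear; lia.
have gq : g ** q = hzero _ _ by rewrite ef; apply: (tri_comp0 (tri_cone f)).
pose gl := [seq Tagged (fun i => Hom (shift a (T i)) (cone f)) (g ** tagged b) | b <- l].
have [|||J' [gJ' cJ' hJ']] := IH (cone f) gl (good_cone f (good_shift a (good_T i)) gJ).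
- move=> j b lt p; have [p' ->] := lift b j p (ltW lt).
  by rewrite (h j b lt p') hcomp0r.
- move=> j p; have [p' ->] := lift a j p (lexx a); have [x hx] := hl j p'.
  by have := pspan_map g hx; rewrite hadd_compr hoppr hcompA gq hcomp0l hopp0 hadd0r.
- by rewrite size_map.
exists J'; split=> //; exact: conn_trans (conn_cone f) cJ'.
Qed.

(** A chain map w from D(L) to a suitable J is null-homotopic, so nu^{-1} w is null as well while
    its cone lies in P; this makes nu^{-1} D(L) = L a retract, up to shift, of that cone. *)
Lemma T_generates :
  (forall Y, Db_mod Y <-> thick (fun Z => exists i, Z = X i) Y) ->
  P (stalk (L^c)^o).
Proof.
move=> thX; have [c hc] := dual_J_bound dbX rk thX.
have H i : exists N : nat, forall b, b < - N%:Z -> hom0 (shift b (T i)) (stalk DL).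
  have [N hN] := bounded_hom0 (good_T i).1.1 good_stalk.1; exists N => b lt.
  apply/hom0_shift0/hom0_shift; apply: hN.
  by move: lt; clear; lia.
pose N i := projT1 (cid (H i)); pose M := (\max_i N i)%N.
(* Below degree -M there are no maps to begin with, and each round raises the limit by one; M + c +
   1 rounds cover all b <= c. *)
have [J [gJ [w pw] hJ]] : exists J, [/\ good J, conn (stalk DL) J &
    forall i b, b < - M%:Z + (M + c.+1)%:Z -> hom0 (shift b (T i)) J].
  elim: (M + c.+1)%N => [|n [J [gJ cJ hJ]]].
    exists (stalk DL); split; [exact: good_stalk | exact: conn_refl |].
    move=> i b; rewrite addr0 => lt; have := projT2 (cid (H i)); apply.
    by apply: lt_le_trans lt _; rewrite lerN2 lez_nat; apply: leq_bigmax.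
  have [J' [gJ' cJ' hJ']] := approx_step gJ hJ.
  exists J'; split=> // [|i b lt]; first exact: conn_trans cJ cJ'.
  by apply: hJ'; move: lt; clear; lia.
(* The bound is applied to Sigma^{-(c+1)} J: for k > 0, maps from T_i to its k-th shift are maps
   Sigma^{c+1-k} T_i -> J, with c + 1 - k <= c. *)
have h0 : hom0 (stalk DL) J.
  apply/hom0_shift0; rewrite -(subrr c.+1%:Z); apply/hom0_shiftD; apply: hc.
  - exact: binj_shift gJ.1.
  - move=> i k k0; apply/hom0_shiftD; have -> : k - c.+1%:Z = 0 - (c.+1%:Z - k).
      by rewrite sub0r opprB.
    by apply/hom0_shift/hom0_shift0; apply: hJ; move: k0; clear; lia.
  - by rewrite ltz_nat.
apply: (closed_nu_dual sP); apply: (closed_null tP sP _ pw).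
apply: etrans (Q_homotopic (nu_map_homotopic
  (kinj_homotopic (binj_kinj gJ.1) (h0 (Q w))))) _.
by apply: Q_eq => i x; apply: hd_ext.
Qed.
End Closed.
End Approximation.

(** * The t-structure generated by small objects *)

Section Aisle.
Variable R : nzRingType.
Implicit Types J M N W : cplx R.

(** Maps Y 0 -> W extend to T, and maps T -> Sigma W that vanish on Y 0 are zero; the long exact
    sequence leaves nothing for the cone C. *)
Lemma colim_cone_hom0 (Y : nat -> cplx R) S (inj : forall n, Hom (Y n) S)
    (beta : forall n, Hom (Y n) (Y n.+1)) (phi : Hom S S) T (u : Hom S T)
    (v : Hom T (shift 1 S)) (Z : nat -> cplx R)
    (alpha : forall n, Hom (Z n) (Y n)) (gamma : forall n, Hom (Y n.+1) (shift 1 (Z n)))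
    C (k : Hom T C) (l : Hom C (shift 1 (Y 0%N))) W :
  hcoprod inj -> (forall n, phi ** inj n = inj n +! hopp (inj n.+1 ** beta n)) ->
  tri phi u v -> (forall n, tri (alpha n) (beta n) (gamma n)) ->
  (forall n, hom0 (Z n) W) -> tri (u ** inj 0%N) k l -> hom0 C (shift 1 W).
Proof.
move=> cS phiE tT tY Z0 t p.
have [|s ->] := tri_ext (p := p) (tri_rot t).
  apply: (colim_hom0 cS phiE tT tY Z0).
  by rewrite -hcompA (tri_comp0 t) hcomp0r.
have [x ->] := hsh_full s; have [q ->] := colim_ext cS phiE tT tY Z0 x.
rewrite hsh_comp -hcompA -[hsh 1 (u ** _)]hoppK hoppl.
by rewrite (tri_comp0 (tri_rot (tri_rot t))) hopp0 hcomp0r.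
Qed.

Variables (I : Type) (G : I -> cplx R).
Hypothesis kG : forall i m, kproj (shift m (G i)).
Hypothesis sG : forall i, countably_small (G i).

Definition coaisle N := forall i m, m < 0 -> hom0 (G i) (shift m N).
Definition aisle M := forall N, coaisle N -> hom0 M (shift (- 1) N).

(* Indexing by chain maps rather than by morphisms of the derived category
   keeps the index set small. *)
Definition attach_index J := {classic {p : I * nat & chmap (shift (p.2%:Z - 1) (G p.1)) J}}.
Definition attach_cell J (t : attach_index J) := shift ((tag t).2%:Z - 1) (G (tag t).1).
Definition attach_out J (t : attach_index J) : chmap (attach_cell t) J := tagged t.
Definition attach_map J : chmap (ds (@attach_cell J)) J :=
  ds_out (@attach_out J).
Definition attach J := cone (attach_map J).

Lemma attach_out_kill J (t : attach_index J) :
  Q (cone_in (attach_map J)) ** Q (attach_out t) = hzero _ _.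
Proof.
have <- : Q (attach_map J) ** Q (ds_in (@attach_cell J) t) = Q (attach_out t).
  by rewrite -Q_comp; apply: Q_eq => a y; apply: ds_out_in.
by rewrite hcompA (tri_comp0 (tri_cone _)) hcomp0l.
Qed.

Lemma attach_kill J i (m : nat) (x : Hom (shift (m%:Z - 1) (G i)) J) :
  Q (cone_in (attach_map J)) ** x = hzero _ _.
Proof.
have [f ->] := kproj_Q x (@kG _ _).
exact: (attach_out_kill (Tagged (fun p : I * nat =>
  chmap (shift (p.2%:Z - 1) (G p.1)) J) (i := (i, m)) f)).
Qed.

(** A small object argument: the colimit T receives no maps from the killed shifts by smallness, and
    the cone of Y 0 -> T is left orthogonal to whatever the attached cells are. *)
Lemma aisle_truncation M : exists M' N (f : Hom M' M) (g : Hom M (shift (- 1) N)) h,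
  [/\ aisle M', coaisle N & tri f g h].
Proof.
(* Starting at Sigma^{-1} M gives the triangle C -> M -> Sigma T after rotation, with N = Sigma^2 T.
   Hence the exponents m - 1 >= -1 of the cells: Hom(G_i, Sigma^k N) with k < 0 is Hom(Sigma^{-k-2}
   G_i, T). *)
pose Y n := iter n attach (shift (- 1) M).
pose beta n : chmap (Y n) (Y n.+1) := cone_in (attach_map (Y n)).
pose inj n := ds_in Y n.
pose phi := ds_out (fun n => cm_add (inj n) (cm_opp (cm_comp (inj n.+1) (beta n)))).
have phiE n : Q phi ** Q (inj n) = Q (inj n) +! hopp (Q (inj n.+1) ** Q (beta n)).
  rewrite -!Q_comp -Q_opp add_Q; apply: Q_eq; exact: ds_out_in.
pose T := cone phi; pose u := Q (cone_in phi).
have T0 i (m : nat) : hom0 (shift (m%:Z - 1) (G i)) T.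
  have sG' : countably_small (shift (m%:Z - 1) (G i)) by exact: countably_small_sh.
  apply: (telescope_hom0 (ds_coprod Y) phiE (tri_cone phi)).
  - by apply: sG'; apply: ds_coprod.
  - move=> x; have [N hN] := sG' _ _ _ (hcoprod_shift 1 (ds_coprod Y)) x.
    exists N => e he; apply: hN => n.
    by rewrite -hsh_comp he; case: ifP => _ //; rewrite hsh_0.
  - by move=> n x; apply: attach_kill.
have [C [k [l t]]] := tri_complete (u ** Q (inj 0%N)).
pose s := Q (sh0 M) ** Q (shm (subrr 1) M) : Hom (shift 1 (shift (- 1) M)) M.
have is' : hiso s.
  by apply: hiso_comp; apply: hiso_Q; [exact: sh0_quasi_iso | exact: shm_quasi_iso].
have [s' [e1 e2]] := is'.
have iN := shN_iso 1 (shift 1 T); have [r [r1 r2]] := iN.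
have t' := tri_rot (tri_rot t).
exists C, (shift 1 (shift 1 T)), (s ** l),
  (r ** hopp (hsh 1 (u ** Q (inj 0%N))) ** s'), (hopp (hsh 1 k) ** shN 1 (shift 1 T)).
split.
- move=> N hN; apply: (hom0_shiftD 1 (- 2%:Z) C N).1.
  apply: (colim_cone_hom0 (ds_coprod Y) phiE (tri_cone phi) _ _ t).
    by move=> n; apply: tri_cone.
  move=> n; apply: (hcoprod_hom0 (ds_coprod _)) => -[[i m] f].
  apply/hom0_shift; apply: hN; rewrite /=; clear; lia.
- move=> i m lt; apply/hom0_shiftD/hom0_shiftD.
  have [q eq] : exists q : nat, 0 - (q%:Z - 1) = m + 1 + 1.
    by exists (`|m|.-1)%N; move: lt; clear; lia.
  by rewrite -eq; apply/hom0_shift/hom0_shift0.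
- apply: (tri_iso (a := h1 _) (b := s') (c := shN 1 (shift 1 T))) t'.
  + exact: hiso1.
  + by exists s; split.
  + exact: iN.
  + by rewrite hcompA e1 hcomp1l hcomp1r.
  + by rewrite !hcompA r2 hcomp1l.
  + by rewrite hsh_1 hcomp1l.
Qed.

Lemma coaisle_unshift N : coaisle N -> coaisle (shift (- 1) N).
Proof.
by move=> hN i m lt; apply/hom0_shiftD; apply: hN; move: lt; clear; lia.
Qed.

Lemma aisle_tstructure : is_tstructure aisle coaisle.
Proof.
split; last first.
- move=> M; have [M' [N [f [g [h [aM cN t]]]]]] := aisle_truncation M.
  exists M', N, (rep f), (rep g), (rep h); split=> //.
  by apply/triangleP; rewrite !repK.
- by move=> M N f hM hN; apply: (hom0P _ _).2; apply: hM.
- exact: coaisle_unshift.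
- move=> M hM N hN; apply/hom0_shift/hom0_shiftD.
  exact/hM/coaisle_unshift.
split=> M N /disoP[f [g [e1 e2]]] h; have ig : hiso g by exists f.
  by move=> V /h; apply: hom0_iso ig (hiso1 _).
by move=> i m lt; apply: hom0_iso (hiso1 _) (hiso_sh m ig) (h i m lt).
Qed.
End Aisle.

(** A finite coproduct is a product too: the identity is the sum of the idempotents inj j pr, added
    one index at a time. *)
Lemma hcoprod_fin_hom0 (R : nzRingType) (I : finType) (A : I -> cplx R) S
    (inj : forall i, Hom (A i) S) W m :
  hcoprod inj -> (forall i, hom0 W (shift m (A i))) -> hom0 W (shift m S).
Proof.
move=> cS h x.
suff H s (e : Hom S S) : uniq s ->
    (forall i, e ** inj i = if i \in s then inj i else hzero _ _) ->
    hsh m e ** x = hzero _ _.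
  rewrite -[x]hcomp1l -hsh_1; apply: (H (enum I)) (enum_uniq I) _ => i.
  by rewrite mem_enum hcomp1l.
elim: s e => [|j s IH] e /= => [_ he|/andP[js us] he].
  have -> : e = hzero _ _ by apply: cS.2 => i; rewrite he hcomp0l.
  by rewrite hsh_0 hcomp0l.
have [pr [pr1 pr0]] := hcoprod_proj j cS.
have [e' he'] := cS.1 _ (fun i => if i \in s then inj i else hzero _ _).
have -> : e = e' +! inj j ** pr.
  apply: cS.2 => i; rewrite he hadd_compl he' -hcompA inE.
  have [->|ne] := eqVneq i j; first by rewrite (negbTE js) pr1 hcomp1r hadd0l.
  by rewrite pr0 // hcomp0r hadd0r.
rewrite hsh_add hadd_compl (IH _ us he') hadd0l hsh_comp -hcompA.
by rewrite (h j (hsh m pr ** x)) hcomp0r.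
Qed.

(** * The complexes nu^{-1} T_i and the equivalence *)

Section NuInverseTilting.
Variables (K : fieldType) (L : falgType K) (r : nat).
Variables X T : 'I_r -> cplx L^c.
Hypothesis dbX : forall i, Db_mod (X i).
Hypothesis rk : rickard X T.

Lemma T_dual_summand i k : dual_summand (T i k).
Proof.
have [iT fT] := (rk.2 i).2 k; apply: injective_dual_summand => //.
exact: fg_kfin.
Qed.

Lemma nuT_shift_kproj i m : kproj (shift m (nu_inv (T i))).
Proof.
apply: bounded_kproj.
  by apply: bounded_shift; apply: nu_bounded; exact: (rk.2 i).1.
move=> k; have [n [a [b ab]]] := T_dual_summand i (k + m).
exact: (homdual_projective ab).
Qed.

(** The terms of nu^{-1} T_i are summands of powers of L, and the complex is bounded. *)
Lemma closed_nuT (Q0 : cplx L^c -> Prop) : triangulated_subcat Q0 ->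
  summand_closed Q0 -> Q0 (stalk (L^c)^o) -> forall i, Q0 (nu_inv (T i)).
Proof.
move=> tQ sQ qL i; apply: (closed_bounded tQ).
  by apply: nu_bounded; exact: (rk.2 i).1.
move=> k; have [n [a [b ab]]] := T_dual_summand i k.
exact: (closed_stalk tQ sQ (homdual_basis ab)).
Qed.

(** By projectivity the map is a chain map, and by fullness it is the image of a map T_i -> Sigma^m
    T_j. That one is null-homotopic because its target is a bounded complex of injectives, and
    nu^{-1} carries the homotopy over. *)
Lemma nuT_hom0 i j m : 0 < m -> hom0 (nu_inv (T i)) (shift m (nu_inv (T j))).
Proof.
move=> m0 p.
have kP : kproj (nu_inv (T i)).
  apply: bounded_kproj; first by apply: nu_bounded; exact: (rk.2 i).1.
  move=> k; have [n [a [b ab]]] := T_dual_summand i k.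
  exact: (homdual_projective ab).
have [f ->] := kproj_Q p kP.
have [F hF] := nu_full (cm_comp (nu_shift m (T j)) f) (T_dual_summand i).
apply: (hiso_mono (hiso_Q (nu_shift_quasi_iso m (T j)))).
rewrite -Q_comp hcomp0r (Q_eq hF).
have kJ : kinj (shift m (T j)) by apply: binj_kinj; exact: (good_shift m (good_T rk j)).1.
have F0 : Q F = hzero _ _ by apply: (T_T_hom0 dbX rk).
rewrite (Q_homotopic (nu_map_homotopic (kinj_homotopic kJ F0))).
by apply: Q_eq => k x; apply: hd_ext.
Qed.

Lemma nuT_small i : countably_small (nu_inv (T i)).
Proof.
apply: closed_nuT.
- exact: countably_small_triangulated.
- exact: countably_small_summand.
- exact: countably_small_stalk.
Qed.
End NuInverseTilting.

Theorem proposition3p7 (K : closedFieldType) (L : falgType K) (r : nat)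
    (X T : 'I_r -> cplx L^c) (P : cplx L^c)
    (inj : forall i, dhom (nu_inv (T i)) P) :
  basic L -> simple_minded X -> rickard X T -> is_coprod inj ->
  (tilting_complex P <->
   exists C_le C_ge : cplx L^c -> Prop,
     is_tstructure C_le C_ge /\ heart C_le C_ge P).
Proof.
move=> _ [_ dbX _ _ thX] rk /is_coprodP cP; pose G i := nu_inv (T i).
have PG (Q0 : cplx L^c -> Prop) : triangulated_subcat Q0 -> summand_closed Q0 ->
    Q0 P -> forall i, Q0 (G i).
  move=> tQ sQ qP i; have [pr [e _]] := hcoprod_proj i cP.
  exact: (closed_retract sQ e qP).
have LP (Q0 : cplx L^c -> Prop) : triangulated_subcat Q0 -> summand_closed Q0 ->
    Q0 (stalk (L^c)^o) -> Q0 P.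
  by move=> tQ sQ qL; apply: (closed_coprod tQ cP); apply: (closed_nuT rk tQ sQ qL).
have PL (Q0 : cplx L^c -> Prop) : triangulated_subcat Q0 -> summand_closed Q0 ->
    Q0 P -> Q0 (stalk (L^c)^o).
  move=> tQ sQ qP; apply: (T_generates dbX rk tQ sQ) thX.
  exact: PG.
have P_pos m : 0 < m -> hom0 P (shift m P).
  move=> m0; apply: (hcoprod_fin_hom0 cP) => j; apply: (hcoprod_hom0 cP) => i.
  exact: (nuT_hom0 dbX rk).
split=> [[perP hP genP]|[C_le [C_ge [[[_ fge] _ ge_sh orth _] [Ple Pge]]]]].
  have kG i m : kproj (shift m (G i)) by apply: (nuT_shift_kproj rk).
  have sG i : countably_small (G i) by apply: (nuT_small rk).
  exists (aisle G), (coaisle G); split; first exact: aisle_tstructure kG sG.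
  split=> [N hN|i m m0].
    apply: (hcoprod_hom0 cP) => i; exact: hN.
  (* G_i is a retract of P, so the vanishing of maps out of P passes to it. *)
  have [pr [e _]] := hcoprod_proj i cP.
  have h : hom0 P (shift m P).
    by apply/hom0P; apply: hP; rewrite lt_eqF.
  move=> p; rewrite -[p]hcomp1r -e hcompA.
  by rewrite (h (p ** pr)) hcomp0l.
split.
- by move=> Q0 tQ sQ gQ; apply: LP => //; apply: gQ.
- move=> m m0; apply/hom0P; have [mlt|mgt|e] := ltgtP m 0.
  (* Orthogonality is available against Sigma^{-1} C_ge, so for m < 0 the object Sigma^m P is
     written as Sigma^{-1} of Sigma^{-|m+1|} P, which stays in C_ge. *)
  + have sh (n : nat) : C_ge (shift (- n%:Z) P).
      elim: n => [|n /ge_sh IH].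
        apply: fge Pge; apply/disoP; rewrite oppr0.
        have [t [e1 e2]] := hiso_Q (sh0_quasi_iso P).
        by exists t, (Q (sh0 P)).
      apply: fge IH; apply/disoP.
      have e : - 1 - n%:Z = - n.+1%:Z by rewrite intS opprD.
      by exists (Q (shm e P)); apply/hiso_Q/shm_quasi_iso.
    have h : hom0 P (shift (- 1) (shift (- `|m + 1|%:Z) P)).
      by apply/hom0P => f; apply: orth Ple (sh _).
    have <- : - 1 - `|m + 1|%:Z = m by move: mlt; clear; lia.
    exact/hom0_shiftD.
  + exact: P_pos.
  + by rewrite e eqxx in m0.
- move=> Y; split=> h Q0 tQ sQ gQ; apply: h => // _ ->; [apply: LP|apply: PL] => //; exact: gQ.
Qed.
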